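(* Let $\alpha\ge\beta\ge-\frac12$ with $\alpha>-\frac12$, and let $1\le p<2<q\le\infty$. Write $L^r=L^r(\mathbb{R},A_{\alpha,\beta}(|x|)\,dx)$. Then $$L^p\ast_{\alpha,\beta}L^2\subset L^2\qquad\text{and}\qquad L^2\ast_{\alpha,\beta}L^2\subset L^q,$$ i.e. there exist constants $C_p,C_q>0$ (depending on $p$, resp. $q$, and on $\alpha,\beta$) such that $\|f\ast_{\alpha,\beta}g\|_2\le C_p\|f\|_p\|g\|_2$ for all $f\in L^p$, $g\in L^2$, and $\|f\ast_{\alpha,\beta}g\|_q\le C_q\|f\|_2\|g\|_2$ for all $f,g\in L^2$.
   Context: Set $\rho=\alpha+\beta+1$ and $A_{\alpha,\beta}(z)=(\sinh z)^{2\alpha+1}(\cosh z)^{2\beta+1}$ for $z\ge0$. Generalized translations: $\tau_x^{(\alpha,\beta)}f(y)=\int_{\mathbb{R}}f(z)\,d\mu_{x,y}^{(\alpha,\beta)}(z)$. Convolution: $(f\ast_{\alpha,\beta}g)(x)=\int_{\mathbb{R}}\tau_x^{(\alpha,\beta)}f(-y)\,g(y)\,A_{\alpha,\beta}(|y|)\,dy$, for continuous compactly supported $f,g$, and extended to the Lebesgue spaces in question by density via the stated inequalities. The real measures $\mu_{x,y}^{(\alpha,\beta)}$ on $\mathbb{R}$ are defined as follows. If $y=0$, $\mu_{x,y}^{(\alpha,\beta)}=\delta_x$; if $x=0$, $\mu_{x,y}^{(\alpha,\beta)}=\delta_y$ (Dirac masses). If $xy\ne0$ and $\beta>-\frac12$,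 $d\mu_{x,y}^{(\alpha,\beta)}(z)=\mathcal{K}_{\alpha,\beta}(x,y,z)\,A_{\alpha,\beta}(|z|)\,dz$. If $xy\neq0$ and $\alpha>\beta=-\frac12$, $\mu_{x,y}^{(\alpha,-1/2)}$ is the image of $\mu_{x/2,y/2}^{(\alpha,\alpha)}$ under $z\mapsto2z$. The kernels $\mathcal{K}_{\alpha,\beta}(x,y,z)$ vanish unless $x,y,z\ne0$ and $\bigl||x|-|y|\bigr|<|z|<|x|+|y|$, in which case: • for $\alpha>\beta>-\frac12$, $$\mathcal{K}_{\alpha,\beta}(x,y,z)=M_{\alpha,\beta}\,|\sinh x\sinh y\sinh z|^{-2\alpha}\int_0^\pi h(x,y,z,\chi)_+^{\alpha-\beta-1}\Bigl[1-\sigma_{x,y,z}^\chi+\sigma_{x,z,y}^\chi+\sigma_{z,y,x}^\chi+\frac{\rho}{\beta+\frac12}\coth x\coth y\coth z\,(\sin\chi)^2\Bigr](\sin\chi)^{2\beta}\,d\chi,$$ where $M_{\alpha,\beta}=\frac{\Gamma(\alpha+1)}{\sqrt{\pi}\,\Gamma(\alpha-\beta)\,\Gamma(\beta+\frac12)}$, $h(x,y,z,\chi)=1-\cosh^2x-\cosh^2y-\cosh^2z+2\cosh x\cosh y\cosh z\cos\chi$, $h_+^s$ means $h^s$ where $h>0$ and $0$ where $h\le0$, and $\sigma_{a,b,c}^\chi=\frac{\cosh a\cosh b-\cosh c\cos\chi}{\sinh a\sinh b}$ for $ab\neq0$; • for $\alpha=\beta>-\frac12$, with $M_{\alpha,\alpha}=\frac{\Gamma(\alpha+1)}{\sqrt\pi\,\Gamma(\alpha+\frac12)}$,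 $$\mathcal{K}_{\alpha,\alpha}(x,y,z)=2^{4\alpha+2}M_{\alpha,\alpha}\,e^{x+y-z}\,\frac{\bigl[\sinh(x+y+z)\sinh(-x+y+z)\sinh(x-y+z)\sinh(x+y-z)\bigr]^{\alpha-\frac12}}{|\sinh2x\,\sinh2y\,\sinh2z|^{2\alpha}}\cdot\frac{\sinh(x+y+z)\sinh(-x+y+z)\sinh(x-y+z)}{\sinh2x\,\sinh2y\,\sinh2z}.$$ *)

(* Defs.v *)
From HB Require Import structures.
From mathcomp Require Import all_boot all_order all_algebra.
From mathcomp Require Import all_classical all_reals all_analysis.
From mathcomp Require Import measurable_realfun.
From mathcomp Require Import complex.

Set Implicit Arguments.
Unset Strict Implicit.
Unset Printing Implicit Defensive.

Import Order.TTheory GRing.Theory Num.Theory.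
Import numFieldNormedType.Exports.

Local Open Scope classical_set_scope.
Local Open Scope ring_scope.
Local Open Scope complex_scope.

Definition sinh {R : realType} (x : R) : R := (expR x - expR (- x)) / 2.
Definition cosh {R : realType} (x : R) : R := (expR x + expR (- x)) / 2.
Definition coth {R : realType} (x : R) : R := cosh x / sinh x.

Definition Gamma {R : realType} (s : R) : R :=
  \int[lebesgue_measure]_(t in `]0, +oo[) (t `^ (s - 1) * expR (- t)).

Definition jacobi_weight {R : realType} (alpha beta z : R) : R :=
  sinh z `^ (2 * alpha + 1) * cosh z `^ (2 * beta + 1).

Definition hfun {R : realType} (x y z chi : R) : R :=
  1 - cosh x ^+ 2 - cosh y ^+ 2 - cosh z ^+ 2
  + 2 * cosh x * cosh y * cosh z * cos chi.

(* h_+^s; this differs from [Num.max 0 h `^ s] when [s = 0], since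
   [0 `^ 0 = 1]. *)
Definition pos_powR {R : realType} (h s : R) : R :=
  if 0 < h then h `^ s else 0.

Definition sigma {R : realType} (chi a b c : R) : R :=
  (cosh a * cosh b - cosh c * cos chi) / (sinh a * sinh b).

Definition triangle {R : realType} (x y z : R) : bool :=
  [&& x != 0, y != 0, z != 0,
      `| `|x| - `|y| | < `|z| & `|z| < `|x| + `|y|].

Definition kernel_gt {R : realType} (alpha beta x y z : R) : R :=
  Gamma (alpha + 1) /
    (Num.sqrt pi * Gamma (alpha - beta) * Gamma (beta + 2^-1)) *
  `|sinh x * sinh y * sinh z| `^ (- (2 * alpha)) *
  \int[lebesgue_measure]_(chi in `]0, pi[)
    (pos_powR (hfun x y z chi) (alpha - beta - 1) *
     (1 - sigma chi x y z + sigma chi x z y + sigma chi z y x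
      + (alpha + beta + 1) / (beta + 2^-1) *
        coth x * coth y * coth z * sin chi ^+ 2) *
     sin chi `^ (2 * beta)).

Definition kernel_eq {R : realType} (alpha x y z : R) : R :=
  2 `^ (4 * alpha + 2) *
  (Gamma (alpha + 1) / (Num.sqrt pi * Gamma (alpha + 2^-1))) *
  expR (x + y - z) *
  ((sinh (x + y + z) * sinh (- x + y + z) *
    sinh (x - y + z) * sinh (x + y - z)) `^ (alpha - 2^-1) /
   `|sinh (2 * x) * sinh (2 * y) * sinh (2 * z)| `^ (2 * alpha)) *
  (sinh (x + y + z) * sinh (- x + y + z) * sinh (x - y + z) /
   (sinh (2 * x) * sinh (2 * y) * sinh (2 * z))).

(* Meaningful for [alpha >= beta > -1/2]. *)
Definition kernel {R : realType} (alpha beta x y z : R) : R :=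
  if triangle x y z then
    if alpha == beta then kernel_eq alpha x y z
    else kernel_gt alpha beta x y z
  else 0.

Definition cintegral {R : realType} (f : R -> R[i]) : R[i] :=
  (\int[lebesgue_measure]_x complex.Re (f x)) +i*
  (\int[lebesgue_measure]_x complex.Im (f x)).

(* The real measures mu_(x,y)^(alpha,beta) are signed; they are given by the
   functionals f |-> \int f d mu_(x,y) that they define.  The first functional
   is the integral against K_(alpha,beta)(x,y,z) A_(alpha,beta)(|z|) dz. *)
Definition mu_ac_integral {R : realType} (alpha beta x y : R)
    (f : R -> R[i]) : R[i] :=
  cintegral (fun z =>
    f z * (kernel alpha beta x y z * jacobi_weight alpha beta `|z|)%:C).

(* The last case, reached for [beta = -1/2], is the integral against the image
   of mu_(x/2,y/2)^(alpha,alpha) under [z |-> 2 z]. *)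
Definition mu_integral {R : realType} (alpha beta x y : R)
    (f : R -> R[i]) : R[i] :=
  if y == 0 then f x
  else if x == 0 then f y
  else if - 2^-1 < beta then mu_ac_integral alpha beta x y f
  else mu_ac_integral alpha alpha (x / 2) (y / 2) (fun z => f (2 * z)).

Definition translation {R : realType} (alpha beta x : R) (f : R -> R[i])
    (y : R) : R[i] :=
  mu_integral alpha beta x y f.

Definition convolution {R : realType} (alpha beta : R) (f g : R -> R[i])
    (x : R) : R[i] :=
  cintegral (fun y => translation alpha beta x f (- y) * g y *
                      (jacobi_weight alpha beta `|y|)%:C).

Definition jacobi_measure {R : realType} (alpha beta : R)
    (S : set (measurableTypeR R)) : \bar R :=
  (\int[lebesgue_measure]_(x in S) (jacobi_weight alpha beta `|x|)%:E)%E.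

Lemma jacobi_weight_ge0 {R : realType} (alpha beta z : R) :
  0 <= jacobi_weight alpha beta z.
Proof. by rewrite mulr_ge0 ?powR_ge0. Qed.

Lemma measurable_jacobi_weight {R : realType} (alpha beta : R) :
  measurable_fun [set: R] (fun x : R => jacobi_weight alpha beta `|x|).
Proof.
have mN : measurable_fun [set: R] (fun x : R => expR (- `|x|)).
  apply: measurableT_comp => //; exact: measurableT_comp.
have mP : measurable_fun [set: R] (fun x : R => expR `|x|).
  exact: measurableT_comp.
apply: measurable_funM.
- apply: (measurableT_comp (measurable_powR _)).
  by apply: measurable_funM => //; apply: measurable_funB.
- apply: (measurableT_comp (measurable_powR _)).
  by apply: measurable_funM => //; apply: measurable_funD.
Qed.

Lemma jacobi_measure0 {R : realType} (alpha beta : R) :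
  jacobi_measure alpha beta set0 = 0%E.
Proof. by rewrite /jacobi_measure integral_set0. Qed.

Lemma jacobi_measure_ge0 {R : realType} (alpha beta : R) S :
  (0 <= jacobi_measure alpha beta S)%E.
Proof.
by apply: integral_ge0 => x _; rewrite lee_fin jacobi_weight_ge0.
Qed.

Lemma jacobi_measure_semi_sigma_additive {R : realType} (alpha beta : R) :
  semi_sigma_additive (jacobi_measure alpha beta).
Proof.
move=> /= F mF tF mUF; rewrite /jacobi_measure; apply: cvg_toP.
  apply: ereal_nondecreasing_is_cvgn => m n mn.
  apply: lee_sum_nneg_natr => // k _ _.
  by apply: integral_ge0 => x _; rewrite lee_fin jacobi_weight_ge0.
rewrite ge0_integral_bigcup//=.
- apply: measurable_funTS; apply: measurableT_comp => //.
  exact: measurable_jacobi_weight.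
- by move=> x _; rewrite lee_fin jacobi_weight_ge0.
Qed.

HB.instance Definition _ (R : realType) (alpha beta : R) :=
  isMeasure.Build _ _ _ (jacobi_measure alpha beta)
    (jacobi_measure0 alpha beta) (jacobi_measure_ge0 alpha beta)
    (@jacobi_measure_semi_sigma_additive R alpha beta).

Definition cLnorm {R : realType} (alpha beta : R) (p : \bar R)
    (f : R -> R[i]) : \bar R :=
  Lnorm (jacobi_measure alpha beta) p
    (fun x => (ComplexField.Normc.normc (f x))%:E).

Definition inL {R : realType} (alpha beta : R) (p : \bar R)
    (f : R -> R[i]) : Prop :=
  [/\ measurable_fun [set: R] (fun x => complex.Re (f x)),
      measurable_fun [set: R] (fun x => complex.Im (f x)) &
      (cLnorm alpha beta p f < +oo)%E].

Definition cvg_L {R : realType} (alpha beta : R) (p : \bar R)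
    (F : nat -> R -> R[i]) (f : R -> R[i]) : Prop :=
  [/\ forall n, inL alpha beta p (F n), inL alpha beta p f &
      (fun n => cLnorm alpha beta p (fun x => F n x - f x)) @ \oo --> 0%E].

Definition Cc {R : realType} (f : R -> R[i]) : Prop :=
  [/\ continuous (fun x => complex.Re (f x)),
      continuous (fun x => complex.Im (f x)) &
      compact (closure [set x | f x != 0])].

(* [h] is the value at [(f, g)] of the extension by density of the convolution
   of continuous compactly supported functions to a continuous map
   L^p x L^r -> L^s: [(f, g)] is a limit of pairs of such functions, and along
   all such approximations the convolutions tend to [h] in L^s. *)
Definition is_convolution {R : realType} (alpha beta : R) (p r s : \bar R)
    (f g h : R -> R[i]) : Prop :=
  (exists F G : nat -> R -> R[i],
    [/\ forall n, Cc (F n), forall n, Cc (G n),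
        cvg_L alpha beta p F f & cvg_L alpha beta r G g]) /\
  (forall F G : nat -> R -> R[i],
    (forall n, Cc (F n)) -> (forall n, Cc (G n)) ->
    cvg_L alpha beta p F f -> cvg_L alpha beta r G g ->
    cvg_L alpha beta s (fun n => convolution alpha beta (F n) (G n)) h).

(* Main.v *)
(* Up to a constant, the density of mu_(x,y) with respect to A(|z|) dz is dominated
   by an explicit positive kernel W(x, y, z), symmetric and even in each variable.
   With the weight phi(x) = |sinh x|^-e (cosh x)^-(beta + 1/2), 0 <= e < alpha + 1/2,
   the kernel satisfies the Schur inequality
     int W(x, y, z) phi(z) A(|z|) dz <= C phi(x) phi(y),
   whence, by AM-GM and Cauchy-Schwarz, the convolution |u| * |v| for W is at most
   C phi(x) |u|_2 |v|_2 pointwise, and its L^2 norm is at most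
   C (int |u| phi A) |v|_2.  For every q > 2 the exponent e can be chosen so that phi
   lies in L^q (e = 0 if q = oo): the first bound gives the L^2 * L^2 statement, and
   the second one, with Hoelder's inequality for the conjugate exponents p and q, gives
   the L^p * L^2 statement.  The same bounds applied to differences identify the
   extension by density with the convolution integral itself. *)
From HB Require Import structures.
From mathcomp Require Import all_boot all_order all_algebra.
From mathcomp Require Import all_classical all_reals all_analysis.
From mathcomp Require Import measurable_realfun ess_sup_inf.
From mathcomp Require Import complex.
From mathcomp Require Import ring lra.
Require Import Defs.

Set Implicit Arguments.
Unset Strict Implicit.
Unset Printing Implicit Defensive.

Import Order.TTheory GRing.Theory Num.Theory.
Import numFieldNormedType.Exports.

Local Open Scope classical_set_scope.
Local Open Scope ring_scope.

(** * Hyperbolic functions and beta-type integrals *)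

Section Hyperbolic.
Context {R : realType}.
Implicit Types x y z : R.

(** The signs of the measures are given up at once: only the domination by W is used. The threshold
    q > 2 is decided at infinity. There A(|x|) grows like e^(2 rho |x|) with rho = alpha + beta + 1,
    while phi decays like e^(-(e + beta + 1/2) |x|), and e + beta + 1/2 approaches rho without
    reaching it as e increases to alpha + 1/2. So some e works as soon as q > 2. Near the origin
    phi^q A behaves like |x|^(2 alpha + 1 - e q), which gives a second constraint on e. The bound e
    < alpha + 1/2 itself is the integrability of (cosh z - cosh(|x| - |y|))^(alpha - 1/2 - e) at its
    zero, and beta + 1/2 is the power for which the factors cosh z of W, phi and A cancel. A further
    obstacle is that the convolution is an iterated integral of complex functions, with default
    values where it diverges: each difference estimate has to establish convergence too. *)

Lemma expRV x : expR x * expR (- x) = 1 :> R.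
Proof. by rewrite -expRD subrr expR0. Qed.

Lemma cosh2E x : cosh x ^+ 2 = 1 + sinh x ^+ 2.
Proof. by have := expRV x; rewrite /cosh /sinh => h; nra. Qed.

Lemma sinhN x : sinh (- x) = - sinh x.
Proof. by rewrite /sinh opprK; lra. Qed.

Lemma coshN x : cosh (- x) = cosh x.
Proof. by rewrite /cosh opprK; lra. Qed.

Lemma sinhD x y : sinh (x + y) = sinh x * cosh y + cosh x * sinh y.
Proof. by rewrite /sinh /cosh opprD !expRD; field. Qed.

Lemma coshD x y : cosh (x + y) = cosh x * cosh y + sinh x * sinh y.
Proof. by rewrite /sinh /cosh opprD !expRD; field. Qed.

Lemma coshB x y : cosh (x - y) = cosh x * cosh y - sinh x * sinh y.
Proof. by rewrite coshD coshN sinhN mulrN. Qed.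

Lemma sinh2x x : sinh (2 * x) = 2 * sinh x * cosh x.
Proof. by rewrite mulr2n mulrDl !mul1r sinhD; ring. Qed.

Lemma cosh_gt0 x : 0 < cosh x.
Proof. by rewrite /cosh divr_gt0 // addr_gt0 ?expR_gt0. Qed.

Lemma cosh_ge1 x : 1 <= cosh x.
Proof. have := cosh2E x; have := cosh_gt0 x; nra. Qed.

Lemma sinh_gt0 x : 0 < x -> 0 < sinh x.
Proof. by move=> x0; rewrite /sinh divr_gt0 // subr_gt0 ltr_expR; lra. Qed.

Lemma sinh0 : sinh 0 = 0 :> R.
Proof. by rewrite /sinh oppr0 subrr mul0r. Qed.

Lemma sinh_neq0 x : x != 0 -> sinh x != 0.
Proof.
case: (ltrgtP x 0) => // [x0|x0] _; last by rewrite gt_eqF // sinh_gt0.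
by rewrite -oppr_eq0 -sinhN gt_eqF // sinh_gt0 // oppr_gt0.
Qed.

Lemma sinh_abs x : sinh `|x| = `|sinh x|.
Proof.
case: (ltrgtP x 0) => [x0|x0|->]; last by rewrite normr0 sinh0 normr0.
  have nx : 0 < - x by rewrite oppr_gt0.
  by rewrite -(normrN (sinh x)) -sinhN -(normrN x) !gtr0_norm ?sinh_gt0.
by rewrite !gtr0_norm ?sinh_gt0.
Qed.

Lemma cosh_abs x : cosh `|x| = cosh x.
Proof. by case: (ger0P x) => // _; rewrite coshN. Qed.

Lemma sinh_lt_cosh x : `|sinh x| < cosh x.
Proof.
have := cosh2E x; have := cosh_gt0 x; case: (ger0P (sinh x)) => *; nra.
Qed.

Lemma cosh_ltP x y : 0 <= x -> 0 <= y -> (cosh x < cosh y) = (x < y).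
Proof.
suff H : {in Num.nneg &, {homo @cosh R : x y / x < y}}.
  by move=> x0 y0; exact: (leW_mono_in (le_mono_in H)).
move=> {}x {}y; rewrite !nnegrE => x0 y0 xy; rewrite -subr_gt0.
have -> : cosh y - cosh x = 2 * sinh ((y + x) / 2) * sinh ((y - x) / 2).
  set u := (y + x) / 2; set v := (y - x) / 2.
  have -> : y = u + v by rewrite /u /v; lra.
  have -> : x = u - v by rewrite /u /v; lra.
  by rewrite coshD coshB; ring.
by apply: mulr_gt0; [apply: mulr_gt0 => // |]; apply: sinh_gt0; lra.
Qed.

Lemma is_derive_cosh x : is_derive x 1 cosh (sinh x).
Proof.
rewrite /cosh; apply: is_derive_eq; rewrite /sinh /GRing.scale /=; lra.
Qed.

Lemma is_derive_sinh x : is_derive x 1 sinh (cosh x).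
Proof.
rewrite /sinh; apply: is_derive_eq; rewrite /cosh /GRing.scale /=; lra.
Qed.

Lemma continuous_cosh : continuous (@cosh R).
Proof.
move=> x; apply: differentiable_continuous; apply/derivable1_diffP.
by case: (is_derive_cosh x).
Qed.

Lemma continuous_sinh : continuous (@sinh R).
Proof.
move=> x; apply: differentiable_continuous; apply/derivable1_diffP.
by case: (is_derive_sinh x).
Qed.

End Hyperbolic.

Section PowerIntegrals.
Context {R : realType}.
Local Notation mu := (@lebesgue_measure R).
Implicit Types (D : set R) (l r : R^nat) (F f G g : R -> R).

(** The fundamental theorem of calculus is applied on compact segments, while the integrands may be
    singular at end points or live on a half-line; monotone convergence along the segments bridges
    the two. *)
Definition exhausts l r D := [/\ nonincreasing_seq l, nondecreasing_seq r,
  forall n, l n < r n & D = \bigcup_n `[l n, r n]%classic ].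

Lemma measurable_exhausts l r D : exhausts l r D -> measurable D.
Proof. by move=> [_ _ _ ->]; exact: bigcup_measurable. Qed.

Lemma exhausts_subset l r D n : exhausts l r D -> `[l n, r n] `<=` D.
Proof. by move=> [_ _ _ ->] x xn; exists n. Qed.

Lemma measurable_fun_exhausts l r D g : exhausts l r D ->
  (forall x, D x -> {for x, continuous g}) -> measurable_fun D g.
Proof.
move=> lrD cg; have := lrD; move=> [_ _ _ DE]; rewrite DE.
apply/measurable_fun_bigcup => // n.
apply: subspace_continuous_measurable_fun => //.
apply: continuous_in_subspaceT => x /[!inE] xn; apply: cg.
exact: (exhausts_subset lrD xn).
Qed.

(** As [G] stays in [m, M], each of its increments on a segment is at most M - m, and no limit of
    [G] at the ends of [D] has to be computed. *)
Lemma ge0_integral_derive_le l r D g G (m M : R) : exhausts l r D ->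
  (forall x, D x -> {for x, continuous g}) ->
  (forall x, D x -> is_derive x 1 G (g x)) ->
  (forall x, D x -> 0 <= g x) -> (forall x, D x -> m <= G x <= M) ->
  (\int[mu]_(x in D) (g x)%:E <= (M - m)%:E)%E.
Proof.
move=> lrD cg dG g0 GB; have := lrD; move=> [ndl ndr lr DE].
have sD n := @exhausts_subset l r D n lrD.
have cvgI : (\int[mu]_(x in `[l i, r i]) (g x)%:E @[i --> \oo] -->
    \int[mu]_(x in D) (g x)%:E)%E.
  rewrite DE; apply: ge0_nondecreasing_set_cvg_integral => //.
  - move=> i j ij; rewrite subsetEset => x /=; rewrite !in_itv/=.
    by move=> /andP[? ?]; rewrite (le_trans (ndl _ _ ij)) // (le_trans _ (ndr _ _ ij)).
  - move=> i; apply/measurable_EFinP.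
    by apply: measurable_funS (measurable_fun_exhausts lrD cg) => //;
      exact: measurable_exhausts lrD.
  - by move=> i x /sD Dx; rewrite lee_fin g0.
rewrite -(cvg_lim _ cvgI)//; apply: lime_le; first by apply/cvg_ex; eexists; exact: cvgI.
apply: nearW => n.
have cG x : D x -> {for x, continuous G}.
  move=> Dx; apply: differentiable_continuous; apply/derivable1_diffP.
  by case: (dG _ Dx).
have inl : D (l n) by apply: (sD n); rewrite /= in_itv/= lexx ltW.
have inr : D (r n) by apply: (sD n); rewrite /= in_itv/= lexx ltW.
have ino x : x \in `]l n, r n[ -> D x.
  by move=> xlr; apply: (sD n); rewrite /= (subset_itv_oo_cc xlr).
rewrite (@continuous_FTC2 _ g G) //.
- rewrite -EFinB lee_fin lerB //.
    by have /andP[] := GB _ inr.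
  by have /andP[] := GB _ inl.
- apply: continuous_in_subspaceT => x /[!inE] xn; apply: cg; exact: (sD n).
- split.
  + by move=> x /ino /dG[].
  + exact/cvg_at_right_filter/cG.
  + exact/cvg_at_left_filter/cG.
- move=> x /ino Dx; have [_ <-] := dG _ Dx; by rewrite derive1E.
Qed.

Lemma is_derive_powR F (df : R) p x : 0 < F x -> is_derive x 1 F df ->
  is_derive x 1 (fun x => F x `^ p) (p * F x `^ (p - 1) * df).
Proof.
move=> F0 dF.
have d1 : is_derive (F x) 1 (@powR R ^~ p) (p * F x `^ (p - 1)).
  have FI : F x \in `]0, +oo[ by rewrite in_itv/= F0.
  split; first exact: derivable_powR.
  by rewrite -derive1E powR_derive1.
have := @is_derive1_comp _ _ _ _ _ _ d1 dF.
by [].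
Qed.

Lemma gt0_powRD (x r s : R) : 0 < x -> x `^ (r + s) = x `^ r * x `^ s.
Proof. by move=> x0; rewrite powRD // (gt_eqF x0) implybT. Qed.

(** An explicit upper bound for Euler's integral of (1 - t)^p t^q over (0, 1), not its value; each
    term comes from one half of the interval. *)
Definition betaC (p q : R) := (1 + 2 `^ (- p)) / (q + 1) + (1 + 2 `^ (- q)) / (p + 1).

Lemma betaC_gt0 (p q : R) : -1 < p -> -1 < q -> 0 < betaC p q.
Proof.
move=> p1 q1; have h s : 0 < 1 + 2 `^ s :> R by rewrite addr_gt0 ?powR_gt0.
by apply: addr_gt0; apply: divr_gt0; rewrite ?h //; lra.
Qed.

(** On [L/2, L] a power is largest at L if p >= 0 and at L/2 if p < 0; the sum of both values covers
    either sign. *)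
Lemma powR_half_bound (p L t : R) : 0 < L -> L / 2 <= t <= L ->
  t `^ p <= (1 + 2 `^ (- p)) * L `^ p.
Proof.
move=> L0 /andP[tl tL]; have [p0|p0] := leP 0 p.
  have tLp : t `^ p <= L `^ p by apply: ge0_ler_powR; rewrite ?nnegrE //; lra.
  by rewrite (le_trans tLp) // ler_peMl ?powR_ge0 // lerDl powR_ge0.
have e : (1 + 2 `^ (- p)) * L `^ p = L `^ p + (L / 2) `^ p.
  rewrite mulrDl mul1r powRM ?invr_ge0 ?ltW// -(@powR_inv1 _ 2) // -powRrM.
  by rewrite mulN1r mulrC.
have tLp : t `^ p <= (L / 2) `^ p.
  rewrite -[p]opprK !(powRN _ (- p)) lef_pV2 ?posrE ?powR_gt0 //; [|lra..].
  by apply: ge0_ler_powR; rewrite ?nnegrE //; lra.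
by rewrite e (le_trans tLp) // lerDr powR_ge0.
Qed.

Lemma continuous_for_powR F p x : 0 < F x -> {for x, continuous F} ->
  {for x, continuous (fun x => F x `^ p)}.
Proof.
move=> F0 cF; apply: (@continuous_comp _ _ _ F (@powR R ^~ p)) => //=.
apply: differentiable_continuous; apply/derivable1_diffP.
by apply: derivable_powR; rewrite in_itv/= F0.
Qed.

(* On each half of [[A, B]] one of the two powers is comparable to a power of
   [B - A], so the integrand is dominated by a sum of two exact derivatives. *)
Lemma ge0_integral_beta_le l r D F f (A B p q : R) : exhausts l r D ->
  -1 < p -> -1 < q -> A < B ->
  (forall x, D x -> {for x, continuous f}) ->
  (forall x, D x -> is_derive x 1 F (f x)) ->
  (forall x, D x -> 0 <= f x) -> (forall x, D x -> A < F x < B) ->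
  (\int[mu]_(x in D) ((B - F x) `^ p * (F x - A) `^ q * f x)%:E <=
   (betaC p q * (B - A) `^ (p + q + 1))%:E)%E.
Proof.
move=> lrD p1 q1 AB cf dF f0 FAB.
have mD := measurable_exhausts lrD.
have p1' : 0 < p + 1 by lra.
have q1' : 0 < q + 1 by lra.
have BA0 : 0 < B - A by lra.
pose c1 := (1 + 2 `^ (- p)) * (B - A) `^ p.
pose c2 := (1 + 2 `^ (- q)) * (B - A) `^ q.
have c10 : 0 <= c1 by rewrite mulr_ge0 ?addr_ge0 ?powR_ge0.
have c20 : 0 <= c2 by rewrite mulr_ge0 ?addr_ge0 ?powR_ge0.
pose g x := (c1 * (F x - A) `^ q + c2 * (B - F x) `^ p) * f x.
pose G x := c1 / (q + 1) * (F x - A) `^ (q + 1) - c2 / (p + 1) * (B - F x) `^ (p + 1).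
have FA x : D x -> 0 < F x - A by move=> /FAB; lra.
have FB x : D x -> 0 < B - F x by move=> /FAB; lra.
have cF x : D x -> {for x, continuous F}.
  move=> Dx; apply: differentiable_continuous; apply/derivable1_diffP.
  by case: (dF _ Dx).
have cA s x : D x -> {for x, continuous (fun x => (F x - A) `^ s)}.
  move=> Dx; apply: continuous_for_powR; first exact: FA.
  by apply: continuousB; [exact: cF | exact: cst_continuous].
have cB s x : D x -> {for x, continuous (fun x => (B - F x) `^ s)}.
  move=> Dx; apply: continuous_for_powR; first exact: FB.
  by apply: continuousB; [exact: cst_continuous | exact: cF].
have cg x : D x -> {for x, continuous g}.
  move=> Dx; apply: continuousM; last exact: cf.
  by apply: continuousD; apply: continuousM; by [exact: cst_continuous|exact: cA|exact:
    cB].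
have L1 : (\int[mu]_(x in D) ((B - F x) `^ p * (F x - A) `^ q * f x)%:E <=
    \int[mu]_(x in D) (g x)%:E)%E.
  apply: ge0_le_integral => //.
  - by move=> x Dx; rewrite lee_fin !mulr_ge0 ?powR_ge0 ?f0.
  - apply/measurable_EFinP; apply: (measurable_fun_exhausts lrD) => x Dx.
    by apply: continuousM; [apply: continuousM; [exact: cB|exact: cA]|exact: cf].
  - by apply/measurable_EFinP; exact: (measurable_fun_exhausts lrD).
  - move=> x Dx; rewrite lee_fin ler_wpM2r ?f0 //.
    have [h|h] := leP (F x - A) ((B - A) / 2).
    + rewrite ler_wpDr ?mulr_ge0 ?powR_ge0 // ler_wpM2r ?powR_ge0 //.
      by apply: powR_half_bound => //; have := FAB _ Dx; lra.
    + rewrite ler_wpDl ?mulr_ge0 ?powR_ge0 // mulrC ler_wpM2r ?powR_ge0 //.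
      by apply: powR_half_bound => //; have := FAB _ Dx; lra.
apply: (le_trans L1).
have -> : betaC p q * (B - A) `^ (p + q + 1) =
    c1 / (q + 1) * (B - A) `^ (q + 1) - - (c2 / (p + 1) * (B - A) `^ (p + 1)).
  have e1 : (B - A) `^ (p + q + 1) = (B - A) `^ p * (B - A) `^ (q + 1).
    by rewrite -(gt0_powRD _ _ BA0) addrA.
  have e2 : (B - A) `^ (p + q + 1) = (B - A) `^ q * (B - A) `^ (p + 1).
    by rewrite -(gt0_powRD _ _ BA0) addrA (addrC p).
  by rewrite opprK /betaC mulrDl {1}e1 e2 /c1 /c2; ring.
apply: (@ge0_integral_derive_le l r D g G _ _ lrD cg).
- move=> x Dx.
  have dA : is_derive x 1 (fun x => F x - A) (f x).
    by have := dF x Dx => ?; apply: is_derive_eq; rewrite subr0.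
  have dB : is_derive x 1 (fun x => B - F x) (- f x).
    by have := is_deriveB (is_derive_cst B x 1) (dF x Dx); rewrite sub0r.
  have d1 := @is_derive_powR (fun x => F x - A) _ (q + 1) _ (FA _ Dx) dA.
  have d2 := @is_derive_powR (fun x => B - F x) _ (p + 1) _ (FB _ Dx) dB.
  apply: is_derive_eq; rewrite !addrK /g /GRing.scale /=.
  by field; lra.
- by move=> x Dx; rewrite mulr_ge0 ?f0// addr_ge0// mulr_ge0 ?powR_ge0.
- move=> x Dx; rewrite /G.
  have i1 : 0 <= c1 / (q + 1) by rewrite divr_ge0 // ltW.
  have i2 : 0 <= c2 / (p + 1) by rewrite divr_ge0 // ltW.
  have mA : (F x - A) `^ (q + 1) <= (B - A) `^ (q + 1).
    by apply: ge0_ler_powR; rewrite ?nnegrE ?(ltW q1')//; have := FAB _ Dx; lra.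
  have mB : (B - F x) `^ (p + 1) <= (B - A) `^ (p + 1).
    by apply: ge0_ler_powR; rewrite ?nnegrE ?(ltW p1')//; have := FAB _ Dx; lra.
  have i3 := mulr_ge0 i1 (powR_ge0 (F x - A) (q + 1)).
  have i4 := mulr_ge0 i2 (powR_ge0 (B - F x) (p + 1)).
  have := ler_wpM2l i1 mA; have := ler_wpM2l i2 mB.
  by move: i3 i4; lra.
Qed.

End PowerIntegrals.

(* Syntactic matching keeps [mulr_ge0] and its like from unfolding [cosh] and
   [powR] into products. *)
Ltac pos := repeat match goal with
  | |- is_true (0 <= powR _ _) => exact: powR_ge0
  | |- is_true (0 <= cosh _) => exact: ltW (cosh_gt0 _)
  | |- is_true (0 < cosh _) => exact: cosh_gt0
  | |- is_true (0 <= expR _) => exact: expR_ge0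
  | |- is_true (0 < expR _) => exact: expR_gt0
  | |- is_true (0 <= `|_|) => exact: normr_ge0
  | |- is_true (0 <= 1) => exact: ler01
  | |- is_true (0 < 1) => exact: ltr01
  | |- is_true (0 <= _%:R) => exact: ler0n
  | |- is_true (0 < _%:R) => exact: ltr0n
  | |- is_true (0 <= _ * _) => apply: mulr_ge0
  | |- is_true (0 < _ * _) => apply: mulr_gt0
  | |- is_true (0 <= _ + _) => apply: addr_ge0
  | |- is_true (0 < _ + _) => apply: addr_gt0
  | |- is_true (0 <= _^-1) => rewrite invr_ge0
  | |- is_true (0 < _^-1) => rewrite invr_gt0
  | |- is_true (0 <= _) => assumption
  | |- is_true (0 < _) => assumption
  end.

Section Exhaust.
Context {R : realType}.

(** The thirds keep the first segment nondegenerate: at n = 0 it is the middle third of (l, r). *)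
Lemma exhausts_oo (l r : R) : l < r ->
  exhausts (fun n => l + (r - l) / 3 * n.+1%:R^-1)
           (fun n => r - (r - l) / 3 * n.+1%:R^-1) `]l, r[%classic.
Proof.
move=> lr; have rl : 0 < (r - l) / 3 by lra.
have inc i j : (i <= j)%N -> (r - l) / 3 * j.+1%:R^-1 <= (r - l) / 3 * i.+1%:R^-1.
  by move=> ij; rewrite ler_wpM2l ?(ltW rl) // lef_pV2 ?posrE // ler_nat.
have pos n : 0 < (r - l) / 3 * n.+1%:R^-1 by rewrite mulr_gt0 // invr_gt0.
have le1 n : (r - l) / 3 * n.+1%:R^-1 <= (r - l) / 3.
  by rewrite ler_piMr ?(ltW rl) // invf_le1 // ler1n.
split.
- by move=> i j /inc ij; rewrite lerD2l.
- by move=> i j /inc ij; rewrite lerB.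
- move=> n; apply: (@le_lt_trans _ _ (l + (r - l) / 3)); first by rewrite lerD2l.
  by apply: (@lt_le_trans _ _ (r - (r - l) / 3)); [lra | rewrite lerB].
- apply/seteqP; split=> x /=; last first.
    move=> [n _] /=; rewrite !in_itv/=; move: (pos n).
    by set d := (r - l) / 3 / n.+1%:R => d0 /andP[h1 h2]; apply/andP; split; lra.
  rewrite in_itv/= => /andP[lx xr].
  pose e := Num.min (x - l) (r - x) / ((r - l) / 3).
  have e0 : 0 < e by rewrite divr_gt0 // lt_min; lra.
  have [n ne] := ltr_add_invr e0; exists n => //=; rewrite in_itv/=.
  move: ne; rewrite add0r ltr_pdivlMr // mulrC lt_min => /andP[].
  by set d := (r - l) / 3 / n.+1%:R => h1 h2; apply/andP; split; lra.
Qed.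

(** With [n.+2] on the right the segment is nondegenerate already at n = 0, where it is [1, 2]. *)
Lemma exhausts_oy :
  exhausts (fun n => n.+1%:R^-1 : R) (fun n => n.+2%:R) `]0, +oo[%classic.
Proof.
split.
- by move=> i j ij; rewrite lef_pV2 ?posrE // ler_nat.
- by move=> i j ij; rewrite ler_nat.
- by move=> n; rewrite (@le_lt_trans _ _ 1) // ?ltr1n // invf_le1 // ler1n.
- apply/seteqP; split=> x /=; last first.
    move=> [n _] /=; rewrite !in_itv/= andbT => /andP[+ _].
    by apply: lt_le_trans; rewrite invr_gt0.
  rewrite in_itv/= andbT => x0.
  have [n nx] := ltr_add_invr x0; rewrite add0r in nx.
  exists (maxn n (Num.truncn x)) => //=; rewrite in_itv/=; apply/andP; split.
    by apply: le_trans (ltW nx); rewrite lef_pV2 ?posrE // ler_nat ltnS leq_maxl.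
  apply/ltW/(lt_le_trans (truncnS_gt x)); rewrite ler_nat ltnS.
  exact: leqW (leq_maxr _ _).
Qed.

End Exhaust.

(** * Size of the kernels *)

Section KernelBound.
Context {R : realType}.
Implicit Types x y z : R.

(** The determinant of the symmetric 3 x 3 matrix with diagonal entries 1 and off-diagonal entries
    cosh x, cosh y, cosh z; also the value of [hfun] at chi = 0. *)
Definition gram x y z : R :=
  1 - cosh x ^+ 2 - cosh y ^+ 2 - cosh z ^+ 2 + 2 * cosh x * cosh y * cosh z.

(** As a quadratic polynomial in cosh z, [gram] has the roots cosh(|x| + |y|) and cosh(|x| - |y|).
    This gives its sign on triangles and, later, a beta integral in cosh z. *)
Lemma gramE x y z : gram x y z =
  (cosh (`|x| + `|y|) - cosh z) * (cosh z - cosh (`|x| - `|y|)).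
Proof.
rewrite coshD coshB !cosh_abs !sinh_abs /gram.
have hx : `|sinh x| ^+ 2 = cosh x ^+ 2 - 1 by rewrite cosh2E real_normK ?num_real//; ring.
have hy : `|sinh y| ^+ 2 = cosh y ^+ 2 - 1 by rewrite cosh2E real_normK ?num_real//; ring.
rewrite [RHS](_ : _ = `|sinh x| ^+ 2 * `|sinh y| ^+ 2 - (cosh x * cosh y - cosh z) ^+
  2); last by ring.
by rewrite hx hy; ring.
Qed.

Lemma triangle_coshP x y z : triangle x y z ->
  cosh (`|x| - `|y|) < cosh z < cosh (`|x| + `|y|).
Proof.
move=> /and5P[_ _ _ h1 h2].
by rewrite -(cosh_abs (_ - _)) -(cosh_abs z) !cosh_ltP ?h1 ?addr_ge0.
Qed.

Lemma gram_gt0 x y z : triangle x y z -> 0 < gram x y z.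
Proof. by move=> /triangle_coshP /andP[h1 h2]; rewrite gramE mulr_gt0 // subr_gt0. Qed.

Lemma gramC x y z : gram x y z = gram y x z.
Proof. by rewrite /gram; ring. Qed.

Lemma gramCA x y z : gram x y z = gram x z y.
Proof. by rewrite /gram; ring. Qed.

Lemma hfunE x y z chi : hfun x y z chi =
  gram x y z - 2 * cosh x * cosh y * cosh z * (1 - cos chi).
Proof. by rewrite /hfun /gram; ring. Qed.

Lemma ler_norm_div_1 (u v : R) : v != 0 -> u ^+ 2 <= v ^+ 2 -> `|u / v| <= 1.
Proof.
move=> v0 uv; rewrite normrM normfV ler_pdivrMr ?normr_gt0 // mul1r.
by rewrite -ler_sqr ?nnegrE // !real_normK ?num_real.
Qed.

(* [a], [b], [c], [n] are the squares of [sinh x], [sinh y], [sinh z], [sin chi]. *)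
Lemma coth3_core (a b c n : R) : 0 <= a -> 0 <= b -> 0 <= c -> 0 <= n <= 1 ->
  (1 + c) * n <= a * b -> (1 + b) * n <= a * c -> (1 + a) * n <= b * c ->
  (1 + a) * (1 + b) * (1 + c) * n ^+ 2 <= 16 * (a * b * c).
Proof.
(* If one square a' is at most 1, the product of the two hypotheses containing a' on the right gives
   (1 + b')(1 + c') n^2 <= a'^2 b' c', and 1 + a' <= 2. *)
have small (a' b' c' : R) : 0 <= a' <= 1 -> 0 <= b' -> 0 <= c' -> 0 <= n ->
    (1 + c') * n <= a' * b' -> (1 + b') * n <= a' * c' ->
    (1 + a') * (1 + b') * (1 + c') * n ^+ 2 <= 16 * (a' * b' * c').
  move=> /andP[a0 a1] b0 c0 n0 h1 h2.
  have h3 : ((1 + c') * n) * ((1 + b') * n) <= (a' * b') * (a' * c').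
    by apply: ler_pM => //; rewrite mulr_ge0 // addr_ge0.
  have abc : 0 <= a' * b' * c' by rewrite !mulr_ge0.
  have h4 : (1 + a') * (((1 + c') * n) * ((1 + b') * n)) <= 2 * ((a' * b') * (a' * c')).
    apply: ler_pM => //; [by rewrite addr_ge0| |by lra].
    by rewrite !mulr_ge0 // addr_ge0.
  have h5 : a' * (a' * b' * c') <= a' * b' * c' by rewrite ler_piMl.
  have -> : (1 + a') * (1 + b') * (1 + c') * n ^+ 2 =
    (1 + a') * (((1 + c') * n) * ((1 + b') * n)) by ring.
  apply: (le_trans h4); rewrite (_ : a' * b' * (a' * c') = a' * (a' * b' * c'));
    last by ring.
  lra.
move=> a0 b0 c0 /andP[n0 n1] h1 h2 h3.
have [al|ag] := leP a 1; first by apply: small => //; rewrite a0.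
have [bl|bg] := leP b 1.
  by rewrite (mulrC (1 + a)) (mulrC a b); apply: small; rewrite ?b0 // (mulrC b).
have [cl|cg] := leP c 1.
  rewrite (_ : (1 + a) * (1 + b) * (1 + c) = (1 + c) * (1 + a) * (1 + b)); last by ring.
  rewrite (_ : a * b * c = c * a * b); last by ring.
  by apply: small; rewrite ?c0 // (mulrC c).
(* All three squares now exceed 1, so 1 + a <= 2 a and its analogues, with n <= 1, give the bound 8
   abc. *)
have n2 : n ^+ 2 <= 1 by rewrite expr_le1.
have h4 : (1 + a) * (1 + b) <= (2 * a) * (2 * b) by apply: ler_pM; lra.
have h5 : (1 + a) * (1 + b) * (1 + c) <= (2 * a) * (2 * b) * (2 * c).
  by apply: ler_pM => //; rewrite ?mulr_ge0; lra.
have h6 : (1 + a) * (1 + b) * (1 + c) * n ^+ 2 <= (2 * a) * (2 * b) * (2 * c) * 1.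
  by apply: ler_pM => //; rewrite ?sqr_ge0 // !mulr_ge0 // addr_ge0.
have abc : 0 <= a * b * c by rewrite !mulr_ge0.
apply: (le_trans h6); rewrite (_ : 2 * a * (2 * b) * (2 * c) * 1 = 8 * (a * b * c));
  last by ring.
lra.
Qed.

(* [h >= 0] amounts to [(X Y - Z k)^2 + Z^2 n <= s^2 t^2] and its permutations:
   these put every [sigma] in [[-1, 1]] and bound the product of the [coth]. *)
Lemma bracket_bound (X Y Z s t u k n r : R) : X ^+ 2 = 1 + s ^+ 2 ->
  Y ^+ 2 = 1 + t ^+ 2 -> Z ^+ 2 = 1 + u ^+ 2 -> s != 0 -> t != 0 -> u != 0 ->
  0 <= n -> k ^+ 2 + n = 1 ->
  0 <= 1 - X ^+ 2 - Y ^+ 2 - Z ^+ 2 + 2 * X * Y * Z * k ->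
  `|1 - (X * Y - Z * k) / (s * t) + (X * Z - Y * k) / (s * u)
    + (Z * Y - X * k) / (u * t) + r * (X / s) * (Y / t) * (Z / u) * n|
  <= 4 + 4 * `|r|.
Proof.
move=> hX hY hZ s0 t0 u0 n0 kn h.
have k1 : n <= 1 by have := sqr_ge0 k; lra.
have c1 : (X * Y - Z * k) ^+ 2 + Z ^+ 2 * n <= s ^+ 2 * t ^+ 2.
  rewrite -subr_ge0; apply: le_trans h _; rewrite le_eqVlt; apply/orP; left; apply/eqP.
  have -> : n = 1 - k ^+ 2 by lra.
  have -> : s ^+ 2 = X ^+ 2 - 1 by lra.
  have -> : t ^+ 2 = Y ^+ 2 - 1 by lra.
  ring.
have c2 : (X * Z - Y * k) ^+ 2 + Y ^+ 2 * n <= s ^+ 2 * u ^+ 2.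
  rewrite -subr_ge0; apply: le_trans h _; rewrite le_eqVlt; apply/orP; left; apply/eqP.
  have -> : n = 1 - k ^+ 2 by lra.
  have -> : s ^+ 2 = X ^+ 2 - 1 by lra.
  have -> : u ^+ 2 = Z ^+ 2 - 1 by lra.
  ring.
have c3 : (Z * Y - X * k) ^+ 2 + X ^+ 2 * n <= u ^+ 2 * t ^+ 2.
  rewrite -subr_ge0; apply: le_trans h _; rewrite le_eqVlt; apply/orP; left; apply/eqP.
  have -> : n = 1 - k ^+ 2 by lra.
  have -> : u ^+ 2 = Z ^+ 2 - 1 by lra.
  have -> : t ^+ 2 = Y ^+ 2 - 1 by lra.
  ring.
have p1 : 0 <= Z ^+ 2 * n by rewrite mulr_ge0 ?sqr_ge0.
have p2 : 0 <= Y ^+ 2 * n by rewrite mulr_ge0 ?sqr_ge0.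
have p3 : 0 <= X ^+ 2 * n by rewrite mulr_ge0 ?sqr_ge0.
have q1 := sqr_ge0 (X * Y - Z * k).
have q2 := sqr_ge0 (X * Z - Y * k).
have q3 := sqr_ge0 (Z * Y - X * k).
have b1 : `|(X * Y - Z * k) / (s * t)| <= 1.
  by apply: ler_norm_div_1; rewrite ?mulf_neq0 // exprMn; lra.
have b2 : `|(X * Z - Y * k) / (s * u)| <= 1.
  by apply: ler_norm_div_1; rewrite ?mulf_neq0 // exprMn; lra.
have b3 : `|(Z * Y - X * k) / (u * t)| <= 1.
  by apply: ler_norm_div_1; rewrite ?mulf_neq0 // exprMn; lra.
(* [coth3_core] bounds the square by 16; the factor 4 is taken out so that a quotient of modulus at
   most 1 remains. *)
have b4 : `|(X / s) * (Y / t) * (Z / u) * n| <= 4.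
  have -> : (X / s) * (Y / t) * (Z / u) * n = (X * Y * Z * n / 4) / (s * t * u) * 4.
    by field; rewrite s0 t0 u0.
  rewrite normrM (gtr0_norm (ltr0n _ 4)) ler_piMl //.
  apply: ler_norm_div_1; first by rewrite !mulf_neq0.
  have := @coth3_core (s ^+ 2) (t ^+ 2) (u ^+ 2) n.
  rewrite !sqr_ge0 n0 k1 -hX -hY -hZ => /(_ isT isT isT isT).
  have -> : (X * Y * Z * n / 4) ^+ 2 = X ^+ 2 * Y ^+ 2 * Z ^+ 2 * n ^+ 2 / 16 by field.
  have -> : (s * t * u) ^+ 2 = s ^+ 2 * t ^+ 2 * u ^+ 2 by ring.
  have g1 : Z ^+ 2 * n <= s ^+ 2 * t ^+ 2 by lra.
  have g2 : Y ^+ 2 * n <= s ^+ 2 * u ^+ 2 by lra.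
  have g3 : X ^+ 2 * n <= t ^+ 2 * u ^+ 2 by rewrite (mulrC (t ^+ 2)); lra.
  by move=> /(_ g1 g2 g3); lra.
have b5 : `|r * (X / s) * (Y / t) * (Z / u) * n| <= 4 * `|r|.
  rewrite (_ : r * (X / s) * (Y / t) * (Z / u) * n = r * ((X / s) * (Y / t) * (Z / u) *
    n)); last by ring.
  by rewrite normrM mulrC ler_wpM2r.
move: b1 b2 b3 b5.
set v1 := (X * Y - Z * k) / _; set v2 := (X * Z - Y * k) / _.
set v3 := (Z * Y - X * k) / _; set v4 := r * _ * _ * _ * _.
rewrite !ler_norml; lra.
Qed.

(** Since sinh(a + b) sinh(a - b) = cosh^2 a - cosh^2 b, the product is a product of two differences
    of squares. The factors with a minus sign form [gram], those with a plus sign the second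
    factor. *)
Lemma sinh4E x y z :
  sinh (x + y + z) * sinh (- x + y + z) * sinh (x - y + z) * sinh (x + y - z) =
  gram x y z * (cosh x ^+ 2 + cosh y ^+ 2 + cosh z ^+ 2 - 1
                + 2 * cosh x * cosh y * cosh z).
Proof.
rewrite /gram /sinh /cosh !opprD !opprK !expRD !expRN.
have := expR_gt0 x; have := expR_gt0 y; have := expR_gt0 z.
by move=> ? ? ?; field; rewrite !gt_eqF.
Qed.

(** Here sinh(a + b) sinh(a - b) is read as (cosh 2a - cosh 2b) / 2. This form suits beta = -1/2,
    where the kernel is taken at halved arguments. *)
Lemma sinh4E2 x y z :
  sinh (x + y + z) * sinh (- x + y + z) * sinh (x - y + z) * sinh (x + y - z) =
  gram (2 * x) (2 * y) (2 * z) / 4.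
Proof.
rewrite /gram !mulr2n !mulrDl !mul1r /sinh /cosh !opprD !opprK !expRD !expRN.
have := expR_gt0 x; have := expR_gt0 y; have := expR_gt0 z.
by move=> ? ? ?; field; rewrite !gt_eqF.
Qed.

(* The last factor of the kernel for [alpha = beta] is, up to the factor 4, the
   bracket of the kernel for [alpha > beta] at the angle where [h] vanishes. *)
Lemma bracket_eqE x y z : x != 0 -> y != 0 -> z != 0 ->
  let k := (cosh x ^+ 2 + cosh y ^+ 2 + cosh z ^+ 2 - 1) /
    (2 * cosh x * cosh y * cosh z) in
  expR (x + y - z) *
  (sinh (x + y + z) * sinh (- x + y + z) * sinh (x - y + z) /
   (sinh (2 * x) * sinh (2 * y) * sinh (2 * z))) =
  (1 - (cosh x * cosh y - cosh z * k) / (sinh x * sinh y)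
   + (cosh x * cosh z - cosh y * k) / (sinh x * sinh z)
   + (cosh z * cosh y - cosh x * k) / (sinh z * sinh y)
   + 2 * (cosh x / sinh x) * (cosh y / sinh y) * (cosh z / sinh z) *
     (1 - k ^+ 2)) / 4.
Proof.
move=> x0 y0 z0 k; rewrite /k !sinh2x.
have cx := cosh_gt0 x; have cy := cosh_gt0 y; have cz := cosh_gt0 z.
have sx := sinh_neq0 x0; have sy := sinh_neq0 y0; have sz := sinh_neq0 z0.
(* Clearing denominators leaves an identity of Laurent polynomials in e^x, e^y and e^z. *)
have num : expR (x + y - z) * (sinh (x + y + z) * sinh (- x + y + z) * sinh (x - y + z)) =
  2 * sinh x * sinh y * sinh z * cosh x * cosh y * cosh z
  - 2 * cosh x * cosh y * cosh z * sinh z * (cosh x * cosh y)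
  + cosh z * sinh z * (cosh x ^+ 2 + cosh y ^+ 2 + cosh z ^+ 2 - 1)
  + 2 * cosh x * cosh y * cosh z * sinh y * (cosh x * cosh z)
  - cosh y * sinh y * (cosh x ^+ 2 + cosh y ^+ 2 + cosh z ^+ 2 - 1)
  + 2 * cosh x * cosh y * cosh z * sinh x * (cosh z * cosh y)
  - cosh x * sinh x * (cosh x ^+ 2 + cosh y ^+ 2 + cosh z ^+ 2 - 1)
  + (4 * cosh x ^+ 2 * cosh y ^+ 2 * cosh z ^+ 2 - (cosh x ^+ 2 + cosh y ^+ 2 + cosh z
      ^+ 2 - 1) ^+ 2).
  rewrite /sinh /cosh !opprD !opprK !expRD !expRN.
  have := expR_gt0 x; have := expR_gt0 y; have := expR_gt0 z.
  by move=> ? ? ?; field; rewrite !gt_eqF.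
rewrite mulrA num; field.
by rewrite sx sy sz !gt_eqF.
Qed.

(* Up to a constant, this dominates the absolute value of the signed kernel; it
   is symmetric and even in all three variables. *)
Definition kernel_bound (alpha beta x y z : R) : R :=
  if triangle x y z then
    `|sinh x * sinh y * sinh z| `^ (- (2 * alpha)) *
    (cosh x * cosh y * cosh z) `^ (- (beta + 2^-1)) *
    gram x y z `^ (alpha - 2^-1)
  else 0.

Lemma kernel_bound_ge0 alpha beta x y z : 0 <= kernel_bound alpha beta x y z.
Proof. by rewrite /kernel_bound; case: ifP => // _; pos. Qed.

(** The sum of the end-point values spares later estimates a case distinction on the sign of the
    exponent. *)
Lemma powR_between (p m M t : R) : 0 < m -> m <= t <= M ->
  t `^ p <= m `^ p + M `^ p.
Proof.
move=> m0 /andP[mt tM]; have [p0|p0] := leP 0 p.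
  rewrite ler_wpDl ?powR_ge0 //; apply: ge0_ler_powR; rewrite ?nnegrE //; lra.
rewrite ler_wpDr ?powR_ge0 //.
rewrite -[p]opprK !(powRN _ (- p)) lef_pV2 ?posrE ?powR_gt0 //; last lra.
by apply: ge0_ler_powR; rewrite ?nnegrE //; lra.
Qed.

Lemma sqr_cosh_ge1 x : 1 <= cosh x ^+ 2.
Proof. by rewrite cosh2E lerDl sqr_ge0. Qed.

(** The factor 3 is 12 / 4: [bracket_bound] gives 4 + 4 * 2 = 12, and [bracket_eqE] divides the
    bracket by 4. *)
Definition kernel_eq_const (alpha : R) : R :=
  2 `^ (4 * alpha + 2) *
  `|Gamma (alpha + 1) / (Num.sqrt pi * Gamma (alpha + 2^-1))| * 3.

Lemma kernel_eq_const_ge0 alpha : 0 <= kernel_eq_const alpha.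
Proof. by rewrite /kernel_eq_const; pos. Qed.

(** The exponential and the last quotient together are a bounded bracket. The remaining factors are
    kept at doubled arguments, so that the bound serves both alpha = beta and, at halved arguments,
    beta = -1/2. *)
Lemma kernel_eq_le alpha x y z : triangle x y z ->
  `|kernel_eq alpha x y z| <= kernel_eq_const alpha *
    ((gram (2 * x) (2 * y) (2 * z) / 4) `^ (alpha - 2^-1) /
     `|sinh (2 * x) * sinh (2 * y) * sinh (2 * z)| `^ (2 * alpha)).
Proof.
move=> xyz; have /and5P[x0 y0 z0 _ _] := xyz.
have g0 := gram_gt0 xyz.
have cx := cosh_ge1 x; have cy := cosh_ge1 y; have cz := cosh_ge1 z.
rewrite /kernel_eq sinh4E2.
set c0 := 2 `^ _; set c1 := Gamma _ / _; set e := expR _; set q := _ / _ `^ _.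
set u := _ / (_ * _ * _).
rewrite (_ : c0 * c1 * e * q * u = c0 * c1 * q * (e * u)); last by ring.
have q0 : 0 <= q by rewrite divr_ge0 ?powR_ge0.
(* [k] is the value of cos chi at which h vanishes; it is at most 1 because [gram] is positive. *)
rewrite /e /u bracket_eqE //; set k := _ / (2 * _ * _ * _).
set S := cosh x ^+ 2 + cosh y ^+ 2 + cosh z ^+ 2 - 1 in k *.
set Q := 2 * cosh x * cosh y * cosh z in k *.
have Q0 : 0 < Q by rewrite /Q; pos.
have S0 : 0 <= S.
  have := sqr_ge0 (cosh y); have := sqr_ge0 (cosh z); have := sqr_cosh_ge1 x.
  by rewrite /S; lra.
have SQ : S < Q by move: g0; rewrite /gram /S /Q; lra.
have k0 : 0 <= k by rewrite divr_ge0 // ltW.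
have k1 : k <= 1 by rewrite ler_pdivrMr // mul1r ltW.
have kk : k ^+ 2 <= 1 by rewrite expr_le1.
have kh : 0 <= 1 - cosh x ^+ 2 - cosh y ^+ 2 - cosh z ^+ 2
    + 2 * cosh x * cosh y * cosh z * k.
  by rewrite -/Q mulrCA mulfV ?gt_eqF // mulr1 /S; lra.
(* The coefficient 2 is (alpha + beta + 1) / (beta + 1/2) at alpha = beta. *)
have B := @bracket_bound _ _ _ _ _ _ k (1 - k ^+ 2) 2 (cosh2E x) (cosh2E y)
  (cosh2E z) (sinh_neq0 x0) (sinh_neq0 y0) (sinh_neq0 z0).
have {}B := B _ _ kh.
have k2 : 0 <= 1 - k ^+ 2 by lra.
have {}B := B k2 (subrKC _ _).
set br := (X in _ * (X / 4)); have {}B : `|br| <= 12 by apply: (le_trans B);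
  rewrite ger0_norm //; lra.
rewrite (_ : c0 * c1 * q * (br / 4) = (c0 * q / 4) * (c1 * br)); last by ring.
have d0 : 0 <= c0 * q / 4 by rewrite /c0; pos.
rewrite normrM (ger0_norm d0) normrM.
rewrite (_ : kernel_eq_const alpha * q = (c0 * q / 4) * (`|c1| * 12));
  last by rewrite /kernel_eq_const -/c0 -/c1; field.
by apply: ler_wpM2l => //; apply: ler_wpM2l.
Qed.

(** The second factor in [sinh4E] lies between 2 Q and 4 Q, where Q is the product of the hyperbolic
    cosines. Its power Q^(alpha - 1/2) and the Q^(-2 alpha) from the doubled sines combine to the
    Q^(-(alpha + 1/2)) of [kernel_bound]. *)
Lemma kernel_eq_bound alpha : exists2 C : R, 0 <= C &
  forall x y z, triangle x y z ->
  `|kernel_eq alpha x y z| <= C * kernel_bound alpha alpha x y z.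
Proof.
pose c := 2 `^ (alpha - 2^-1) + 4 `^ (alpha - 2^-1) : R.
exists (kernel_eq_const alpha * (c * 8 `^ (- (2 * alpha)))).
  have := kernel_eq_const_ge0 alpha => h; rewrite /c; pos.
move=> x y z xyz; apply: (le_trans (kernel_eq_le _ xyz)).
rewrite -[leRHS]mulrA ler_wpM2l ?kernel_eq_const_ge0 //.
have g0 := gram_gt0 xyz.
have cx := cosh_ge1 x; have cy := cosh_ge1 y; have cz := cosh_ge1 z.
rewrite -sinh4E2 sinh4E /kernel_bound xyz.
set S := _ - 1 + _; set Q := cosh x * cosh y * cosh z.
have Q0 : 0 < Q by rewrite /Q; pos.
have SE : 2 * Q <= S <= 4 * Q.
  have := sqr_cosh_ge1 x.
  have := sqr_ge0 (cosh y); have := sqr_ge0 (cosh z).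
  by move: g0; rewrite /gram /S /Q; lra.
have Sp : S `^ (alpha - 2^-1) <= c * Q `^ (alpha - 2^-1).
  have Q2 : 0 < 2 * Q by pos.
  have := powR_between (alpha - 2^-1) Q2 SE.
  by rewrite (powRM _ (ler0n _ 2) (ltW Q0)) (powRM _ (ler0n _ 4) (ltW Q0)) -mulrDl.
have S0 : 0 <= S by move: SE => /andP[]; lra.
rewrite (powRM _ (ltW g0) S0) !sinh2x.
rewrite (_ : 2 * sinh x * cosh x * (2 * sinh y * cosh y) * (2 * sinh z * cosh z)
   = 8 * ((sinh x * sinh y * sinh z) * Q)); last by rewrite /Q; ring.
rewrite normrM (ger0_norm (ler0n _ 8)) powRM // (normrM _ Q) (gtr0_norm Q0).
rewrite powRM ?(ltW Q0) // !invfM -!powRN.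
set s := `|_| `^ _.
have -> : Q `^ (- (alpha + 2^-1)) = Q `^ (alpha - 2^-1) * Q `^ (- (2 * alpha)).
  by rewrite -gt0_powRD //; congr (_ `^ _); lra.
set g := gram _ _ _ `^ _.
rewrite [leLHS](_ : _ = g * 8 `^ (- (2 * alpha)) * s * Q `^ (- (2 * alpha)) * S `^
  (alpha - 2^-1)); last by ring.
rewrite [leRHS](_ : _ = g * 8 `^ (- (2 * alpha)) * s * Q `^ (- (2 * alpha)) * (c * Q `^
  (alpha - 2^-1))); last by ring.
by apply: ler_wpM2l; [rewrite /g /s; pos | exact: Sp].
Qed.

Lemma triangle_half x y z : triangle (x / 2) (y / 2) (z / 2) = triangle x y z.
Proof.
have h (t : R) : (t / 2 != 0) = (t != 0) by rewrite mulf_eq0 invr_eq0 pnatr_eq0 orbF.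
have n (t : R) : `|t / 2| = `|t| / 2 by rewrite normrM normfV (ger0_norm (ler0n _ 2)).
by rewrite /triangle !h !n -mulrBl -mulrDl n !ltr_pM2r ?invr_gt0.
Qed.

(** Doubling undoes the halving, so [kernel_eq_le] already has the required shape; at beta = -1/2
    the cosines in [kernel_bound] have exponent 0. *)
Lemma kernel_eq_half_bound alpha : exists2 C : R, 0 <= C &
  forall x y z, triangle x y z ->
  `|kernel_eq alpha (x / 2) (y / 2) (z / 2)| <= C * kernel_bound alpha (- 2^-1) x y z.
Proof.
exists (kernel_eq_const alpha * 4^-1 `^ (alpha - 2^-1)).
  have := kernel_eq_const_ge0 alpha => h; pos.
move=> x y z xyz.
have xyz2 : triangle (x / 2) (y / 2) (z / 2) by rewrite triangle_half.
apply: (le_trans (kernel_eq_le _ xyz2)).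
rewrite -[leRHS]mulrA ler_wpM2l ?kernel_eq_const_ge0 //.
have h2 t : 2 * (t / 2) = t :> R by lra.
rewrite !h2 /kernel_bound xyz addNr oppr0 powRr0 mulr1.
rewrite powRM ?invr_ge0 ?(ltW (gram_gt0 xyz)) // powRN.
by rewrite le_eqVlt; apply/orP; left; apply/eqP; ring.
Qed.

End KernelBound.

(** * Measurability of the kernels and of integrals with a parameter *)

Section Measurability.
Context {R : realType} d (T : measurableType d).
Implicit Types (f g : T -> R).

Lemma measurable_fun_cosh f : measurable_fun setT f ->
  measurable_fun setT (fun t => cosh (f t)).
Proof.
by move=> mf; apply: measurableT_comp => //; apply: continuous_measurable_fun;
  exact: continuous_cosh.
Qed.

Lemma measurable_fun_sinh f : measurable_fun setT f ->
  measurable_fun setT (fun t => sinh (f t)).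
Proof.
by move=> mf; apply: measurableT_comp => //; apply: continuous_measurable_fun;
  exact: continuous_sinh.
Qed.

Lemma measurable_fun_powR f p : measurable_fun setT f ->
  measurable_fun setT (fun t => f t `^ p).
Proof. by move=> mf; apply: (measurableT_comp (measurable_powR p)). Qed.

Lemma measurable_fun_norm f : measurable_fun setT f ->
  measurable_fun setT (fun t => `|f t|).
Proof. by move=> mf; apply: measurableT_comp mf. Qed.

Lemma measurable_fun_expR f : measurable_fun setT f ->
  measurable_fun setT (fun t => expR (f t)).
Proof. by move=> mf; apply: measurableT_comp mf. Qed.

Lemma measurable_fun_cos f : measurable_fun setT f ->
  measurable_fun setT (fun t => cos (f t)).
Proof.
by move=> mf; apply: measurableT_comp => //; apply: continuous_measurable_fun;
  exact: continuous_cos.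
Qed.

Lemma measurable_fun_sin f : measurable_fun setT f ->
  measurable_fun setT (fun t => sin (f t)).
Proof.
by move=> mf; apply: measurableT_comp => //; apply: continuous_measurable_fun;
  exact: continuous_sin.
Qed.

(** Writing 1/f as f (f^2)^(-1) reduces the claim to real powers of a nonnegative function; where f
    vanishes both sides are 0. *)
Lemma measurable_fun_inv f : measurable_fun setT f ->
  measurable_fun setT (fun t => (f t)^-1).
Proof.
move=> mf; rewrite (_ : (fun t => (f t)^-1) = (fun t => f t * (f t ^+ 2) `^ (-1))).
  apply: measurable_funM => //; apply: measurable_fun_powR.
  exact: measurable_funX.
apply/funext => t; rewrite powR_inv1 ?sqr_ge0 //.
have [->|f0] := eqVneq (f t) 0; first by rewrite invr0 mul0r.
by field.
Qed.

Lemma measurable_fun_sqr f : measurable_fun setT f ->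
  measurable_fun setT (fun t => f t ^+ 2).
Proof. exact: measurable_funX. Qed.

Lemma measurable_fun_neq0 f : measurable_fun setT f ->
  measurable_fun setT (fun t => f t != 0).
Proof.
move=> mf; apply: measurableT_comp => //; apply: measurable_fun_eqr => //.
Qed.

End Measurability.

Ltac meas := repeat match goal with
  | |- measurable_fun _ (fun t => _ + _) => apply: measurable_funD
  | |- measurable_fun _ (fun t => - _) => apply: measurable_funN
  | |- measurable_fun _ (fun t => _ * _) => apply: measurable_funM
  | |- measurable_fun _ (fun t => _ ^+ 2) => apply: measurable_fun_sqr
  | |- measurable_fun _ (fun t => _ ^-1) => apply: measurable_fun_inv
  | |- measurable_fun _ (fun t => `|_|) => apply: measurable_fun_norm
  | |- measurable_fun _ (fun t => powR _ _) => apply: measurable_fun_powR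
  | |- measurable_fun _ (fun t => expR _) => apply: measurable_fun_expR
  | |- measurable_fun _ (fun t => cosh _) => apply: measurable_fun_cosh
  | |- measurable_fun _ (fun t => sinh _) => apply: measurable_fun_sinh
  | |- measurable_fun _ (fun t => cos _) => apply: measurable_fun_cos
  | |- measurable_fun _ (fun t => sin _) => apply: measurable_fun_sin
  | |- measurable_fun _ cos => apply: (measurable_fun_cos (@measurable_id _ _ _))
  | |- measurable_fun _ sin => apply: (measurable_fun_sin (@measurable_id _ _ _))
  | |- measurable_fun _ cosh => apply: (measurable_fun_cosh (@measurable_id _ _ _))
  | |- measurable_fun _ sinh => apply: (measurable_fun_sinh (@measurable_id _ _ _))
  | |- measurable_fun _ Num.norm => apply: (measurable_fun_norm (@measurable_id _ _ _))
  | |- measurable_fun _ (fun t => t) => exact: measurable_id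
  | |- measurable_fun _ (fun t => ?c) => exact: measurable_cst
  | |- _ => assumption
  end.

Section MeasurableKernel.
Context {R : realType} d (T : measurableType d).
Implicit Types (f g x y z chi : T -> R).

Lemma measurable_fun_triangle x y z : measurable_fun setT x ->
  measurable_fun setT y -> measurable_fun setT z ->
  measurable_fun setT (fun t => triangle (x t) (y t) (z t)).
Proof.
move=> mx my mz; rewrite /triangle.
do 3 (apply: measurable_and; first exact: measurable_fun_neq0).
by apply: measurable_and; apply: measurable_fun_ltr; meas.
Qed.

Lemma measurable_fun_gram x y z : measurable_fun setT x ->
  measurable_fun setT y -> measurable_fun setT z ->
  measurable_fun setT (fun t => gram (x t) (y t) (z t)).
Proof. by move=> mx my mz; rewrite /gram; meas. Qed.

Lemma measurable_fun_kernel_bound alpha beta x y z : measurable_fun setT x ->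
  measurable_fun setT y -> measurable_fun setT z ->
  measurable_fun setT (fun t => kernel_bound alpha beta (x t) (y t) (z t)).
Proof.
move=> mx my mz; apply: measurable_fun_ifT.
- exact: measurable_fun_triangle.
- by meas; exact: measurable_fun_gram.
- exact: measurable_cst.
Qed.

Lemma measurable_fun_pos_powR f p : measurable_fun setT f ->
  measurable_fun setT (fun t => pos_powR (f t) p).
Proof.
move=> mf; apply: measurable_fun_ifT; by [exact: measurable_fun_ltr|meas].
Qed.

Lemma measurable_fun_kernel_eq alpha x y z : measurable_fun setT x ->
  measurable_fun setT y -> measurable_fun setT z ->
  measurable_fun setT (fun t => kernel_eq alpha (x t) (y t) (z t)).
Proof. by move=> mx my mz; rewrite /kernel_eq; meas. Qed.

Definition kernel_gt_integrand (alpha beta x y z chi : R) : R :=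
  (pos_powR (hfun x y z chi) (alpha - beta - 1) *
     (1 - sigma chi x y z + sigma chi x z y + sigma chi z y x
      + (alpha + beta + 1) / (beta + 2^-1) *
        coth x * coth y * coth z * sin chi ^+ 2) *
     sin chi `^ (2 * beta)).

Lemma measurable_fun_kernel_gt_integrand alpha beta x y z chi :
  measurable_fun setT x -> measurable_fun setT y -> measurable_fun setT z ->
  measurable_fun setT chi ->
  measurable_fun setT (fun t => kernel_gt_integrand alpha beta (x t) (y t) (z t) (chi t)).
Proof.
move=> mx my mz mchi; rewrite /kernel_gt_integrand /sigma /coth; meas.
by apply: measurable_fun_pos_powR; rewrite /hfun; meas.
Qed.

End MeasurableKernel.

Section ParametricIntegral.
Context {R : realType} d (T : measurableType d).
Local Notation mu := (@lebesgue_measure R).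

(** No integrability is assumed: Tonelli applies to the positive and the negative part, and [fine]
    is measurable, so default values do no harm. *)
Lemma measurable_fun_Rintegral_param (D : set (measurableTypeR R))
    (f : T * measurableTypeR R -> R) :
  measurable D -> measurable_fun setT f ->
  measurable_fun setT (fun t => \int[mu]_(u in D) f (t, u)).
Proof.
move=> mD mf; rewrite /Rintegral.
apply: (measurableT_comp (fine_measurable measurableT)).
pose g (p : T * measurableTypeR R) := (f p * \1_D p.2)%:E.
have mg : measurable_fun setT g.
  apply/measurable_EFinP; apply: measurable_funM => //.
  by apply: (measurableT_comp (measurable_indic mD)).
rewrite (_ : (fun t => _) = (fun t => \int[mu]_u g^\+ (t, u) - \int[mu]_u g^\- (t, u))%E).
  apply: emeasurable_funB.
  - exact: (@measurable_fun_fubini_tonelli_F _ _ T _ R mu _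
      (measurable_funepos mg) (fun p => funepos_ge0 g p)).
  - exact: (@measurable_fun_fubini_tonelli_F _ _ T _ R mu _
      (measurable_funeneg mg) (fun p => funeneg_ge0 g p)).
apply/funext => t; rewrite integral_mkcond integralE.
congr (_ - _)%E; apply: eq_integral => u _.
- by rewrite /g !funeposE patchE indicE; case: (u \in D); rewrite ?mulr1 ?mulr0.
- by rewrite /g !funenegE patchE indicE; case: (u \in D); rewrite ?mulr1 ?mulr0.
Qed.

Lemma normr_Rintegral_le (D : set (measurableTypeR R)) (f : R ->
  R) (M : R) : measurable D ->
  measurable_fun D f -> (\int[mu]_(x in D) `|f x|%:E <= M%:E)%E ->
  `|\int[mu]_(x in D) f x| <= M.
Proof.
move=> mD mf fM.
have fi : mu.-integrable D (EFin \o f).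
  apply/integrableP; split; first exact/measurable_EFinP.
  exact: le_lt_trans fM (ltry _).
rewrite -lee_fin; apply: le_trans fM.
rewrite EFin_normr_Rintegral //; apply: (le_abse_integral _ mD).
exact/measurable_EFinP.
Qed.

Lemma measurable_fun_kernel_gt alpha beta (x y z : T -> R) :
  measurable_fun setT x -> measurable_fun setT y -> measurable_fun setT z ->
  measurable_fun setT (fun t => kernel_gt alpha beta (x t) (y t) (z t)).
Proof.
move=> mx my mz; rewrite /kernel_gt; meas.
apply: (@measurable_fun_Rintegral_param `]0, pi[%classic
  (fun p => kernel_gt_integrand alpha beta (x p.1) (y p.1) (z p.1) p.2)).
  exact: measurable_itv.
by apply: measurable_fun_kernel_gt_integrand => //; apply: measurableT_comp.
Qed.

Lemma measurable_fun_kernel alpha beta (x y z : T -> R) :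
  measurable_fun setT x -> measurable_fun setT y -> measurable_fun setT z ->
  measurable_fun setT (fun t => kernel alpha beta (x t) (y t) (z t)).
Proof.
move=> mx my mz; apply: measurable_fun_ifT => //.
- exact: measurable_fun_triangle.
- by case: (alpha == beta); [exact: measurable_fun_kernel_eq|exact:
    measurable_fun_kernel_gt].
Qed.

End ParametricIntegral.

Section KernelGtBound.
Context {R : realType}.
Local Notation mu := (@lebesgue_measure R).
Variables (alpha beta : R).
Hypotheses (hb : - 2^-1 < beta) (hab : beta < alpha).

(** [gam] is the exponent of h, [Cbr] bounds the bracket by [bracket_bound], and [Csin] bounds (1 +
    cos chi)^(beta - 1/2), as 1 + cos chi lies between 1 and 2 on the support of h_+. *)
Let gam := alpha - beta - 1.
Let Cbr := 4 + 4 * `|(alpha + beta + 1) / (beta + 2^-1)|.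
Let Csin : R := 1 `^ (beta - 2^-1) + 2 `^ (beta - 2^-1).

(** For w = 1 - cos chi one has h = Q (tau - w), sin^2 chi = w (1 + cos chi) and dw = sin chi dchi,
    so the integrand becomes that of a beta integral in w over (0, tau). The subtracted 0 is the
    left end point in the form expected by [ge0_integral_beta_le]. *)
Lemma kernel_gt_integrand_le (x y z chi Q tau : R) :
  Q = 2 * cosh x * cosh y * cosh z -> tau = gram x y z / Q ->
  triangle x y z -> 0 < chi < pi ->
  `|kernel_gt_integrand alpha beta x y z chi| <=
  if 1 - cos chi < tau then
    Cbr * Csin * Q `^ gam *
    ((tau - (1 - cos chi)) `^ gam * (1 - cos chi - 0) `^ (beta - 2^-1) * sin chi)
  else 0.
Proof.
have hb' := hb; have hab' := hab.
move=> QE tauE xyz /andP[c0 cpi]; have /and5P[x0 y0 z0 _ _] := xyz.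
have Q0 : 0 < Q by rewrite QE; pos.
have g0 := gram_gt0 xyz.
have hE : hfun x y z chi = Q * (tau - (1 - cos chi)).
  by rewrite hfunE -QE tauE; field; rewrite gt_eqF.
have sin0 : 0 < sin chi by rewrite sin_gt0_pi // c0.
have cos1 : cos chi < 1 by rewrite -cos0 ltr_cos // in_itv/= ?lexx ?pi_ge0// (ltW c0) ltW.
rewrite /kernel_gt_integrand /pos_powR hE pmulr_rgt0 // subr_gt0.
case: ifPn => [ct|_]; last by rewrite !mul0r normr0.
have t0 : 0 < tau - (1 - cos chi) by rewrite subr_gt0.
have h0 : 0 <= 1 - cosh x ^+ 2 - cosh y ^+ 2 - cosh z ^+ 2 +
    2 * cosh x * cosh y * cosh z * cos chi.
  by rewrite -/(hfun x y z chi) hE; apply: mulr_ge0; apply: ltW.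
have B := @bracket_bound _ _ _ _ _ _ _ (cos chi) (sin chi ^+ 2)
  ((alpha + beta + 1) / (beta + 2^-1)) (cosh2E x) (cosh2E y)
  (cosh2E z) (sinh_neq0 x0) (sinh_neq0 y0) (sinh_neq0 z0) (sqr_ge0 _) (cos2Dsin2 _) h0.
rewrite /sigma /coth normrM normrM -/gam.
set br := (X in _ * `|X| * _).
have {}B : `|br| <= Cbr by exact: B.
rewrite (powRM _ (ltW Q0) (ltW t0)) [`|_ * _ `^ gam|]ger0_norm ?mulr_ge0 ?powR_ge0 //.
rewrite [`|sin _ `^ _|]ger0_norm ?powR_ge0 //.
have tau1 : tau <= 1.
  rewrite tauE ler_pdivrMr // mul1r /gram QE.
  by have := sqr_cosh_ge1 x; have := sqr_ge0 (cosh y); have := sqr_ge0 (cosh z); lra.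
have sE : sin chi `^ (2 * beta) <= Csin * ((1 - cos chi - 0) `^ (beta - 2^-1) * sin chi).
  have -> : 2 * beta = (beta - 2^-1) + (beta - 2^-1) + 1 by lra.
  rewrite (gt0_powRD _ 1 sin0) (gt0_powRD _ (beta - _) sin0) powRr1 ?(ltW sin0) //
    mulrA ler_wpM2r ?(ltW sin0) //.
  rewrite -powRM ?(ltW sin0) // -expr2 sin2cos2 subr0.
  have -> : 1 - cos chi ^+ 2 = (1 + cos chi) * (1 - cos chi) by ring.
  rewrite powRM; [|lra..]; rewrite ler_wpM2r ?powR_ge0 //.
  by apply: powR_between => //; lra.
rewrite [leRHS](_ : _ = (Q `^ gam * (tau - (1 - cos chi)) `^ gam) * Cbr *
  (Csin * ((1 - cos chi - 0) `^ (beta - 2^-1) * sin chi))); last by ring.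
apply: ler_pM => //; [by pos|exact: powR_ge0|].
by apply: ler_wpM2l => //; pos.
Qed.

(** The hypotheses beta < alpha and beta > -1/2 make both exponents of the beta integral exceed -1;
    its bound scales as tau^(alpha - 1/2). The powers of Q then combine to (alpha - beta - 1) -
    (alpha - 1/2) = -(beta + 1/2), the exponent of the cosines in [kernel_bound]. *)
Lemma kernel_gt_bound : exists2 C : R, 0 <= C &
  forall x y z, triangle x y z ->
  `|kernel_gt alpha beta x y z| <= C * kernel_bound alpha beta x y z.
Proof.
have hb' := hb; have hab' := hab.
pose M := Gamma (alpha + 1) / (Num.sqrt pi * Gamma (alpha - beta) * Gamma (beta + 2^-1)).
have g1 : -1 < gam by rewrite /gam ltrBrDr addNr subr_gt0.
have b1 : -1 < beta - 2^-1 by lra.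
have Cbr0 : 0 <= Cbr by rewrite /Cbr; pos.
have Csin0 : 0 <= Csin by rewrite /Csin; pos.
have bc0 := ltW (betaC_gt0 g1 b1).
exists (`|M| * (Cbr * Csin * betaC gam (beta - 2^-1) * 2 `^ (- (beta + 2^-1)))).
  by pos.
move=> x y z xyz; have g0 := gram_gt0 xyz.
pose Q := 2 * cosh x * cosh y * cosh z.
pose tau := gram x y z / Q.
have Q0 : 0 < Q by rewrite /Q; pos.
have tau0 : 0 < tau by rewrite divr_gt0.
have tau1 : tau <= 1.
  rewrite ler_pdivrMr // mul1r /gram /Q.
  by have := sqr_cosh_ge1 x; have := sqr_ge0 (cosh y); have := sqr_ge0 (cosh z); lra.
have tI : -1 <= 1 - tau <= 1 by lra.
(* The angle beyond which h_+ vanishes. *)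
pose c0 := acos (1 - tau).
have cosc0 : cos c0 = 1 - tau by rewrite acosK.
have c0I : 0 <= c0 <= pi by rewrite acos_ge0 // acos_lepi.
have c0pos : 0 < c0.
  rewrite lt_neqAle; move: c0I => /andP[-> _]; rewrite andbT.
  by apply/eqP => h; move: cosc0; rewrite -h cos0; lra.
have cosP u : 0 < u < pi -> (1 - cos u < tau) = (u < c0).
  move=> /andP[u0 upi].
  have -> : (1 - cos u < tau) = (cos c0 < cos u) by rewrite cosc0 ltrBlDl ltrBlDr addrC.
  by rewrite ltr_cos // in_itv/= ?(ltW u0) ?(ltW upi).
pose K := Cbr * Csin * Q `^ gam.
have K0 : 0 <= K by rewrite /K; pos.
pose g u := (tau - (1 - cos u)) `^ gam * (1 - cos u - 0) `^ (beta - 2^-1) * sin u.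
have D0 := exhausts_oo c0pos.
have inD u : `]0, c0[%classic u -> 0 < u < pi /\ u < c0.
  by rewrite /= in_itv/= => /andP[u0 uc]; move: c0I => /andP[_ c0p];
    rewrite u0 uc (lt_le_trans uc).
have Ig : (\int[mu]_(u in `]0%R, c0[) (g u)%:E <=
    (betaC gam (beta - 2^-1) * tau `^ (alpha - 2^-1))%:E)%E.
  have := @ge0_integral_beta_le R _ _ _ (fun u => 1 - cos u) sin 0 tau gam (beta -
    2^-1) D0 g1 b1 tau0.
  rewrite subr0 (_ : gam + (beta - 2^-1) + 1 = alpha - 2^-1); last by rewrite /gam; lra.
  apply.
  - by move=> u _; exact: continuous_sin.
  - by move=> u _; have := is_deriveB (is_derive_cst (1 : R) u 1) (is_derive_cos u);
      rewrite sub0r opprK.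
  - by move=> u /inD[/andP[u0 upi] _]; rewrite ltW // sin_gt0_pi // u0.
  - move=> u /inD[ui uc]; rewrite cosP // uc andbT subr_gt0.
    move: ui => /andP[u0 upi].
    by rewrite -cos0 ltr_cos // in_itv/= ?lexx ?pi_ge0// (ltW u0) ltW.
have mg : measurable_fun setT g.
  by rewrite /g; meas.
have mI : measurable_fun setT (kernel_gt_integrand alpha beta x y z).
  by apply: measurable_fun_kernel_gt_integrand => //; exact: measurable_cst.
have Iint : `|\int[mu]_(chi in `]0, pi[) kernel_gt_integrand alpha beta x y z chi| <=
    K * (betaC gam (beta - 2^-1) * tau `^ (alpha - 2^-1)).
  apply: normr_Rintegral_le => //; first exact: measurable_funTS.
  apply: (@le_trans _ _ (\int[mu]_(u in `]0%R, c0[) (K%:E * (g u)%:E))%E); last first.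
    rewrite ge0_integralZl_EFin //.
    - rewrite [leRHS]EFinM; apply: lee_wpmul2l; first by rewrite lee_fin.
      exact: Ig.
    - move=> u /inD[/andP[u0 upi] _]; rewrite lee_fin /g.
      by apply: mulr_ge0; [pos|rewrite ltW // sin_gt0_pi // u0].
    - by apply/measurable_EFinP; exact: measurable_funTS.
  rewrite [leLHS]integral_mkcond [leRHS]integral_mkcond.
  apply: ge0_le_integral => //.
  - by move=> u _; apply: erestrict_ge0 => v _; rewrite lee_fin.
  - apply/(measurable_restrictT _ _).1 => //.
    by apply/measurable_EFinP; apply: measurable_funTS; meas.
  - apply/(measurable_restrictT _ _).1 => //.
    by apply: emeasurable_funM => //; apply/measurable_EFinP; exact: measurable_funTS.
  move=> u _; rewrite !patchE !mem_setE !in_itv/=.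
  have [/andP[u0 upi]|nu] := boolP (0 < u < pi); last first.
    case: ifPn => // /andP[u0 uc]; move: nu; rewrite u0/= -leNgt => piu.
    by move: c0I => /andP[_ c0p]; have := lt_le_trans uc (le_trans c0p piu); rewrite ltxx.
  have ui : 0 < u < pi by rewrite u0.
  have := @kernel_gt_integrand_le x y z u Q tau erefl erefl xyz ui; rewrite cosP // u0 /=.
  by case: ifP => _; rewrite -?EFinM lee_fin.
rewrite /kernel_gt normrM normrM -/M.
have -> : `| `|sinh x * sinh y * sinh z| `^ (- (2 * alpha))| =
  `|sinh x * sinh y * sinh z| `^ (- (2 * alpha)) by rewrite ger0_norm ?powR_ge0.
rewrite /kernel_bound xyz.
set s := `|_ * _ * _| `^ _.
have s0 : 0 <= s by rewrite /s; pos.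
apply: (@le_trans _ _ (`|M| * s * (K * (betaC gam (beta - 2^-1) * tau `^ (alpha -
  2^-1))))).
  by apply: ler_wpM2l; [pos|exact: Iint].
rewrite /K /tau powRM ?(ltW g0) ?invr_ge0 ?(ltW Q0) // -(powR_inv1 (ltW Q0)) -powRrM.
have -> : Q `^ (-1 * (alpha - 2^-1)) = Q `^ (- gam) * Q `^ (- (beta + 2^-1)).
  by rewrite -gt0_powRD //; congr (_ `^ _); rewrite /gam; lra.
have QE : Q = 2 * (cosh x * cosh y * cosh z) by rewrite /Q; ring.
have Q1 : Q `^ gam * Q `^ (- gam) = 1 by rewrite -gt0_powRD // subrr powRr0.
rewrite [X in X `^ (- (beta + _))]QE powRM //; last by pos.
rewrite le_eqVlt; apply/orP; left; apply/eqP.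
set G := gram _ _ _ `^ _; set c := (cosh x * _ * _) `^ _; set b := betaC _ _;
  set w := 2 `^ _.
rewrite [LHS](_ : _ = (Q `^ gam * Q `^ (- gam)) * (`|M| * (Cbr * Csin * b * w) * (s * c
  * G))); last by ring.
by rewrite Q1 mul1r.
Qed.

End KernelGtBound.

(** * Reflection and dilation of the line *)

Section ChangeOfVariables.
Context {R : realType}.
Local Notation mu := (@lebesgue_measure R).
Local Open Scope ereal_scope.

Lemma ge0_integral_even (f : R -> \bar R) : measurable_fun [set: R] f ->
  (forall x, 0 <= f x) -> (forall x, f (- x)%R = f x) ->
  \int[mu]_x f x = \int[mu]_(x in `]0%R, +oo[) f x + \int[mu]_(x in `]0%R, +oo[) f x.
Proof.
move=> mf f0 fN.
have mN : measurable_fun [set: measurableTypeR R] (-%R : R -> measurableTypeR R).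
  exact: oppr_measurable.
have E : \int[mu]_(x in `]-oo, 0%R[) f x = \int[mu]_(x in `]0%R, +oo[) f x.
  rewrite (_ : `]-oo, 0%R[%classic =
      (-%R : _ -> measurableTypeR R) @^-1` `]0%R, +oo[); last first.
    by rewrite opp_preimage_itvbndy oppr0.
  transitivity (\int[pushforward mu (-%R : _ -> measurableTypeR R)]_(x in `]0%R,
    +oo[) f x).
    rewrite ge0_integral_pushforward//=; last exact: measurable_funS mf.
    by apply: eq_integral => x _ /=; rewrite fN.
  by apply: eq_measure_integral => //= A mA AS; exact: lebesgue_measureN.
rewrite -{2}E.
have -> : [set: R] = `]-oo, 0%R]%classic `|` `]0%R, +oo[%classic.
  apply/seteqP; split => x //= _; rewrite !in_itv/= andbT.
  by case: (leP x 0%R) => _; [left|right].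
rewrite ge0_integral_setU//=.
- rewrite addeC; congr (_ + _).
  by rewrite integral_itv_bndo_bndc //; exact: measurable_funTS.
- exact: measurable_funTS.
- by apply/disj_setPS => x /=; rewrite !in_itv/= andbT; case: (leP x 0%R) => // ? [].
Qed.

(** The image of Lebesgue measure under the dilation, multiplied by k, gives half-open intervals
    their length, hence is Lebesgue measure. *)
Lemma ge0_integral_scale (k : R) (f : R -> \bar R) : (0 < k)%R ->
  measurable_fun [set: R] f -> (forall x, 0 <= f x) ->
  k%:E * \int[mu]_x f (k * x)%R = \int[mu]_x f x.
Proof.
move=> k0 mf f0.
have mk : measurable_fun setT (fun x : measurableTypeR R => (k * x)%R : measurableTypeR
  R).
  exact: mulrl_measurable.
pose nu := measure_function_pushforward__canonical__measure_function_Measure mu mk.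
pose knn := NngNum (ltW k0).
rewrite (_ : \int[mu]_x f (k * x)%R = \int[nu]_x f x); last first.
  by rewrite (ge0_integral_pushforward mk).
rewrite -(@ge0_integral_mscale _ _ _ nu _ measurableT knn) //.
apply: eq_measure_integral => //= A mA _; apply/esym.
apply: (@lebesgue_measure_unique R (mscale knn nu)) => //= _ [[a b]] _ <-.
rewrite /mscale/= /pushforward.
rewrite (_ : _ @^-1` _ = `](a / k)%R, (b / k)%R]%classic); last first.
  apply/seteqP; split => x /=; rewrite !in_itv/= ltr_pdivrMr // ler_pdivlMr //;
  by rewrite mulrC.
rewrite !lebesgue_measure_itv/= !lte_fin ltr_pM2r ?invr_gt0 //.
case: ifP => _; last by rewrite mule0.
by rewrite -!EFinB -EFinM -mulrBl mulrC divfK ?gt_eqF.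
Qed.

End ChangeOfVariables.

(** * The Schur weight *)

Section SchurWeight.
Context {R : realType}.
Local Notation mu := (@lebesgue_measure R).
Implicit Types x y z : R.

Lemma jacobi_weight_absE (alpha beta x : R) : jacobi_weight alpha beta `|x| =
  `|sinh x| `^ (2 * alpha + 1) * cosh x `^ (2 * beta + 1).
Proof. by rewrite /jacobi_weight sinh_abs cosh_abs. Qed.

(* [1] at the origin is a dummy value that keeps the weight positive. *)
Definition schur_weight (beta e x : R) : R :=
  if x == 0 then 1 else `|sinh x| `^ (- e) * cosh x `^ (- (beta + 2^-1)).

Lemma schur_weight_gt0 beta e x : 0 < schur_weight beta e x.
Proof.
rewrite /schur_weight; case: ifPn => // x0; apply: mulr_gt0; apply: powR_gt0.
  by rewrite normr_gt0 sinh_neq0.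
exact: cosh_gt0.
Qed.

Lemma schur_weightN beta e x : schur_weight beta e (- x) = schur_weight beta e x.
Proof. by rewrite /schur_weight oppr_eq0 sinhN normrN coshN. Qed.

Lemma schur_weight_le1 beta x : - 2^-1 <= beta -> schur_weight beta 0 x <= 1.
Proof.
move=> hb; rewrite /schur_weight; case: ifP => // _.
rewrite oppr0 powRr0 mul1r powRN invf_le1 ?powR_gt0 ?cosh_gt0 //.
rewrite -{1}(powRr0 (cosh x)) ler_powR ?cosh_ge1 //; lra.
Qed.

Lemma measurable_fun_schur_weight beta e :
  measurable_fun [set: R] (schur_weight beta e).
Proof.
apply: measurable_fun_ifT.
- by apply: measurable_fun_eqr; [exact: measurable_id|exact: measurable_cst].
- exact: measurable_cst.
- by meas.
Qed.

Lemma triangleNz x y z : triangle x y (- z) = triangle x y z.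
Proof. by rewrite /triangle oppr_eq0 normrN. Qed.

Lemma kernel_boundNz alpha beta x y z :
  kernel_bound alpha beta x y (- z) = kernel_bound alpha beta x y z.
Proof. by rewrite /kernel_bound triangleNz sinhN !coshN mulrN normrN /gram coshN. Qed.

(* Only the factors [(cosh (|x| + |y|) - cosh z) (cosh z - cosh (|x| - |y|))] and
   [sinh z] survive, and [(sinh z)^-e <= (cosh z - cosh (|x| - |y|))^-e] leaves a
   beta integral in the variable [cosh z]. *)
Lemma schur_inequality (alpha beta e : R) :
  - 2^-1 < alpha -> 0 <= e < alpha + 2^-1 ->
  exists2 C : R, 0 < C & forall x y,
  (\int[mu]_z (kernel_bound alpha beta x y z * schur_weight beta e z *
              jacobi_weight alpha beta `|z|)%:E <=
   (C * schur_weight beta e x * schur_weight beta e y)%:E)%E.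
Proof.
move=> ha /andP[e0 ea].
have p1 : -1 < alpha - 2^-1 by lra.
have q1 : -1 < alpha - 2^-1 - e by lra.
pose Cb := betaC (alpha - 2^-1) (alpha - 2^-1 - e).
have Cb0 : 0 < Cb by exact: betaC_gt0.
(* The power of 2 comes from cosh r - cosh l = 2 |sinh x sinh y|, where r = |x| + |y| and l = ||x| -
   |y||. The final 2 C adds the two half-lines. *)
pose C := Cb * 2 `^ (2 * alpha - e).
have C0 : 0 < C by rewrite mulr_gt0 // powR_gt0.
exists (2 * C); first by rewrite mulr_gt0.
move=> x y.
pose f z := kernel_bound alpha beta x y z * schur_weight beta e z *
              jacobi_weight alpha beta `|z|.
have f0 z : 0 <= f z.
  have := ltW (schur_weight_gt0 beta e z); have := kernel_bound_ge0 alpha beta x y z =>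
    h1 h2.
  by have := jacobi_weight_ge0 alpha beta `|z| => h3; rewrite /f; pos.
have mf : measurable_fun [set: R] f.
  apply: measurable_funM; last exact: measurable_jacobi_weight.
  apply: measurable_funM; last exact: measurable_fun_schur_weight.
  by apply: measurable_fun_kernel_bound; [exact: measurable_cst|exact:
    measurable_cst|exact: measurable_id].
have [xy0|/norP[x0 y0]] := boolP ((x == 0) || (y == 0)).
  rewrite (_ : (fun z => _) = (cst 0%E)).
    rewrite integral_cst // mul0e lee_fin.
    by rewrite !mulr_ge0 ?(ltW C0)// ltW // schur_weight_gt0.
  apply/funext => z; rewrite /kernel_bound /triangle.
  by move: xy0 => /orP[/eqP->|/eqP->]; rewrite eqxx /= ?andbF /= !mul0r.
rewrite (@ge0_integral_even _ (fun z => (f z)%:E)); last 3 first.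
- exact/measurable_EFinP.
- by move=> z; rewrite lee_fin.
- by move=> z; rewrite /f kernel_boundNz schur_weightN normrN.
suff H : (\int[mu]_(z in `]0%R, +oo[) (f z)%:E <=
    (C * schur_weight beta e x * schur_weight beta e y)%:E)%E.
  rewrite [leRHS](_ : _ = (C * schur_weight beta e x * schur_weight beta e y)%:E +
    (C * schur_weight beta e x * schur_weight beta e y)%:E)%E; first exact: leeD.
  rewrite -EFinD (_ : 2 * C * schur_weight beta e x * schur_weight beta e y =
    2 * (C * schur_weight beta e x * schur_weight beta e y)); last by rewrite !mulrA.
  by rewrite mulr_natl mulr2n.
pose l := `| `|x| - `|y| |; pose r := `|x| + `|y|.
have ax : 0 < `|x| by rewrite normr_gt0.
have ay : 0 < `|y| by rewrite normr_gt0.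
have l0 : 0 <= l by exact: normr_ge0.
have lr : l < r by rewrite /l /r ltr_norml; apply/andP; split; lra.
have r0 : 0 <= r by lra.
have crl : cosh r - cosh l = 2 * `|sinh x * sinh y|.
  by rewrite /r /l cosh_abs coshD coshB !cosh_abs !sinh_abs (normrM (sinh x)); ring.
have clr : cosh l < cosh r by rewrite cosh_ltP.
pose K := `|sinh x * sinh y| `^ (- (2 * alpha)) * (cosh x * cosh y) `^ (- (beta + 2^-1)).
have K0 : 0 <= K by rewrite /K; pos.
pose g z := (cosh r - cosh z) `^ (alpha - 2^-1) *
  (cosh z - cosh l) `^ (alpha - 2^-1 - e) * sinh z.
have mg : measurable_fun [set: R] g by rewrite /g; meas.
have g0 z : `]l, r[%classic z -> 0 <= g z.
  rewrite /= in_itv/= => /andP[lz _]; rewrite /g.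
  have h : 0 <= sinh z by rewrite ltW // sinh_gt0 // (le_lt_trans l0).
  by pos.
have Ig : (\int[mu]_(z in `]l, r[) (g z)%:E <=
    (Cb * (cosh r - cosh l) `^ (2 * alpha - e))%:E)%E.
  have := @ge0_integral_beta_le R _ _ _ cosh sinh (cosh l) (cosh r)
    (alpha - 2^-1) (alpha - 2^-1 - e) (exhausts_oo lr) p1 q1 clr.
  rewrite (_ : alpha - 2^-1 + (alpha - 2^-1 - e) + 1 = 2 * alpha - e); last by lra.
  apply.
  - by move=> z _; exact: continuous_sinh.
  - by move=> z _; exact: is_derive_cosh.
  - by move=> z; rewrite /= in_itv/= => /andP[lz _];
      rewrite ltW // sinh_gt0 // (le_lt_trans l0).
  - move=> z; rewrite /= in_itv/= => /andP[lz zr].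
    have z0 : 0 <= z by rewrite ltW // (le_lt_trans l0).
    by rewrite !cosh_ltP // lz.
apply: (@le_trans _ _ (\int[mu]_(z in `]l, r[) (K%:E * (g z)%:E))%E); last first.
  rewrite ge0_integralZl_EFin //.
  - rewrite (_ : C * schur_weight beta e x * schur_weight beta e y =
      K * (Cb * (cosh r - cosh l) `^ (2 * alpha - e))).
      by rewrite [leRHS]EFinM; apply: lee_wpmul2l; [rewrite lee_fin|exact: Ig].
    rewrite crl /K /C /schur_weight (negbTE x0) (negbTE y0).
    have s0 : 0 < `|sinh x * sinh y| by rewrite normr_gt0 mulf_neq0 // sinh_neq0.
    rewrite (powRM _ (ler0n _ 2) (ltW s0)) (gt0_powRD _ (- e) s0).
    have E1 : `|sinh x * sinh y| `^ (2 * alpha) * `|sinh x * sinh y| `^ (- (2 * alpha))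
      = 1.
      by rewrite -(gt0_powRD _ _ s0) subrr powRr0.
    rewrite [RHS](_ : _ = (`|sinh x * sinh y| `^ (2 * alpha) * `|sinh x * sinh y| `^ (-
      (2 * alpha))) *
      ((cosh x * cosh y) `^ (- (beta + 2^-1)) * Cb * 2 `^ (2 * alpha - e) * `|sinh x *
        sinh y| `^ (- e))); last by ring.
    rewrite E1 mul1r (normrM (sinh x)) (powRM _ (normr_ge0 _) (normr_ge0 _)).
    rewrite (powRM _ (ltW (cosh_gt0 x)) (ltW (cosh_gt0 y))).
    set u1 := `|sinh x| `^ _; set u2 := `|sinh y| `^ _.
    set v1 := cosh x `^ _; set v2 := cosh y `^ _; set w := 2 `^ _.
    by clearbody u1 u2 v1 v2 w Cb; ring.
  - by apply/measurable_EFinP; exact: measurable_funTS.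
rewrite [leLHS]integral_mkcond [leRHS]integral_mkcond.
apply: ge0_le_integral => //.
- by move=> z _; apply: erestrict_ge0 => v _; rewrite lee_fin.
- apply/(measurable_restrictT _ _).1 => //.
  by apply/measurable_EFinP; apply: measurable_funTS.
- apply/(measurable_restrictT _ _).1 => //.
  by apply: emeasurable_funM => //; apply/measurable_EFinP; exact: measurable_funTS.
move=> z _; rewrite !patchE !mem_setE !in_itv/= andbT.
have [z0|nz] := ltP 0 z; last first.
  case: ifP => // zlr; rewrite -EFinM lee_fin mulr_ge0 // g0 //=.
have tE : triangle x y z = (l < z < r).
  by rewrite /triangle x0 y0 (gt_eqF z0) /= (gtr0_norm z0).
rewrite /f /kernel_bound tE; case: ifPn => zlr; last by rewrite !mul0r.
move: zlr => /andP[lz zr].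
rewrite -EFinM lee_fin jacobi_weight_absE /schur_weight (gt_eqF z0).
have sz := sinh_gt0 z0; have cz := cosh_gt0 z.
have lcz : cosh l < cosh z by rewrite cosh_ltP // ltW.
have czr : cosh z < cosh r by rewrite cosh_ltP // ltW.
rewrite (normrM _ (sinh z)) (gtr0_norm sz) gramE.
rewrite (_ : cosh (`|x| - `|y|) = cosh l); last by rewrite /l cosh_abs.
rewrite -/r.
have sxy0 : 0 <= `|sinh x * sinh y| by [].
have cxy0 : 0 <= cosh x * cosh y by pos.
rewrite (powRM _ sxy0 (ltW sz)) (powRM _ cxy0 (ltW cz)).
have d1 : 0 < cosh r - cosh z by rewrite subr_gt0.
have d2 : 0 < cosh z - cosh l by rewrite subr_gt0.
rewrite (powRM _ (ltW d1) (ltW d2)).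
rewrite /g /K (gt0_powRD _ (- e) d2).
set S := `|sinh x * sinh y| `^ _; set Q := (cosh x * cosh y) `^ _.
set U := (_ - cosh z) `^ _; set V := (_ - _) `^ (alpha - 2^-1).
(* Of the powers of sinh z in W and A a single factor sinh z is left, the derivative of cosh z; the
   powers of cosh z in W, phi and A cancel completely. *)
have E1 : sinh z `^ (2 * alpha + 1) = sinh z `^ (2 * alpha) * sinh z.
  by rewrite gt0_powRD // powRr1 // ltW.
have E2 : sinh z `^ (- (2 * alpha)) * sinh z `^ (2 * alpha) = 1.
  by rewrite -gt0_powRD // addNr powRr0.
have E3 : cosh z `^ (- (beta + 2^-1)) * cosh z `^ (- (beta + 2^-1)) * cosh z `^ (2 *
  beta + 1) = 1.
  by rewrite -!gt0_powRD // (_ : _ + _ = 0) ?powRr0 //; lra.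
rewrite E1.
rewrite [leLHS](_ : _ = (sinh z `^ (- (2 * alpha)) * sinh z `^ (2 * alpha)) *
  (cosh z `^ (- (beta + 2^-1)) * cosh z `^ (- (beta + 2^-1)) * cosh z `^ (2 * beta + 1)) *
  (S * Q * (U * V) * sinh z * sinh z `^ (- e))); last by ring.
rewrite E2 E3 !mul1r.
rewrite [leRHS](_ : _ = S * Q * (U * V) * sinh z * (cosh z - cosh l) `^ (- e));
  last by ring.
apply: ler_wpM2l; first by have sz' := ltW sz; rewrite /S /Q /U /V; pos.
rewrite !powRN lef_pV2 ?posrE ?powR_gt0 //.
apply: ge0_ler_powR; rewrite ?nnegrE ?(ltW sz) ?(ltW d2) //.
(* Since cosh l >= 1, (cosh z - cosh l)^2 <= (cosh z - 1)^2 <= cosh^2 z - 1 = sinh^2 z. *)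
have := cosh_ge1 l; have := cosh2E z; move: (cosh z) (sinh z) cz sz => X s; nra.
Qed.

(* A beta integral in the variable [tanh z]. *)
Lemma schur_weight_Lp (alpha beta e q : R) :
  e * q < 2 * alpha + 2 -> 2 * (alpha + beta + 1) < (e + (beta + 2^-1)) * q ->
  exists2 C : R, 0 <= C &
  (\int[mu]_z (schur_weight beta e z `^ q * jacobi_weight alpha beta `|z|)%:E <= C%:E)%E.
Proof.
move=> h1 h2.
(* phi^q A equals (tanh z)^kap (cosh z)^(-2 del), that is t^kap (1 - t^2)^(del - 1) dt for t = tanh
   z. The two hypotheses say that kap > -1 and del > 0; [c] bounds (1 + t)^(del - 1). *)
pose kap := 2 * alpha + 1 - e * q.
pose del := ((e + (beta + 2^-1)) * q - 2 * (alpha + beta + 1)) / 2.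
have k1 : -1 < kap by rewrite /kap; lra.
have d0 : 0 < del by rewrite /del; lra.
have d1 : -1 < del - 1 by lra.
pose c : R := 1 `^ (del - 1) + 2 `^ (del - 1).
have c0 : 0 <= c by rewrite /c; pos.
pose Cb := betaC (del - 1) kap.
have Cb0 : 0 < Cb by exact: betaC_gt0.
have Cb0' := ltW Cb0.
exists (c * Cb + c * Cb); first by pos.
pose f z := schur_weight beta e z `^ q * jacobi_weight alpha beta `|z|.
have f0 z : 0 <= f z by rewrite mulr_ge0 ?powR_ge0 // jacobi_weight_ge0.
have mf : measurable_fun [set: R] f.
  apply: measurable_funM; last exact: measurable_jacobi_weight.
  by apply: measurable_fun_powR; exact: measurable_fun_schur_weight.
rewrite (@ge0_integral_even _ (fun z => (f z)%:E)); last 3 first.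
- exact/measurable_EFinP.
- by move=> z; rewrite lee_fin.
- by move=> z; rewrite /f schur_weightN normrN.
pose tanh z : R := sinh z / cosh z.
suff H : (\int[mu]_(z in `]0%R, +oo[) (f z)%:E <= (c * Cb)%:E)%E.
  by rewrite EFinD; exact: leeD.
have tP z : 0 < z -> 0 < tanh z < 1.
  move=> z0; rewrite divr_gt0 ?sinh_gt0 ?cosh_gt0 //= ltr_pdivrMr ?cosh_gt0 // mul1r.
  by have := sinh_lt_cosh z; rewrite gtr0_norm // sinh_gt0.
have tE z : cosh z ^- 2 = (1 - tanh z) * (1 + tanh z).
  have := cosh2E z => h; have := gt_eqF (cosh_gt0 z) => h3.
  have -> : (1 - tanh z) * (1 + tanh z) = (cosh z ^+ 2 - sinh z ^+ 2) / cosh z ^+ 2.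
    by rewrite /tanh; field; rewrite h3.
  by rewrite h addrK mul1r.
pose g z := (1 - tanh z) `^ (del - 1) * (tanh z - 0) `^ kap * cosh z ^- 2.
have mg : measurable_fun [set: R] g by rewrite /g /tanh; meas.
have g0 z : 0 <= g z by rewrite mulr_ge0 ?mulr_ge0 ?powR_ge0 // invr_ge0 sqr_ge0.
apply: (@le_trans _ _ (\int[mu]_(z in `]0%R, +oo[) (c%:E * (g z)%:E))%E); last first.
  rewrite ge0_integralZl_EFin //.
  - rewrite [leRHS]EFinM; apply: lee_wpmul2l; first by rewrite lee_fin.
    have := @ge0_integral_beta_le R _ _ _ tanh (fun z => cosh z ^- 2) 0 1
      (del - 1) kap exhausts_oy d1 k1 ltr01.
    rewrite subr0 powR1 mulr1; apply.
    + move=> z _; apply: continuousV; first by rewrite sqrf_eq0 gt_eqF // cosh_gt0.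
      by apply: continuousM; exact: continuous_cosh.
    + move=> z _.
      have cz : cosh z != 0 by rewrite gt_eqF // cosh_gt0.
      have dV := is_deriveV cz (is_derive_cosh z).
      have := is_deriveM (is_derive_sinh z) dV.
      rewrite (_ : _ *: _ + _ *: _ = cosh z ^- 2) // /GRing.scale /=.
      by rewrite [RHS](_ : _ = (cosh z ^+ 2 - sinh z ^+ 2) / cosh z ^+ 2);
        [field|rewrite cosh2E addrK mul1r].
    + by move=> z _; rewrite invr_ge0 sqr_ge0.
    + by move=> z; rewrite /= in_itv/= andbT; exact: tP.
  - by move=> z _; rewrite lee_fin.
  - by apply/measurable_EFinP; exact: measurable_funTS.
apply: ge0_le_integral => //.
- by move=> z _; rewrite lee_fin.
- by apply/measurable_EFinP; exact: measurable_funTS.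
- by apply: emeasurable_funM => //; apply/measurable_EFinP; exact: measurable_funTS.
move=> z; rewrite /= in_itv/= andbT => z0; rewrite -EFinM lee_fin.
have sz := sinh_gt0 z0; have cz := cosh_gt0 z.
have /andP[t0 t1] := tP _ z0.
have t1' : 0 < 1 - tanh z by rewrite subr_gt0.
have t1'' : 0 < 1 + tanh z by lra.
rewrite /f /schur_weight (gt_eqF z0) jacobi_weight_absE (gtr0_norm sz).
rewrite powRM ?powR_ge0 // -!powRrM.
have sE : sinh z = tanh z * cosh z by rewrite /tanh divfK ?gt_eqF.
rewrite [leLHS](_ : _ = tanh z `^ kap * cosh z `^ (- (2 * del))); last first.
  rewrite [LHS](_ : _ = (sinh z `^ (- e * q) * sinh z `^ (2 * alpha + 1)) *
    (cosh z `^ (- (beta + 2^-1) * q) * cosh z `^ (2 * beta + 1))); last by ring.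
  rewrite -!gt0_powRD // (_ : - e * q + (2 * alpha + 1) = kap); last by rewrite /kap; lra.
  rewrite sE powRM ?(ltW t0) ?(ltW cz) // -mulrA -gt0_powRD //.
  by congr (_ * _ `^ _); rewrite /kap /del; field.
have -> : cosh z `^ (- (2 * del)) = (cosh z ^- 2) `^ (del - 1) * cosh z ^- 2.
  rewrite -powR_invn ?(ltW cz) // -powRrM -gt0_powRD //; congr (_ `^ _); lra.
rewrite [X in X `^ (del - 1)]tE (powRM _ (ltW t1') (ltW t1'')) /g subr0.
rewrite [leLHS](_ : _ = (1 - tanh z) `^ (del - 1) * tanh z `^ kap * cosh z ^- 2 *
  (1 + tanh z) `^ (del - 1)); last by ring.
rewrite [leRHS]mulrC; apply: ler_wpM2l.
  by rewrite mulr_ge0 ?mulr_ge0 ?powR_ge0 // invr_ge0 sqr_ge0.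
by apply: powR_between => //; lra.
Qed.

(** With a = alpha + 1/2 and b = beta + 1/2 an e between max(0, L) and min(a, U) is wanted. The
    hypothesis q > 2 gives L < a, and b >= 0 gives L < U, so the midpoint will do. *)
Lemma exists_schur_exponent (alpha beta q : R) : - 2^-1 <= beta -> - 2^-1 < alpha ->
  2 < q -> exists e : R, [/\ 0 <= e < alpha + 2^-1, e * q < 2 * alpha + 2 &
    2 * (alpha + beta + 1) < (e + (beta + 2^-1)) * q].
Proof.
move=> hb ha q2.
pose a := alpha + 2^-1; pose b := beta + 2^-1.
have a0 : 0 < a by rewrite /a; lra.
have b0 : 0 <= b by rewrite /b; lra.
have q0 : 0 < q by lra.
pose L := 2 * (a + b) / q - b; pose U := (2 * a + 1) / q.
have U0 : 0 < U by rewrite divr_gt0 //; lra.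
have La : L < a.
  by rewrite ltrBlDr ltr_pdivrMr // mulrC ltr_pM2l //; lra.
have LU : L < U.
  rewrite /L /U ltrBlDr -ltrBlDl -mulrBl ltr_pdivrMr //.
  have : 0 <= b * (q - 2) by rewrite mulr_ge0 //; lra.
  by lra.
have [e [e0 ea eL eU]] : exists e, [/\ 0 <= e, e < a, L < e & e < U].
  exists ((Num.max 0 L + Num.min a U) / 2).
  by case: (leP 0 L) => h1; case: (leP a U) => h2; split; lra.
exists e; split.
- by rewrite e0.
- by move: eU; rewrite /U ltr_pdivlMr // /a; lra.
- by move: eL; rewrite /L ltrBlDr ltr_pdivrMr // /a /b; lra.
Qed.

End SchurWeight.

(** * Inequalities and Tonelli's theorem for extended reals *)

Section ErealInequalities.
Context {R : realType}.
Implicit Types (a b T Q : \bar R).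

(** The infimum over t of the right-hand side is sqrt(a Q), attained at t = sqrt(Q / a) if 0 < Q <
    oo. Cauchy-Schwarz thus follows from an integrated AM-GM inequality, with no finiteness known
    beforehand. *)
Lemma sqre_le_AMGM T Q (a : R) : 0 < a -> (0 <= T)%E -> (0 <= Q)%E ->
  (forall t : R, 0 < t -> (T <= (t / 2 * a)%:E + ((2 * t)^-1)%:E * Q)%E) ->
  (T * T <= a%:E * Q)%E.
Proof.
move=> a0 T0 Q0 H; case: Q Q0 H => [q| |] // q0 H; last first.
  by rewrite gt0_muley ?lte_fin // leey.
have Tfin : T \is a fin_num.
  rewrite ge0_fin_numE //; apply: le_lt_trans (H 1 ltr01) _.
  by rewrite -EFinM -EFinD ltry.
move: T0 H; rewrite -(fineK Tfin); move: (fine T) => r r0 H.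
rewrite lee_fin in r0; rewrite -!EFinM lee_fin.
rewrite lee_fin in q0.
have {}H t : 0 < t -> r <= t / 2 * a + (2 * t)^-1 * q.
  by move=> /H; rewrite -EFinM -EFinD lee_fin.
move: q0; rewrite le_eqVlt => /orP[/eqP q0|q0].
  rewrite -q0 mulr0; suff -> : r = 0 by rewrite mulr0.
  apply/eqP; rewrite eq_le r0 andbT leNgt; apply/negP => rp.
  have := H (r / a) (divr_gt0 rp a0); rewrite -q0 mulr0 addr0.
  by rewrite (_ : r / a / 2 * a = r / 2); [lra|field; rewrite gt_eqF].
pose t := Num.sqrt (q / a).
have t0 : 0 < t by rewrite sqrtr_gt0 divr_gt0.
have tt : t * t = q / a by rewrite -expr2 sqr_sqrtr // ltW // divr_gt0.
have qE : q = a * (t * t) by rewrite tt mulrCA divff ?mulr1 // gt_eqF.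
have := H t t0; rewrite (_ : t / 2 * a + (2 * t)^-1 * q = a * t); last first.
  by rewrite {1}qE; field; rewrite gt_eqF.
move=> rt; rewrite qE (_ : a * (a * (t * t)) = (a * t) * (a * t)); last by ring.
exact: ler_pM.
Qed.

Lemma sqreD_le a b : (0 <= a)%E -> (0 <= b)%E ->
  ((a + b) * (a + b) <= 2%:E * (a * a) + 2%:E * (b * b))%E.
Proof.
case: a => [a| |] //; case: b => [b| |] // a0 b0.
- rewrite -EFinD -!EFinM -EFinD lee_fin.
  have := sqr_ge0 (a - b); rewrite expr2; lra.
- by rewrite mulyy gt0_muley ?lte_fin // addey // leey.
- by rewrite mulyy gt0_muley ?lte_fin // addye // leey.
- by rewrite mulyy gt0_muley ?lte_fin // addye // leey.
Qed.

Lemma continuous_addl (a e : R) : {for e, continuous (fun t => a + t)}.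
Proof. by apply: continuousD; [exact: cst_continuous|exact: cvg_id]. Qed.

(** Allows bounds that may vanish to be enlarged by e > 0 before dividing by them. *)
Lemma lee_right_limit (T : \bar R) (h : R -> R) : {for 0, continuous h} ->
  (forall e : R, 0 < e -> (T <= (h e)%:E)%E) -> (T <= (h 0)%:E)%E.
Proof.
move=> ch H.
have hcv : (h n.+1%:R^-1)%:E @[n --> \oo] --> (h 0)%:E.
  apply: cvg_EFin; first exact: nearW.
  exact: (cvg_comp _ _ (@cvg_harmonic R) ch).
rewrite -(cvg_lim _ hcv) //; apply: lime_ge; first by apply/cvg_ex; eexists; exact: hcv.
by apply: nearW => n; apply: H; rewrite invr_gt0.
Qed.

End ErealInequalities.

Section Tonelli.
Context {R : realType}.
Local Notation M := (measurableTypeR R).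
Local Notation mu := (@lebesgue_measure R).
Local Open Scope ereal_scope.

Lemma tonelli2 (f : M -> M -> \bar R) :
  measurable_fun setT (fun p : M * M => f p.1 p.2) -> (forall x y, 0 <= f x y) ->
  \int[mu]_x \int[mu]_y f x y = \int[mu]_y \int[mu]_x f x y.
Proof.
move=> mf f0.
exact: (@fubini_tonelli _ _ M M R mu mu (fun p => f p.1 p.2) mf (fun p => f0 p.1 p.2)).
Qed.

Lemma measurable_fun_integral d (T : measurableType d) (f : T -> M -> \bar R) :
  measurable_fun setT (fun p : T * M => f p.1 p.2) -> (forall x y, 0 <= f x y) ->
  measurable_fun setT (fun x => \int[mu]_y f x y).
Proof.
move=> mf f0.
exact: (@measurable_fun_fubini_tonelli_F _ _ T M R mu (fun p => f p.1 p.2) mf (fun p =>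
  f0 p.1 p.2)).
Qed.

Lemma measurable_fun_integral2 d (T : measurableType d) (f : T -> M -> M -> \bar R) :
  measurable_fun setT (fun p : T * M * M => f p.1.1 p.1.2 p.2) ->
  (forall x y z, 0 <= f x y z) ->
  measurable_fun setT (fun x => \int[mu]_y \int[mu]_z f x y z).
Proof.
move=> mf f0; apply: measurable_fun_integral => [|x y]; last exact: integral_ge0.
exact: (@measurable_fun_integral _ (T * M)%type (fun p z => f p.1 p.2 z)).
Qed.

Lemma tonelli3 (f : M -> M -> M -> \bar R) :
  measurable_fun setT (fun p : M * M * M => f p.1.1 p.1.2 p.2) ->
  (forall x y z, 0 <= f x y z) ->
  \int[mu]_x \int[mu]_y \int[mu]_z f x y z = \int[mu]_y \int[mu]_z \int[mu]_x f x y z.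
Proof.
move=> mf f0; rewrite tonelli2; last 2 first.
- exact: (@measurable_fun_integral _ (M * M)%type (fun p z => f p.1 p.2 z)).
- by move=> x y; exact: integral_ge0.
apply: eq_integral => y _; apply: tonelli2 => //.
have h : measurable_fun setT (fun p : M * M => (p.1, y, p.2)).
  by apply: measurable_fun_pair => //; exact: measurable_fun_pair.
exact: (measurableT_comp mf h).
Qed.

End Tonelli.

(** * The Schur test for bilinear forms *)

Section SchurTest.
Context {R : realType}.
Local Notation M := (measurableTypeR R).
Local Notation mu := (@lebesgue_measure R).
Variables (W : R -> R -> R -> R) (A phi : R -> R) (C : R).
Hypothesis mW : measurable_fun setT (fun p : M * M * M => W p.1.1 p.1.2 p.2).
Hypothesis W0 : forall x y z, 0 <= W x y z.
Hypothesis WC : forall x y z, W x y z = W y x z.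
Hypothesis WCA : forall x y z, W x y z = W x z y.
Hypothesis mA : measurable_fun [set: M] A.
Hypothesis A0 : forall x, 0 <= A x.
Hypothesis mphi : measurable_fun [set: M] phi.
Hypothesis phi0 : forall x, 0 < phi x.
Hypothesis C0 : 0 < C.
Hypothesis schurW : forall x y,
  (\int[mu]_z (W x y z * phi z * A z)%:E <= (C * phi x * phi y)%:E)%E.

Implicit Types (u v w : M -> R) (x y z : M).

(** Extended-real valued, so that estimates can be stated before convergence is known. *)
Definition tri_form (u v : M -> R) (x : M) : \bar R :=
  (\int[mu]_y \int[mu]_z (u z * v y * (W x y z * A z * A y))%:E)%E.

Lemma measurable_fun_kernelW d (T : measurableType d) (X Y Z : T -> M) :
  measurable_fun setT X -> measurable_fun setT Y -> measurable_fun setT Z ->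
  measurable_fun setT (fun t => W (X t) (Y t) (Z t)).
Proof.
move=> mX mY mZ.
have h : measurable_fun setT (fun t => (X t, Y t, Z t)).
  by apply: measurable_fun_pair => //; exact: measurable_fun_pair.
exact: (measurableT_comp mW h).
Qed.

Let mcomp d (T : measurableType d) (f : M -> R) (X : T -> M) :
  measurable_fun setT f -> measurable_fun setT X ->
  measurable_fun setT (fun t => f (X t)).
Proof. by move=> mf mX; exact: measurableT_comp mf mX. Qed.

Ltac form_meas := repeat match goal with
  | |- measurable_fun _ (EFin \o _) => apply/measurable_EFinP
  | |- measurable_fun _ (fun t => EFin _) => apply/measurable_EFinP
  | |- measurable_fun _ (fun t => _ * _) => apply: measurable_funM
  | |- measurable_fun _ (fun t => _ ^+ 2) => apply: measurable_fun_sqr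
  | |- measurable_fun _ (fun t => _ ^-1) => apply: measurable_fun_inv
  | |- measurable_fun _ (fun t => W _ _ _) => apply: measurable_fun_kernelW
  | |- measurable_fun _ (W _ _) => apply: (measurable_fun_kernelW
      (measurable_cst _) (measurable_cst _) (@measurable_id _ _ _))
  | |- measurable_fun _ (fun t => t.1) => exact: measurable_fst
  | |- measurable_fun _ (fun t => t.2) => exact: measurable_snd
  | |- measurable_fun _ (fun t => t.1.1) => exact: (measurableT_comp measurable_fst
    measurable_fst)
  | |- measurable_fun _ (fun t => t.1.2) => exact: (measurableT_comp measurable_snd
    measurable_fst)
  | |- measurable_fun _ (fun t => t) => exact: measurable_id
  | |- measurable_fun _ (fun t => ?f (_ t)) => apply: (mcomp (f := f)) => //
  | |- measurable_fun _ (fun t => ?f (_ (_ t))) => apply: (mcomp (f := f)) => //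
  | |- measurable_fun _ (fun t => ?f t) => exact: (mcomp (f := f))
  | |- measurable_fun _ (fun t => ?c) => exact: measurable_cst
  | |- _ => assumption
  end.

Lemma tri_form_ge0 u v x : (forall z, 0 <= u z) -> (forall z, 0 <= v z) ->
  (0 <= tri_form u v x)%E.
Proof.
move=> u0 v0; apply: integral_ge0 => y _; apply: integral_ge0 => z _.
rewrite lee_fin; have := A0 z; have := A0 y; have := W0 x y z => h1 h2 h3.
by have := u0 z; have := v0 y => h4 h5; pos.
Qed.

Lemma measurable_fun_tri_form u v : measurable_fun [set: M] u ->
  measurable_fun [set: M] v -> (forall z, 0 <= u z) -> (forall z, 0 <= v z) ->
  measurable_fun [set: M] (tri_form u v).
Proof.
move=> mu_ mv u0 v0.
apply: (@measurable_fun_integral2 R _ M (fun x y z => (u z * v y * (W x y z * A z * A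
  y))%:E)).
  by form_meas.
move=> x y z; rewrite lee_fin; have := A0 z; have := A0 y; have := W0 x y z => h1 h2 h3.
by have := u0 z; have := v0 y => h4 h5; pos.
Qed.

(** The Schur inequality in z, integrated against w(y). The AM-GM splittings that follow reduce to
    it. *)
Lemma integral_schur_le (w : M -> R) x : measurable_fun [set: M] w ->
  (forall y, 0 <= w y) ->
  (\int[mu]_y \int[mu]_z (w y * (W x y z * phi z * A z))%:E <=
   (C * phi x)%:E * \int[mu]_y (w y * phi y)%:E)%E.
Proof.
move=> mw w0.
have pos3 y z : 0 <= W x y z * phi z * A z.
  by have := A0 z; have := ltW (phi0 z); have := W0 x y z => h1 h2 h3; pos.
rewrite -ge0_integralZl_EFin //; last 3 first.
- by move=> y _; rewrite lee_fin mulr_ge0 // ltW.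
- by form_meas.
- by rewrite mulr_ge0 // ltW.
apply: (ge0_le_integral _ measurableT).
- move=> y _; apply: integral_ge0 => z _; rewrite lee_fin; exact: mulr_ge0.
- apply: (@measurable_fun_integral R _ M (fun y z => (w y * (W x y z * phi z * A z))%:E)).
    by form_meas.
  by move=> y z; rewrite lee_fin mulr_ge0.
- by apply: emeasurable_funM; form_meas.
move=> y _.
rewrite (_ : (fun z => _) = (fun z => (w y)%:E * (W x y z * phi z * A z)%:E)%E);
  last first.
  by apply/funext => z; rewrite EFinM.
rewrite ge0_integralZl_EFin //; last 2 first.
- by move=> z _; rewrite lee_fin.
- by form_meas.
apply: (@le_trans _ _ ((w y)%:E * (C * phi x * phi y)%:E)%E).
  by apply: lee_wpmul2l; [rewrite lee_fin|exact: schurW].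
by rewrite -!EFinM lee_fin mulrCA.
Qed.

(* AM-GM: [2 u(z) v(y) <= t u(z)^2 phi(y) / phi(z) + v(y)^2 phi(z) / (t phi(y))]. *)
Lemma tri_form_AMGM u v x (t : R) : 0 < t -> measurable_fun [set: M] u ->
  measurable_fun [set: M] v -> (forall z, 0 <= u z) -> (forall z, 0 <= v z) ->
  (tri_form u v x <=
   (t / 2 * (C * phi x))%:E * \int[mu]_z (u z ^+ 2 * A z)%:E +
   ((2 * t)^-1 * (C * phi x))%:E * \int[mu]_y (v y ^+ 2 * A y)%:E)%E.
Proof.
move=> t0 mu_ mv u0 v0.
have t2 : 0 < t / 2 by rewrite divr_gt0.
have t2' : 0 < (2 * t)^-1 by rewrite invr_gt0 mulr_gt0.
have half (w : M -> R) (s : R) : 0 < s -> measurable_fun [set: M] w -> (forall y,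
  0 <= w y) ->
  (\int[mu]_y \int[mu]_z ((s * (w y ^+ 2 * A y / phi y)) * (W x y z * phi z * A z))%:E <=
    (s * (C * phi x))%:E * \int[mu]_y (w y ^+ 2 * A y)%:E)%E.
  move=> s0 mw w0.
  have nn y : 0 <= s * (w y ^+ 2 * A y / phi y).
    have := A0 y; have := phi0 y; have := sqr_ge0 (w y) => h1 h2 h3; have := ltW s0 => h4.
    by apply: mulr_ge0 => //; apply: divr_ge0; [apply: mulr_ge0|apply: ltW].
  apply: (le_trans (@integral_schur_le (fun y => s * (w y ^+ 2 * A y / phi y)) x _ _))
    => //.
    by form_meas.
  rewrite (_ : (fun y => _) = (fun y => s%:E * (w y ^+ 2 * A y)%:E)%E); last first.
    apply/funext => y; rewrite -EFinM; congr EFin; field.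
    by rewrite gt_eqF // phi0.
  rewrite ge0_integralZl_EFin //; last 3 first.
  - by move=> y _; rewrite lee_fin mulr_ge0 // sqr_ge0.
  - by form_meas.
  - exact: ltW.
  by rewrite muleA -EFinM (mulrC s).
have H1 := half u (t / 2) t2 mu_ u0; have H2 := half v (2 * t)^-1 t2' mv v0.
pose F1 y z := (t / 2 * (u z ^+ 2 * A z / phi z)) * (W x z y * phi y * A y).
pose F2 y z := ((2 * t)^-1 * (v y ^+ 2 * A y / phi y)) * (W x y z * phi z * A z).
have nn1 (w : M -> R) (s : R) y z : 0 < s -> (forall y, 0 <= w y) ->
    0 <= (s * (w y ^+ 2 * A y / phi y)) * (W x y z * phi z * A z).
  move=> s0 w0; have := A0 y; have := A0 z; have := ltW (phi0 z);
    have := W0 x y z => h1 h2 h3 h4.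
  have := ltW (phi0 y) => h5; have := sqr_ge0 (w y) => h6; have := ltW s0 => h7; pos.
have F10 y z : 0 <= F1 y z by exact: nn1.
have F20 y z : 0 <= F2 y z by exact: nn1.
(* In the term with u the Schur inequality is used in the variable y, which therefore has to be the
   inner one. *)
have E1 : (\int[mu]_y \int[mu]_z (F1 y z)%:E =
    \int[mu]_z \int[mu]_y (F1 y z)%:E)%E.
  by apply: tonelli2 => [|y z]; [rewrite /F1; form_meas|rewrite lee_fin].
apply: (@le_trans _ _ (\int[mu]_y \int[mu]_z (F1 y z)%:E + \int[mu]_y \int[mu]_z (F2 y
  z)%:E)%E); last first.
  by rewrite E1; apply: leeD; [exact: H1|exact: H2].
have mF1 : measurable_fun setT (fun p : M * M => (F1 p.1 p.2)%:E) by rewrite /F1;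
  form_meas.
have mF2 : measurable_fun setT (fun p : M * M => (F2 p.1 p.2)%:E) by rewrite /F2;
  form_meas.
rewrite -(ge0_integralD _ measurableT); last 4 first.
- by move=> y _; apply: integral_ge0 => z _; rewrite lee_fin.
- by apply: (@measurable_fun_integral R _ M (fun y z => (F1 y z)%:E)) => // *;
    rewrite lee_fin.
- by move=> y _; apply: integral_ge0 => z _; rewrite lee_fin.
- by apply: (@measurable_fun_integral R _ M (fun y z => (F2 y z)%:E)) => // *;
    rewrite lee_fin.
have pT y z : 0 <= u z * v y * (W x y z * A z * A y).
  have := A0 z; have := A0 y; have := W0 x y z => h1 h2 h3.
  by have := u0 z; have := v0 y => h4 h5; pos.
apply: (ge0_le_integral _ measurableT).
- by move=> y _; apply: integral_ge0 => z _; rewrite lee_fin.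
- apply: (@measurable_fun_integral R _ M (fun y z => (u z * v y * (W x y z * A z * A
    y))%:E)).
    by form_meas.
  by move=> y z; rewrite lee_fin.
- apply: emeasurable_funD.
  + by apply: (@measurable_fun_integral R _ M (fun y z => (F1 y z)%:E)) => // *;
      rewrite lee_fin.
  + by apply: (@measurable_fun_integral R _ M (fun y z => (F2 y z)%:E)) => // *;
      rewrite lee_fin.
move=> y _; rewrite -(ge0_integralD _ measurableT); last 4 first.
- by move=> z _; rewrite lee_fin.
- by rewrite /F1; form_meas.
- by move=> z _; rewrite lee_fin.
- by rewrite /F2; form_meas.
apply: (ge0_le_integral _ measurableT).
- by move=> z _; rewrite lee_fin.
- by form_meas.
- by apply: emeasurable_funD; rewrite /F1 /F2; form_meas.
move=> z _; rewrite -EFinD lee_fin /F1 /F2 (WCA x z y).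
have py := phi0 y; have pz := phi0 z.
rewrite [leRHS](_ : _ = (t / 2 * u z ^+ 2 * (phi y / phi z) + (2 * t)^-1 * v y ^+ 2 *
  (phi z / phi y)) *
  (W x y z * A z * A y)); last by field; rewrite !gt_eqF.
apply: ler_wpM2r; first by have := A0 z; have := A0 y; have := W0 x y z => h1 h2 h3; pos.
rewrite -subr_ge0 [leRHS](_ : _ = (t * phi y * u z - phi z * v y) ^+ 2 / (2 * t * phi z
  * phi y)).
  by apply: divr_ge0; [exact: sqr_ge0|apply: ltW; pos].
by field; rewrite !gt_eqF.
Qed.

(** The choice t = V / U balances the two terms of [tri_form_AMGM]; U and V are enlarged by e
    because they may be 0. *)
Lemma tri_form_le u v x (U V : R) : 0 <= U -> 0 <= V -> measurable_fun [set: M] u ->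
  measurable_fun [set: M] v -> (forall z, 0 <= u z) -> (forall z, 0 <= v z) ->
  (\int[mu]_z (u z ^+ 2 * A z)%:E <= (U ^+ 2)%:E)%E ->
  (\int[mu]_z (v z ^+ 2 * A z)%:E <= (V ^+ 2)%:E)%E ->
  (tri_form u v x <= (C * phi x * (U * V))%:E)%E.
Proof.
move=> U0 V0 mu_ mv u0 v0 HU HV.
have Cp : 0 <= C * phi x by rewrite mulr_ge0 // ltW.
have := @lee_right_limit R (tri_form u v x) (fun e => C * phi x * ((U + e) * (V + e))).
rewrite !addr0; apply.
  apply: continuousM; first exact: cst_continuous.
  by apply: continuousM; exact: continuous_addl.
move=> e e0; have U1 : 0 < U + e by lra.
have V1 : 0 < V + e by lra.
have t0 : 0 < (V + e) / (U + e) by rewrite divr_gt0.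
apply: (le_trans (tri_form_AMGM x t0 mu_ mv u0 v0)).
have sq (n : R) : 0 <= n -> n ^+ 2 <= (n + e) ^+ 2.
  by move=> n0; rewrite ler_sqr ?nnegrE; lra.
apply: (@le_trans _ _ (((V + e) / (U + e) / 2 * (C * phi x) * (U + e) ^+ 2)%:E +
  ((2 * ((V + e) / (U + e)))^-1 * (C * phi x) * (V + e) ^+ 2)%:E)%E).
  apply: leeD; rewrite [leRHS]EFinM; apply: lee_wpmul2l.
  - by rewrite lee_fin mulr_ge0 // ltW // divr_gt0.
  - by apply: (le_trans HU); rewrite lee_fin sq.
  - by rewrite lee_fin mulr_ge0 // invr_ge0 mulr_ge0 // ltW.
  - by apply: (le_trans HV); rewrite lee_fin sq.
rewrite -EFinD lee_fin le_eqVlt; apply/orP; left; apply/eqP.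
by field; rewrite !gt_eqF.
Qed.

(* Cauchy-Schwarz at fixed [x], in the AM-GM form
   [2 v(y) <= t phi(y) / phi(x) + v(y)^2 phi(x) / (t phi(y))], then Tonelli. *)
Lemma integral_sqr_tri_form_le u v (P V : R) : 0 <= P -> 0 <= V ->
  measurable_fun [set: M] u -> measurable_fun [set: M] v ->
  (forall z, 0 <= u z) -> (forall z, 0 <= v z) ->
  (\int[mu]_z (u z * phi z * A z)%:E <= P%:E)%E ->
  (\int[mu]_z (v z ^+ 2 * A z)%:E <= (V ^+ 2)%:E)%E ->
  (\int[mu]_x (tri_form u v x * tri_form u v x * (A x)%:E) <= ((C * P * V) ^+ 2)%:E)%E.
Proof.
move=> P0 V0 mu_ mv u0 v0 HP HV.
(* [sqre_le_AMGM] needs a positive constant, here C (P + e), while P may be 0. *)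
have := @lee_right_limit R (\int[mu]_x (tri_form u v x * tri_form u v x * (A x)%:E))%E
  (fun e => C * (P + e) * (C * P * V ^+ 2)).
have -> : (C * P * V) ^+ 2 = C * (P + 0) * (C * P * V ^+ 2) by ring.
apply.
  apply: continuousM; last exact: cst_continuous.
  apply: continuousM; first exact: cst_continuous.
  exact: continuous_addl.
move=> e e0; have P1 : 0 < P + e by lra.
have CP : 0 < C * (P + e) by rewrite mulr_gt0.
have HP' : (\int[mu]_z (u z * phi z * A z)%:E <= (P + e)%:E)%E.
  by apply: (le_trans HP); rewrite lee_fin; lra.
pose q x y z := (u z * A z) * (v y ^+ 2 * A y / phi y) * (phi x * W x y z).
have q0 x y z : 0 <= q x y z.
  have := A0 y; have := A0 z; have := u0 z; have := W0 x y z => h1 h2 h3 h4.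
  have := ltW (phi0 y) => h5; have := sqr_ge0 (v y) => h6; have := ltW (phi0 x) => h7.
  by rewrite /q; pos.
pose Q x := (\int[mu]_y \int[mu]_z (q x y z)%:E)%E.
have mq : measurable_fun setT (fun p : M * M * M => (q p.1.1 p.1.2 p.2)%:E) by rewrite
  /q; form_meas.
have Q0 x : (0 <= Q x)%E.
  by apply: integral_ge0 => y _; apply: integral_ge0 => z _; rewrite lee_fin.
have mQ : measurable_fun [set: M] Q.
  exact: (@measurable_fun_integral2 R _ M (fun x y z => (q x y z)%:E)).
have pT x y z : 0 <= u z * v y * (W x y z * A z * A y).
  have := A0 z; have := A0 y; have := W0 x y z => h1 h2 h3.
  by have := u0 z; have := v0 y => h4 h5; pos.
have TQ x : (tri_form u v x * tri_form u v x <= (C * (P + e))%:E * Q x)%E.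
  apply: sqre_le_AMGM => //; first exact: tri_form_ge0.
  move=> t t0.
  have t0' := ltW t0.
  have t2 : 0 < t / 2 by rewrite divr_gt0.
  have t2' : 0 < (2 * t)^-1 by rewrite invr_gt0 mulr_gt0.
  have px := phi0 x.
  (* The factor 1 / phi(x) cancels the phi(x) of the Schur bound, so this half is bounded
     independently of x. *)
  pose F1 y z := (t / 2 * (u z * A z / phi x)) * (W x z y * phi y * A y).
  have F10 y z : 0 <= F1 y z.
    have := A0 y; have := A0 z; have := u0 z; have := W0 x z y => h1 h2 h3 h4.
    have := ltW (phi0 y) => h5; have := ltW px => h6; have := ltW t2 => h7.
    by rewrite /F1; pos.
  have H1 : (\int[mu]_y \int[mu]_z (F1 y z)%:E <= (t / 2 * (C * (P + e)))%:E)%E.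
    rewrite tonelli2; last 2 first.
    - by rewrite /F1; form_meas.
    - by move=> y z; rewrite lee_fin.
    apply: (le_trans (@integral_schur_le (fun z => t / 2 * (u z * A z / phi x)) x _ _)).
    - by form_meas.
    - move=> y; have := A0 y; have := u0 y => h1 h2.
      by have := ltW px => h6; pos.
    rewrite (_ : (fun y => _) = (fun y => (t / 2 / phi x)%:E * (u y * phi y * A
      y)%:E)%E); last first.
      apply/funext => y; rewrite -EFinM; congr EFin; field.
      by rewrite gt_eqF.
    rewrite ge0_integralZl_EFin //; last 3 first.
    - move=> y _; rewrite lee_fin; have := A0 y; have := u0 y;
        have := ltW (phi0 y) => h1 h2 h3; pos.
    - by form_meas.
    - by rewrite divr_ge0 // ltW.
    rewrite muleA -EFinM [leRHS](_ : _ = (C * phi x * (t / 2 / phi x))%:E * (P +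
      e)%:E)%E; last first.
      by rewrite -EFinM; congr EFin; field; rewrite gt_eqF.
    apply: lee_wpmul2l HP'; rewrite lee_fin.
    by have := ltW px => h6; have := ltW C0 => h8; pos.
  pose F2 y z := (2 * t)^-1 * q x y z.
  have E2 : (((2 * t)^-1)%:E * Q x = \int[mu]_y \int[mu]_z (F2 y z)%:E)%E.
    rewrite -ge0_integralZl_EFin //; last 3 first.
    - by move=> y _; apply: integral_ge0 => z _; rewrite lee_fin.
    - apply: (@measurable_fun_integral R _ M (fun y z => (q x y z)%:E)).
        by rewrite /q; form_meas.
      by move=> *; rewrite lee_fin.
    - exact: ltW.
    apply: eq_integral => y _; rewrite -ge0_integralZl_EFin //.
    - by move=> z _; rewrite lee_fin.
    - by rewrite /q; form_meas.
    - exact: ltW.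
  have F20 y z : 0 <= F2 y z by rewrite mulr_ge0 // ltW.
  have mF1 : measurable_fun setT (fun p : M * M => (F1 p.1 p.2)%:E) by rewrite /F1;
    form_meas.
  have mF2 : measurable_fun setT (fun p : M * M => (F2 p.1 p.2)%:E) by rewrite /F2 /q;
    form_meas.
  rewrite E2; apply: le_trans (leeD H1 (lexx _)).
  rewrite -(ge0_integralD _ measurableT); last 4 first.
  - by move=> y _; apply: integral_ge0 => z _; rewrite lee_fin.
  - by apply: (@measurable_fun_integral R _ M (fun y z => (F1 y z)%:E)) => // *;
      rewrite lee_fin.
  - by move=> y _; apply: integral_ge0 => z _; rewrite lee_fin.
  - by apply: (@measurable_fun_integral R _ M (fun y z => (F2 y z)%:E)) => // *;
      rewrite lee_fin.
  apply: (ge0_le_integral _ measurableT).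
  - by move=> y _; apply: integral_ge0 => z _; rewrite lee_fin.
  - apply: (@measurable_fun_integral R _ M (fun y z => (u z * v y * (W x y z * A z * A
      y))%:E)).
      by form_meas.
    by move=> y z; rewrite lee_fin.
  - apply: emeasurable_funD.
    + by apply: (@measurable_fun_integral R _ M (fun y z => (F1 y z)%:E)) => // *;
        rewrite lee_fin.
    + by apply: (@measurable_fun_integral R _ M (fun y z => (F2 y z)%:E)) => // *;
        rewrite lee_fin.
  move=> y _; rewrite -(ge0_integralD _ measurableT); last 4 first.
  - by move=> z _; rewrite lee_fin.
  - by rewrite /F1; form_meas.
  - by move=> z _; rewrite lee_fin.
  - by rewrite /F2 /q; form_meas.
  apply: (ge0_le_integral _ measurableT).
  - by move=> z _; rewrite lee_fin.
  - by form_meas.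
  - by apply: emeasurable_funD; rewrite /F1 /F2 /q; form_meas.
  move=> z _; rewrite -EFinD lee_fin /F1 /F2 /q (WCA x z y).
  have py := phi0 y.
  rewrite [leRHS](_ : _ = (t / 2 * (phi y / phi x) + (2 * t)^-1 * v y ^+ 2 * (phi x /
    phi y)) *
    (u z * (W x y z * A z * A y))); last by field; rewrite !gt_eqF.
  rewrite [leLHS](_ : _ = v y * (u z * (W x y z * A z * A y))); last by ring.
  apply: ler_wpM2r.
    by have := A0 z; have := A0 y; have := u0 z; have := W0 x y z => h1 h2 h3 h4; pos.
  rewrite -subr_ge0 [leRHS](_ : _ = (t * phi y - phi x * v y) ^+ 2 / (2 * t * phi x *
    phi y)).
    by apply: divr_ge0; [exact: sqr_ge0|apply: ltW; pos].
  by field; rewrite !gt_eqF.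
have mT := measurable_fun_tri_form mu_ mv u0 v0.
apply: (@le_trans _ _ ((C * (P + e))%:E * \int[mu]_x (Q x * (A x)%:E))%E).
  rewrite -ge0_integralZl_EFin //; last 3 first.
  - by move=> x _; rewrite mule_ge0 // lee_fin.
  - by apply: emeasurable_funM; [exact: mQ|form_meas].
  - exact: ltW.
  apply: (ge0_le_integral _ measurableT).
  - by move=> x _; rewrite !mule_ge0 ?tri_form_ge0 // lee_fin.
  - by apply: emeasurable_funM; [exact: emeasurable_funM|form_meas].
  - by apply: emeasurable_funM; [form_meas|apply: emeasurable_funM;
      [exact: mQ|form_meas]].
  - by move=> x _; rewrite muleA; apply: lee_wpmul2r; [rewrite lee_fin|exact: TQ].
rewrite [leRHS]EFinM; apply: lee_wpmul2l; first by rewrite lee_fin ltW.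
rewrite (_ : (fun x => _) = (fun x => \int[mu]_y \int[mu]_z (q x y z * A x)%:E)%E);
  last first.
  apply/funext => x; rewrite -ge0_integralZr //; last 3 first.
  - apply: (@measurable_fun_integral R _ M (fun y z => (q x y z)%:E)).
      by rewrite /q; form_meas.
    by move=> *; rewrite lee_fin.
  - by move=> y _; apply: integral_ge0 => z _; rewrite lee_fin.
  - by rewrite lee_fin.
  apply: eq_integral => y _; rewrite -ge0_integralZr //.
  - by rewrite /q; form_meas.
  - by move=> z _; rewrite lee_fin.
  - by rewrite lee_fin.
rewrite tonelli3; last 2 first.
- by rewrite /q; form_meas.
- by move=> x y z; rewrite lee_fin mulr_ge0.
apply: (@le_trans _ _ (\int[mu]_y \int[mu]_z ((C * (v y ^+ 2 * A y))%:E * (u z * phi z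
  * A z)%:E))%E).
  have nn y z : 0 <= C * (v y ^+ 2 * A y) * (u z * phi z * A z).
    have := A0 y; have := A0 z; have := u0 z; have := ltW (phi0 z) => h1 h2 h3 h4.
    by have := sqr_ge0 (v y) => h6; have := ltW C0 => h7; pos.
  apply: (ge0_le_integral _ measurableT).
  - move=> y _; apply: integral_ge0 => z _; apply: integral_ge0 => x _.
    by rewrite lee_fin mulr_ge0.
  - apply: (@measurable_fun_integral2 R _ M (fun y z x => (q x y z * A x)%:E)).
      by rewrite /q; form_meas.
    by move=> *; rewrite lee_fin mulr_ge0.
  - apply: (@measurable_fun_integral R _ M (fun y z => (C * (v y ^+ 2 * A y))%:E * (u z
      * phi z * A z)%:E))%E.
      by apply: emeasurable_funM; form_meas.
    by move=> *; rewrite -EFinM lee_fin.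
  move=> y _; apply: (ge0_le_integral _ measurableT).
  - by move=> z _; apply: integral_ge0 => x _; rewrite lee_fin mulr_ge0.
  - apply: (@measurable_fun_integral R _ M (fun z x => (q x y z * A x)%:E)).
      by rewrite /q; form_meas.
    by move=> *; rewrite lee_fin mulr_ge0.
  - by apply: emeasurable_funM; form_meas.
  move=> z _.
  have s0 : 0 <= u z * A z * (v y ^+ 2 * A y / phi y).
    have := A0 y; have := A0 z; have := u0 z; have := ltW (phi0 y) => h1 h2 h3 h4.
    by have := sqr_ge0 (v y) => h6; pos.
  (* By symmetry the kernel is read as W(y, z, x): the integral in x is again of Schur type, and the
     phi(y) of its bound cancels 1 / phi(y). *)
  rewrite (_ : (fun x => _) = (fun x => (u z * A z * (v y ^+ 2 * A y / phi y))%:E *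
      (W y z x * phi x * A x)%:E)%E); last first.
    by apply/funext => x; rewrite -EFinM /q (WC x y z) (WCA y x z); congr EFin; ring.
  rewrite ge0_integralZl_EFin //; last 2 first.
  - move=> x _; rewrite lee_fin; have := A0 x; have := W0 y z x;
      have := ltW (phi0 x) => h1 h2 h3; pos.
  - by form_meas.
  apply: (@le_trans _ _ ((u z * A z * (v y ^+ 2 * A y / phi y))%:E * (C * phi y * phi
    z)%:E)%E).
    by apply: lee_wpmul2l; [rewrite lee_fin|exact: schurW].
  rewrite -!EFinM lee_fin le_eqVlt; apply/orP; left; apply/eqP.
  by field; rewrite gt_eqF // phi0.
rewrite (_ : (fun y => _) = (fun y => (C * (v y ^+ 2 * A y))%:E * \int[mu]_z (u z * phi
  z * A z)%:E)%E); last first.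
  apply/funext => y; rewrite ge0_integralZl_EFin //.
  - move=> z _; rewrite lee_fin; have := A0 z; have := u0 z;
      have := ltW (phi0 z) => h1 h2 h3; pos.
  - by form_meas.
  - have := A0 y; have := sqr_ge0 (v y) => h6 h5; have := ltW C0 => h7; pos.
have I0 : (0 <= \int[mu]_z (u z * phi z * A z)%:E)%E.
  apply: integral_ge0 => z _; rewrite lee_fin; have := A0 z; have := u0 z;
    have := ltW (phi0 z) => h1 h2 h3; pos.
rewrite ge0_integralZr //; last 2 first.
- by form_meas.
- move=> y _; rewrite lee_fin; have := A0 y; have := sqr_ge0 (v y) => h6 h5;
    have := ltW C0 => h7; pos.
rewrite (_ : (fun y => (C * _)%:E) = (fun y => C%:E * (v y ^+ 2 * A y)%:E)%E); last first.
  by apply/funext => y; rewrite EFinM.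
rewrite ge0_integralZl_EFin //; last 3 first.
- by move=> y _; rewrite lee_fin; have := A0 y; have := sqr_ge0 (v y) => h6 h5; pos.
- by form_meas.
- exact: ltW.
rewrite [leRHS](_ : _ = C%:E * (V ^+ 2)%:E * P%:E)%E; last by rewrite -!EFinM;
  congr EFin; ring.
apply: lee_pmul => //.
- apply: mule_ge0; first by rewrite lee_fin ltW.
  by apply: integral_ge0 => y _; rewrite lee_fin; have := A0 y;
    have := sqr_ge0 (v y) => h6 h5; pos.
- by apply: lee_wpmul2l => //; rewrite lee_fin ltW.
Qed.

End SchurTest.

(** * Lebesgue norms for the Jacobi measure *)

Section JacobiMeasure.
Context {R : realType}.
Local Notation M := (measurableTypeR R).
Local Notation mu := (@lebesgue_measure R).
Variables (alpha beta : R).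
Local Notation nu := (jacobi_measure alpha beta).
Local Notation A := (fun x : R => jacobi_weight alpha beta `|x|).

Import HBNNSimple.

(** For indicators this is the definition of [jacobi_measure]; linearity gives simple functions, and
    monotone convergence the rest. *)
Lemma integral_jacobi_measure (f : M -> \bar R) : measurable_fun setT f ->
  (forall x, 0 <= f x)%E ->
  (\int[nu]_x f x = \int[mu]_x (f x * (A x)%:E))%E.
Proof.
move=> mf f0; pose h := nnsfun_approx measurableT mf.
have mA : measurable_fun [set: M] (fun x => (A x)%:E).
  by apply/measurable_EFinP; exact: measurable_jacobi_weight.
have A0 x : (0 <= (A x)%:E)%E by rewrite lee_fin jacobi_weight_ge0.
have hf x : (EFin \o h n) x @[n --> \oo] --> f x by exact: cvg_nnsfun_approx.
have ndh x m n : (m <= n)%N -> h m x <= h n x.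
  by move=> mn; exact/lefP/nd_nnsfun_approx.
transitivity (limn (fun n => \int[nu]_x (h n x)%:E))%E.
  rewrite -monotone_convergence//.
  - by apply: eq_integral => x _; apply/esym/cvg_lim => //; exact: hf.
  - by move=> n; exact/measurable_EFinP/measurable_funP.
  - by move=> n x _; rewrite lee_fin.
  - by move=> x _ m n mn; rewrite lee_fin; exact: ndh.
transitivity (limn (fun n => \int[mu]_x ((h n x)%:E * (A x)%:E)))%E; last first.
  rewrite -monotone_convergence//.
  - apply: eq_integral => x _; apply/cvg_lim => //.
    by apply: cvgeZr => //; exact: hf.
  - by move=> n; apply: emeasurable_funM => //; exact/measurable_EFinP/measurable_funP.
  - by move=> n x _; rewrite mule_ge0 // lee_fin.
  - by move=> x _ m n mn; apply: lee_wpmul2r => //; rewrite lee_fin; exact: ndh.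
congr (limn _); apply/funext => n.
have mh r : measurable (h n @^-1` [set r]) by exact: measurable_funPTI.
rewrite integralT_nnsfun sintegralE.
transitivity (\int[mu]_x (\sum_(r \in range (h n)) (r * \1_(h n @^-1` [set r]) x)%:E *
  (A x)%:E))%E; last first.
  apply: eq_integral => x _; rewrite -ge0_mule_fsuml => [|y];
    last exact: nnfun_muleindic_ge0.
  by rewrite fsumEFin // -(fimfunE _ x).
rewrite ge0_integral_fsum//; last 2 first.
- move=> r; apply: emeasurable_funM => //; apply/measurable_EFinP.
  by apply: measurable_funM => //; exact: measurable_indic.
- by move=> r x _; rewrite mule_ge0 // nnfun_muleindic_ge0.
apply: eq_fsbigr => r; rewrite inE => -[t _ rE].
have r0 : (0 <= r) by rewrite -rE.
under [RHS]eq_integral do rewrite EFinM -muleA.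
rewrite ge0_integralZl_EFin //; last 2 first.
- by move=> x _; rewrite mule_ge0 // lee_fin.
- by apply: emeasurable_funM => //; apply/measurable_EFinP; exact: measurable_indic.
congr (_ * _)%E.
rewrite [LHS](_ : _ = \int[mu]_(x in h n @^-1` [set r]) (A x)%:E)%E //.
rewrite [LHS]integral_mkcond; apply: eq_integral => x _.
by rewrite patchE indicE; case: (x \in _); rewrite ?mul1e ?mul0e.
Qed.

Lemma Lnorm_jacobiE (r : R) (f : M -> R) : measurable_fun setT f ->
  Lnorm nu r%:E (EFin \o f) = ((\int[mu]_x (`|f x| `^ r * A x)%:E) `^ r^-1)%E.
Proof.
move=> mf; rewrite unlock; congr (_ `^ _)%E.
rewrite integral_jacobi_measure //; last by move=> x; exact: poweR_ge0.
rewrite (_ : (fun x => _) = EFin \o (fun x => `|f x| `^ r)) //.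
by apply/measurable_EFinP; apply: measurable_fun_powR; exact: measurable_fun_norm.
Qed.

Lemma Lnorm_jacobi_le (r K : R) (f : M -> R) : 0 < r -> 0 <= K -> measurable_fun setT f ->
  (\int[mu]_x (`|f x| `^ r * A x)%:E <= (K `^ r)%:E)%E ->
  (Lnorm nu r%:E (EFin \o f) <= K%:E)%E.
Proof.
move=> r0 K0 mf H; rewrite Lnorm_jacobiE //.
rewrite (_ : K%:E = (K `^ r)%:E `^ r^-1)%E; last first.
  by rewrite poweR_EFin -powRrM mulfV ?gt_eqF // powRr1.
apply: gt0_ler_poweR => //.
- by rewrite invr_ge0 ltW.
- rewrite in_itv/= leey andbT; apply: integral_ge0 => x _.
  by rewrite lee_fin mulr_ge0 ?powR_ge0 // jacobi_weight_ge0.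
- by rewrite in_itv/= leey andbT lee_fin powR_ge0.
Qed.

Lemma integral_le_Lnorm_jacobi (r K : R) (f : M -> R) : 0 < r -> 0 <= K ->
  measurable_fun setT f ->
  (Lnorm nu r%:E (EFin \o f) <= K%:E)%E ->
  (\int[mu]_x (`|f x| `^ r * A x)%:E <= (K `^ r)%:E)%E.
Proof.
move=> r0 K0 mf; rewrite Lnorm_jacobiE // => H.
have I0 : (0 <= \int[mu]_x (`|f x| `^ r * A x)%:E)%E.
  apply: integral_ge0 => x _.
  by rewrite lee_fin mulr_ge0 ?powR_ge0 // jacobi_weight_ge0.
rewrite -(poweRe1 I0) -(mulVf (lt0r_neq0 r0)) poweRrM -poweR_EFin.
apply: gt0_ler_poweR => //.
- exact: ltW.
- by rewrite in_itv/= leey andbT poweR_ge0.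
- by rewrite in_itv/= leey andbT lee_fin.
Qed.

Lemma Lnorm_jacobi_ey_le (K : R) (f : M -> R) : 0 <= K ->
  (forall x, x != 0 -> `|f x| <= K) -> (Lnorm nu +oo%E (EFin \o f) <= K%:E)%E.
Proof.
move=> K0 H; rewrite unlock; case: ifP => // _.
apply/ess_supP; exists [set 0%R]; split.
- exact: measurable_set1.
- by rewrite /= /jacobi_measure integral_set1.
- move=> x /= /negP; rewrite -ltNge => Hx; apply/eqP; apply: contraT => x0.
  by move: Hx; rewrite lte_fin ltNge H.
Qed.

(** At the origin the measures degenerate to Dirac masses and [schur_weight] has a dummy value; the
    vanishing weight removes this point from weighted integrals. *)
Lemma jacobi_weight0 : - 2^-1 < alpha -> jacobi_weight alpha beta `|0 : R| = 0.
Proof.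
move=> ha; rewrite jacobi_weight_absE sinh0 normr0 powR0 ?mul0r //.
by rewrite gt_eqF //; lra.
Qed.

End JacobiMeasure.

(** * Norm bounds for functions dominated by the positive forms *)

Section NormBounds.
Context {R : realType}.
Local Notation M := (measurableTypeR R).
Local Notation mu := (@lebesgue_measure R).
Variables (alpha beta : R).
Local Notation nu := (jacobi_measure alpha beta).
Local Notation A := (fun x : R => jacobi_weight alpha beta `|x|).
Local Notation N p f := (Lnorm nu p (EFin \o f)).
Local Notation T := (tri_form (kernel_bound alpha beta) A).

(* Four summands, because this is how [convolution_diff_le] bounds a difference
   of convolutions; [x = 0] is a null set at which the measures degenerate. *)
Definition tri_form_bounded (p s : \bar R) (c : R) :=
  forall (H : M -> R) (u v : 'I_4 -> M -> R) (a b : 'I_4 -> R),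
    measurable_fun setT H ->
    (forall i, measurable_fun setT (u i)) -> (forall i, measurable_fun setT (v i)) ->
    (forall i x, 0 <= u i x) -> (forall i x, 0 <= v i x) ->
    (forall i, 0 <= a i) -> (forall i, 0 <= b i) ->
    (forall i, N p (u i) <= (a i)%:E)%E -> (forall i, N 2%:E (v i) <= (b i)%:E)%E ->
    (forall x : R, x != 0 -> (`|H x|%:E <= \sum_(i < 4) T (u i) (v i) x)%E) ->
    (N s H <= (c * \sum_(i < 4) a i * b i)%:E)%E.

Lemma measurable_kernel_bound3 :
  measurable_fun setT (fun p : M * M * M => kernel_bound alpha beta p.1.1 p.1.2 p.2).
Proof.
apply: measurable_fun_kernel_bound.
- exact: (measurableT_comp measurable_fst measurable_fst).
- exact: (measurableT_comp measurable_snd measurable_fst).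
- exact: measurable_snd.
Qed.

Lemma triangleC (x y z : R) : triangle x y z = triangle y x z.
Proof.
rewrite /triangle distrC (addrC `|x|).
by case: (x != 0); case: (y != 0); case: (z != 0).
Qed.

Lemma triangleCA (x y z : R) : triangle x y z = triangle x z y.
Proof.
rewrite /triangle; case: (x != 0); case: (y != 0); case: (z != 0) => //=.
rewrite !ltr_distl.
by apply/andP/andP => -[/andP[? ?] ?]; split; try (apply/andP; split); lra.
Qed.

Lemma kernel_boundC (x y z : R) :
  kernel_bound alpha beta x y z = kernel_bound alpha beta y x z.
Proof.
rewrite /kernel_bound triangleC gramC (mulrC (sinh x)) (mulrC (cosh x)).
by case: ifP => [_|_]; reflexivity.
Qed.

Lemma kernel_boundCA (x y z : R) :
  kernel_bound alpha beta x y z = kernel_bound alpha beta x z y.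
Proof.
rewrite /kernel_bound triangleCA gramCA (mulrAC (sinh x)) (mulrAC (cosh x)).
by case: ifP => [_|_]; reflexivity.
Qed.

Lemma integral_sqr_le (K : R) (f : M -> R) : 0 <= K -> measurable_fun setT f ->
  (N 2%:E f <= K%:E)%E -> (\int[mu]_x (f x ^+ 2 * A x)%:E <= (K ^+ 2)%:E)%E.
Proof.
move=> K0 mf /(integral_le_Lnorm_jacobi (ltr0n _ 2) K0 mf).
rewrite powR_mulrn // (_ : (fun x => _) = (fun x => (f x ^+ 2 * A x)%:E)) //.
by apply/funext => x; rewrite powR_mulrn // real_normK ?num_real.
Qed.

Lemma tri_form_bounded_2_r (q : \bar R) : - 2^-1 <= beta -> beta <= alpha ->
  - 2^-1 < alpha -> (2%:E < q)%E -> exists2 c : R, 0 <= c & tri_form_bounded 2%:E q c.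
Proof.
move=> hb hab ha q2.
(* [K] bounds the L^q norm of phi; only here do finite q and q = oo differ. For q = oo the choice e
   = 0 makes phi at most 1. *)
have [e [K [eI K0 HK]]] : exists e K : R, [/\ 0 <= e < alpha + 2^-1, 0 <= K &
    forall (H : M -> R) (c : R), measurable_fun setT H -> 0 <= c ->
      (forall x, x != 0 -> `|H x| <= c * schur_weight beta e x) ->
      (N q H <= (c * K)%:E)%E].
  case: q q2 => [q| |] // q2.
  - rewrite lte_fin in q2; have q0 : 0 < q by lra.
    have [e [eI e1 e2]] := exists_schur_exponent hb ha q2.
    have [C C0 HC] := schur_weight_Lp e1 e2.
    exists e, (C `^ q^-1); split => //; first exact: powR_ge0.
    move=> H c mH c0 Hc; apply: Lnorm_jacobi_le => //;
      first by rewrite mulr_ge0 ?powR_ge0.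
    rewrite powRM ?powR_ge0 // -powRrM mulVf ?gt_eqF // powRr1 //.
    apply: (@le_trans _ _ (\int[mu]_x ((c `^ q)%:E * (schur_weight beta e x `^ q * A
      x)%:E))%E).
      apply: ge0_le_integral => //.
      + by move=> x _; rewrite lee_fin mulr_ge0 ?powR_ge0 // jacobi_weight_ge0.
      + apply/measurable_EFinP; apply: measurable_funM;
          last exact: measurable_jacobi_weight.
        by apply: measurable_fun_powR; exact: measurable_fun_norm.
      + apply: emeasurable_funM => //; apply/measurable_EFinP.
        apply: measurable_funM; last exact: measurable_jacobi_weight.
        by apply: measurable_fun_powR; exact: measurable_fun_schur_weight.
      + move=> x _; rewrite -EFinM lee_fin [leRHS]mulrA.
        have [->|x0] := eqVneq x 0; first by rewrite jacobi_weight0 // !mulr0.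
        apply: ler_wpM2r; first exact: jacobi_weight_ge0.
        have w0 := ltW (schur_weight_gt0 beta e x).
        rewrite -powRM //; apply: ge0_ler_powR; rewrite ?nnegrE ?(ltW q0) ?mulr_ge0 //.
        exact: Hc.
    rewrite ge0_integralZl_EFin ?powR_ge0 //.
    + by rewrite EFinM; apply: lee_wpmul2l; rewrite ?lee_fin ?powR_ge0.
    + by move=> x _; rewrite lee_fin mulr_ge0 ?powR_ge0 // jacobi_weight_ge0.
    + apply/measurable_EFinP.
      apply: measurable_funM; last exact: measurable_jacobi_weight.
      by apply: measurable_fun_powR; exact: measurable_fun_schur_weight.
  - exists 0, 1; split => //; first by lra.
    move=> H c mH c0 Hc; rewrite mulr1; apply: Lnorm_jacobi_ey_le => // x x0.
    by apply: (le_trans (Hc _ x0)); rewrite ler_piMr // schur_weight_le1.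
have [C C0 HC] := schur_inequality beta ha eI.
exists (C * K); first by rewrite mulr_ge0 // ltW.
move=> H u v a b mH mu_ mv u0 v0 a0 b0 Na Nb HH.
have S0 : 0 <= \sum_(i < 4) a i * b i by apply: sumr_ge0 => i _; exact: mulr_ge0.
rewrite mulrAC; apply: HK => //; first by rewrite mulr_ge0 // ltW.
move=> x x0; rewrite -lee_fin; apply: (le_trans (HH x x0)).
rewrite mulrAC mulr_sumr -sumEFin; apply: lee_sum => i _.
have L := @tri_form_le R (kernel_bound alpha beta) A (schur_weight beta e) C
  measurable_kernel_bound3 (@kernel_bound_ge0 R alpha beta) kernel_boundCA
  (@measurable_jacobi_weight R alpha beta) (fun y => jacobi_weight_ge0 _ _ _)
  (@measurable_fun_schur_weight R beta e) (schur_weight_gt0 _ _) C0 HC.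
apply: L; [exact: a0|exact: b0|exact: mu_|exact: mv|exact: u0|exact: v0| |].
- by apply: integral_sqr_le; [exact: a0|exact: mu_|exact: Na].
- by apply: integral_sqr_le; [exact: b0|exact: mv|exact: Nb].
Qed.

(** The conjugate exponent p / (p - 1) exceeds 2 because p < 2. For p = 1 it is infinite, and phi <=
    1 with e = 0 replaces Hoelder's inequality. *)
Lemma schur_hoelder (p : R) : - 2^-1 <= beta -> - 2^-1 < alpha -> 1 <= p -> p < 2 ->
  exists e K : R, [/\ 0 <= e < alpha + 2^-1, 0 <= K &
    forall (f : M -> R) (a : R), measurable_fun setT f -> (forall x, 0 <= f x) ->
      0 <= a ->
      (N p%:E f <= a%:E)%E ->
      (\int[mu]_x (f x * schur_weight beta e x * A x)%:E <= (K * a)%:E)%E].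
Proof.
move=> hb ha p1 p2; have p0 : 0 < p by lra.
move: p1; rewrite le_eqVlt => /orP[/eqP<-|p1].
  exists 0, 1; split => //; first by lra.
  move=> f a mf f0 a0 /(integral_le_Lnorm_jacobi ltr01 a0 mf).
  rewrite powRr1 // mul1r; apply: le_trans.
  apply: ge0_le_integral => //.
  - move=> x _; rewrite lee_fin; apply: mulr_ge0; last exact: jacobi_weight_ge0.
    by apply: mulr_ge0 => //; apply: ltW; exact: schur_weight_gt0.
  - apply/measurable_EFinP; apply: measurable_funM; last exact: measurable_jacobi_weight.
    by apply: measurable_funM => //; exact: measurable_fun_schur_weight.
  - apply/measurable_EFinP; apply: measurable_funM; last exact: measurable_jacobi_weight.
    by apply: measurable_fun_powR; exact: measurable_fun_norm.
  - move=> x _; rewrite lee_fin; apply: ler_wpM2r; first exact: jacobi_weight_ge0.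
    by rewrite powRr1 // ger0_norm // ler_piMr // schur_weight_le1.
pose q := p / (p - 1).
have p10 : 0 < p - 1 by lra.
have q2 : 2 < q by rewrite ltr_pdivlMr //; lra.
have q0 : 0 < q by lra.
have pq : p^-1 + q^-1 = 1 by rewrite /q; field; rewrite !gt_eqF.
have [e [eI e1 e2]] := exists_schur_exponent hb ha q2.
have [C C0 HC] := schur_weight_Lp e1 e2.
exists e, (C `^ q^-1); split => //; first exact: powR_ge0.
move=> f a mf f0 a0 fa.
have mw := @measurable_fun_schur_weight R beta e.
have w0 x := ltW (schur_weight_gt0 beta e x).
have := @hoelder _ M R nu f (schur_weight beta e) p q mf mw p0 q0 pq.
rewrite Lnorm1 integral_jacobi_measure; last 2 first.
- apply: measurableT_comp => //; apply/measurable_EFinP.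
  exact: measurable_funM.
- by move=> x; exact: abse_ge0.
rewrite (_ : (fun x => _) = (fun x => (f x * schur_weight beta e x * A x)%:E));
  last first.
  apply/funext => x.
  rewrite [LHS](_ : _ = (`|f x * schur_weight beta e x| * A x)%:E) //.
  by rewrite ger0_norm //; apply: mulr_ge0 => //; exact: w0.
move=> /le_trans; apply; rewrite (mulrC (C `^ _)) [leRHS]EFinM; apply: lee_pmul;
  [exact: Lnorm_ge0|exact: Lnorm_ge0|exact: fa|].
apply: Lnorm_jacobi_le => //; first exact: powR_ge0.
have CE : (C `^ q^-1) `^ q = C by rewrite -powRrM mulVf ?gt_eqF // powRr1.
rewrite CE (_ : (fun x => _) = (fun x => (schur_weight beta e x `^ q * A x)%:E)) //.
by apply/funext => x; rewrite ger0_norm.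
Qed.

Lemma sqre_sum4_le (t : 'I_4 -> \bar R) : (forall i, 0 <= t i)%E ->
  ((\sum_(i < 4) t i) * (\sum_(i < 4) t i) <= 4%:E * \sum_(i < 4) (t i * t i))%E.
Proof.
move=> t0; rewrite !big_ord_recl !big_ord0 !adde0.
set a := t _; set b := t _; set c := t _; set d := t _.
have s0 i : (0 <= t i * t i)%E by exact: mule_ge0.
rewrite addeA [X in (_ <= _ * X)%E]addeA.
apply: (@le_trans _ _ (2%:E * ((a + b) * (a + b)) + 2%:E * ((c + d) * (c + d)))%E).
  by apply: sqreD_le; apply: adde_ge0; exact: t0.
rewrite [leRHS]ge0_muleDr; [|apply: adde_ge0; exact: s0|apply: adde_ge0; exact: s0];
  apply: leeD.
- rewrite (_ : 4 = 2 * 2 :> R) ?EFinM -?muleA; last by ring.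
  apply: lee_wpmul2l; first by rewrite lee_fin.
  by rewrite [leRHS]ge0_muleDr; [apply: sqreD_le; exact: t0|exact: s0|exact: s0].
- rewrite (_ : 4 = 2 * 2 :> R) ?EFinM -?muleA; last by ring.
  apply: lee_wpmul2l; first by rewrite lee_fin.
  by rewrite [leRHS]ge0_muleDr; [apply: sqreD_le; exact: t0|exact: s0|exact: s0].
Qed.

Lemma tri_form_bounded_p_2 (p : R) : - 2^-1 <= beta -> beta <= alpha ->
  - 2^-1 < alpha -> 1 <= p -> p < 2 ->
  exists2 c : R, 0 <= c & tri_form_bounded p%:E 2%:E c.
Proof.
move=> hb hab ha p1 p2.
have [e [K [eI K0 HK]]] := schur_hoelder hb ha p1 p2.
have [C C0 HC] := schur_inequality beta ha eI.
(* The factor 2 is the square root of the 4 in [sqre_sum4_le]. *)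
exists (2 * (C * K)); first by have := ltW C0 => h; pos.
move=> H u v a b mH mu_ mv u0 v0 a0 b0 Na Nb HH.
have ab0 i : 0 <= a i * b i by exact: mulr_ge0.
have CK0 : 0 <= C * K by rewrite mulr_ge0 // ltW.
have S0 : 0 <= \sum_(i < 4) a i * b i by exact: sumr_ge0.
apply: Lnorm_jacobi_le => //; first by rewrite !mulr_ge0 // ltW.
have B0 := @kernel_bound_ge0 R alpha beta.
have A0 x : 0 <= A x by exact: jacobi_weight_ge0.
have mA : measurable_fun [set: M] A by exact: measurable_jacobi_weight.
have T0 i x : (0 <= T (u i) (v i) x)%E by exact: tri_form_ge0.
have mT i : measurable_fun [set: M] (T (u i) (v i)).
  by apply: measurable_fun_tri_form => //; exact: measurable_kernel_bound3.
have IT i : (\int[mu]_x (T (u i) (v i) x * T (u i) (v i) x * (A x)%:E) <=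
    ((C * K * (a i * b i)) ^+ 2)%:E)%E.
  rewrite (_ : C * K * (a i * b i) = C * (K * a i) * b i); last by ring.
  have L := @integral_sqr_tri_form_le R (kernel_bound alpha beta) A (schur_weight beta
    e) C
    measurable_kernel_bound3 B0 kernel_boundC kernel_boundCA mA A0
    (@measurable_fun_schur_weight R beta e) (schur_weight_gt0 _ _) C0 HC.
  apply: L; [by apply: mulr_ge0|exact: b0|exact: mu_|exact: mv|exact: u0|exact: v0| |].
  - by apply: HK; [exact: mu_|exact: u0|exact: a0|exact: Na].
  - by apply: integral_sqr_le; [exact: b0|exact: mv|exact: Nb].
apply: (@le_trans _ _ (\int[mu]_x (\sum_(i < 4) (4%:E * (T (u i) (v i) x * T (u i) (v
  i) x * (A x)%:E))))%E).
  apply: ge0_le_integral => //.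
  - by move=> x _; rewrite lee_fin mulr_ge0 // powR_ge0.
  - apply/measurable_EFinP; apply: measurable_funM => //.
    by apply: measurable_fun_powR; exact: measurable_fun_norm.
  - apply: emeasurable_sum => i; apply: emeasurable_funM => //.
    apply: emeasurable_funM; last exact/measurable_EFinP.
    exact: emeasurable_funM.
  move=> x _.
  have [->|x0] := eqVneq x 0.
    rewrite jacobi_weight0 // mulr0; apply: sume_ge0 => i _.
    by rewrite !mule_ge0 // lee_fin.
  have := HH x x0; set h := `|H x|%:E => hh.
  rewrite [leLHS](_ : _ = h * h * (A x)%:E)%E; last by rewrite powR_mulrn // expr2.
  have h0 : (0 <= h)%E by rewrite lee_fin.
  rewrite (eq_bigr (fun i => (4%:E * (T (u i) (v i) x * T (u i) (v i) x)) * (A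
    x)%:E)%E); last first.
    by move=> i _; rewrite muleA.
  rewrite -ge0_sume_distrl; last by move=> i _; rewrite !mule_ge0 // lee_fin.
  apply: lee_wpmul2r; first by rewrite lee_fin; exact: A0.
  rewrite -ge0_sume_distrr; last by move=> i _; rewrite mule_ge0.
  apply: (le_trans (lee_pmul h0 h0 hh hh)); exact: sqre_sum4_le.
rewrite ge0_integral_sum //; last 2 first.
- move=> i; apply: emeasurable_funM => //.
  apply: emeasurable_funM; last exact/measurable_EFinP.
  exact: emeasurable_funM.
- by move=> i x _; rewrite !mule_ge0 // lee_fin.
apply: (@le_trans _ _ (\sum_(i < 4) (4 * (C * K * (a i * b i)) ^+ 2)%:E)%E).
  apply: lee_sum => i _; rewrite ge0_integralZl_EFin //; last 2 first.
  - by move=> x _; rewrite !mule_ge0 // lee_fin.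
  - apply: emeasurable_funM; last exact/measurable_EFinP.
    exact: emeasurable_funM.
  by rewrite EFinM; apply: lee_wpmul2l; rewrite ?lee_fin.
rewrite sumEFin lee_fin powR_mulrn; last by rewrite !mulr_ge0 // ltW.
rewrite (_ : 2 * (C * K) * _ = 2 * (\sum_(i < 4) C * K * (a i * b i))); last first.
  by rewrite -mulrA mulr_sumr.
have c0 i : 0 <= C * K * (a i * b i) by exact: mulr_ge0.
rewrite !big_ord_recl !big_ord0 !addr0.
move: (c0 ord0) (c0 (lift ord0 ord0)) (c0 (lift ord0 (lift ord0 ord0)))
  (c0 (lift ord0 (lift ord0 (lift ord0 ord0)))).
set w := _ * _; set x := _ * _; set y := _ * _; set z := _ * _ => w0 x0 y0 z0.
(* The nonnegative cross terms by which (w + x + y + z)^2 exceeds the sum of the squares. *)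
have h : 0 <= 2 * (w * x + w * y + w * z + x * y + x * z + y * z).
  by rewrite mulr_ge0 // !addr_ge0 // mulr_ge0.
rewrite [leRHS](_ : _ = 4 * (w ^+ 2 + x ^+ 2 + y ^+ 2 + z ^+ 2) + 4 * (2 * (w * x + w *
  y + w * z + x * y + x * z + y * z))); last by ring.
lra.
Qed.

End NormBounds.

(** * Generalized translations and convolutions as double integrals *)

Section SignedDensity.
Context {R : realType}.
Local Notation M := (measurableTypeR R).
Local Notation mu := (@lebesgue_measure R).
Variables (alpha beta : R).
Local Notation A := (fun x : R => jacobi_weight alpha beta `|x|).
Local Notation W := (kernel_bound alpha beta).

(* The density of [mu_(x,y)] with respect to [dz] when [x y <> 0]. *)
Definition translation_density (x y z : R) : R :=
  if - 2^-1 < beta then kernel alpha beta x y z * jacobi_weight alpha beta `|z|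
  else kernel alpha alpha (x / 2) (y / 2) (z / 2) *
       jacobi_weight alpha alpha `|z / 2| / 2.

Lemma measurable_fun_translation_density d (T : measurableType d) (x y z : T -> R) :
  measurable_fun setT x -> measurable_fun setT y -> measurable_fun setT z ->
  measurable_fun setT (fun t => translation_density (x t) (y t) (z t)).
Proof.
move=> mx my mz; rewrite /translation_density; case: (- 2^-1 < beta).
- apply: measurable_funM; first exact: measurable_fun_kernel.
  exact: (measurableT_comp (measurable_jacobi_weight alpha beta) mz).
- have mh (f : T -> R) : measurable_fun setT f -> measurable_fun setT (fun t => f t / 2).
    by move=> mf; apply: measurable_funM => //; exact: measurable_cst.
  apply: measurable_funM; last exact: measurable_cst.
  apply: measurable_funM; first by apply: measurable_fun_kernel; exact: mh.
  exact: (measurableT_comp (measurable_jacobi_weight alpha alpha) (mh _ mz)).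
Qed.

(** Three kernels occur, for alpha > beta > -1/2, for alpha = beta and for beta = -1/2. From here on
    their common bound replaces them. *)
Lemma translation_density_le : - 2^-1 <= beta -> beta <= alpha -> - 2^-1 < alpha ->
  exists2 K : R, 0 < K & forall x y z,
  `|translation_density x y z| <= K * (W x y z * A z).
Proof.
move=> hb hab ha.
suff [K K0 HK] : exists2 K : R, 0 <= K & forall x y z, triangle x y z ->
    `|translation_density x y z| <= K * (W x y z * A z).
  exists (K + 1); first by rewrite ltr_wpDl.
  move=> x y z; have WA : 0 <= W x y z * A z.
    by apply: mulr_ge0; [exact: kernel_bound_ge0|exact: jacobi_weight_ge0].
  have [xyz|nxyz] := boolP (triangle x y z).
    by apply: (le_trans (HK _ _ _ xyz)); apply: ler_wpM2r => //; rewrite lerDl.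
  rewrite (_ : translation_density x y z = 0) ?normr0; last first.
    rewrite /translation_density /kernel triangle_half (negbTE nxyz).
    by case: (_ < _); rewrite mul0r // mul0r.
  by apply: mulr_ge0 => //; rewrite addr_ge0.
rewrite /translation_density; case: (boolP (- 2^-1 < beta)) => [hb1|].
- have [C C0 HC] : exists2 C : R, 0 <= C & forall x y z, triangle x y z ->
      `|kernel alpha beta x y z| <= C * W x y z.
    have [<-|ab] := eqVneq alpha beta.
      have [C C0 HC] := kernel_eq_bound alpha; exists C => // x y z xyz.
      by rewrite /kernel xyz eqxx; exact: HC.
    have ba : beta < alpha by rewrite lt_neqAle eq_sym ab.
    have [C C0 HC] := kernel_gt_bound hb1 ba; exists C => // x y z xyz.
    by rewrite /kernel xyz (negbTE ab); exact: HC.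
  exists C => // x y z xyz.
  rewrite (normrM (kernel _ _ _ _ _)) (ger0_norm (jacobi_weight_ge0 _ _ _)) [leRHS]mulrA.
  by apply: ler_wpM2r; [exact: jacobi_weight_ge0|exact: HC].
- rewrite -leNgt => hb1.
  have bE : beta = - 2^-1 by apply/eqP; rewrite eq_le hb1 hb.
  have [C C0 HC] := kernel_eq_half_bound alpha.
  exists (C * (2^-1 `^ (2 * alpha + 1) / 2)).
    by apply: mulr_ge0 => //; apply: divr_ge0 => //; exact: powR_ge0.
  move=> x y z xyz; rewrite /kernel triangle_half xyz eqxx bE.
  (* Since sinh(z/2) cosh(z/2) = sinh(z) / 2, the halved weight for (alpha, alpha) is a multiple of
     the weight for (alpha, -1/2). *)
  have wE : jacobi_weight alpha alpha `|z / 2| =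
      2^-1 `^ (2 * alpha + 1) * jacobi_weight alpha (- 2^-1) `|z|.
    rewrite !jacobi_weight_absE (_ : 2 * (- 2^-1) + 1 = 0 :> R); last by lra.
    rewrite powRr0 (mulr1 (`|sinh z| `^ _)) -(powRM _ (normr_ge0 _) (ltW (cosh_gt0 _))).
    rewrite -powRM ?invr_ge0 //; congr (_ `^ _).
    have sE : sinh z = 2 * sinh (z / 2) * cosh (z / 2) by rewrite -sinh2x; congr sinh;
      lra.
    rewrite sE (normrM (2 * _)) (normrM 2) (ger0_norm (ler0n _ 2)).
    by rewrite (gtr0_norm (cosh_gt0 _)) -!mulrA mulKf.
  rewrite wE.
  set w := jacobi_weight _ _ _; set c := 2^-1 `^ _.
  have w0 : 0 <= w by exact: jacobi_weight_ge0.
  have c0 : 0 <= c by exact: powR_ge0.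
  have cw0 : 0 <= c * w / 2 by apply: divr_ge0 => //; exact: mulr_ge0.
  rewrite -mulrA (normrM (kernel_eq _ _ _ _)) (ger0_norm cw0).
  rewrite [leRHS](_ : _ = C * kernel_bound alpha (- 2^-1) x y z * (c * w / 2));
    last by ring.
  by apply: ler_wpM2r => //; exact: HC.
Qed.

Lemma kernel_boundNy x y z : W x (- y) z = W x y z.
Proof. by rewrite kernel_boundCA kernel_boundNz kernel_boundCA. Qed.

(** Applying the nonnegative case to the positive and the negative part avoids any integrability
    assumption. *)
Lemma Rintegral_scale (k : R) (f : M -> R) : 0 < k -> measurable_fun setT f ->
  \int[mu]_x f (k * x) = \int[mu]_x (f x / k).
Proof.
move=> k0 mf; congr fine.
have mk : measurable_fun [set: M] (fun x : M => k * x : M) by exact: mulrl_measurable.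
have mfk : measurable_fun [set: M] (fun x => (f x / k)%:E).
  by apply/measurable_EFinP; apply: measurable_funM => //; exact: measurable_cst.
rewrite [LHS]integralE [RHS]integralE.
have kE x : k * (f (k * x) / k) = f (k * x) by rewrite mulrC divfK // gt_eqF.
congr (_ - _)%E.
- rewrite -(ge0_integral_scale k0 (measurable_funepos mfk) (funepos_ge0 _)).
  rewrite -ge0_integralZl_EFin //; last 2 first.
  + exact: (measurableT_comp (measurable_funepos mfk) mk).
  + exact: ltW.
  apply: eq_integral => x _; rewrite !funeposE -!EFin_max -EFinM.
  by rewrite maxr_pMr ?(ltW k0) // mulr0 kE.
- rewrite -(ge0_integral_scale k0 (measurable_funeneg mfk) (funeneg_ge0 _)).
  rewrite -ge0_integralZl_EFin //; last 2 first.
  + exact: (measurableT_comp (measurable_funeneg mfk) mk).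
  + exact: ltW.
  apply: eq_integral => x _; rewrite !funenegE -!EFinN -!EFin_max -EFinM.
  by rewrite maxr_pMr ?(ltW k0) // mulr0 mulrN kE.
Qed.

Definition translationR (f : M -> R) (x y : R) : R :=
  \int[mu]_z (f z * translation_density x y z).

Lemma Re_mul_real (c : R[i]) (r : R) : complex.Re (c * (r%:C)%C) = complex.Re c * r.
Proof. by case: c => a b /=; rewrite mulr0 subr0. Qed.

Lemma Im_mul_real (c : R[i]) (r : R) : complex.Im (c * (r%:C)%C) = complex.Im c * r.
Proof. by case: c => a b /=; rewrite mulr0 add0r. Qed.

Lemma ReIm_translation (f : M -> R[i]) (x y : R) :
  measurable_fun setT (fun t => complex.Re (f t)) ->
  measurable_fun setT (fun t => complex.Im (f t)) -> x != 0 -> y != 0 ->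
  complex.Re (translation alpha beta x f y) = translationR (fun t => complex.Re (f t))
    x y /\
  complex.Im (translation alpha beta x f y) = translationR (fun t => complex.Im (f t))
    x y.
Proof.
move=> mRe mIm x0 y0; rewrite /translation /mu_integral (negbTE y0) (negbTE x0).
have [hb1|hb1] := boolP (- 2^-1 < beta).
  rewrite /mu_ac_integral /cintegral /= /translationR /translation_density hb1.
  by split; apply: eq_Rintegral => z _; rewrite ?Re_mul_real ?Im_mul_real.
(* For beta = -1/2 the substitution z -> z / 2 turns the image measure into a density; it produces
   the factor 1/2 in [translation_density]. *)
have scale (h : M -> R) : measurable_fun setT h ->
    \int[mu]_z (h (2 * z) * (kernel alpha alpha (x / 2) (y / 2) z * jacobi_weight alpha
      alpha `|z|)) =
    translationR h x y.
  move=> mh; rewrite /translationR /translation_density (negbTE hb1).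
  pose G z := h z * (kernel alpha alpha (x / 2) (y / 2) (z / 2) * jacobi_weight alpha
    alpha `|z / 2|).
  have mG : measurable_fun [set: M] G.
    have mz : measurable_fun [set: M] (fun z : M => z / 2).
      by apply: measurable_funM; [exact: measurable_id|exact: measurable_cst].
    apply: measurable_funM => //; apply: measurable_funM.
      by apply: measurable_fun_kernel => //; exact: measurable_cst.
    exact: (measurableT_comp (measurable_jacobi_weight alpha alpha) mz).
  transitivity (\int[mu]_z G (2 * z)).
    by apply: eq_Rintegral => z _; rewrite /G (mulrC 2 z) mulfK.
  rewrite Rintegral_scale //; apply: eq_Rintegral => z _.
  by rewrite /G !mulrA.
rewrite /mu_ac_integral /cintegral /=.
split; rewrite -scale //; apply: eq_Rintegral => z _;
  by rewrite ?Re_mul_real ?Im_mul_real.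
Qed.

End SignedDensity.

Section Bilinear.
Context {R : realType}.
Local Notation M := (measurableTypeR R).
Local Notation mu := (@lebesgue_measure R).
Variables (alpha beta : R).
Local Notation A := (fun x : R => jacobi_weight alpha beta `|x|).
Local Notation W := (kernel_bound alpha beta).
Local Notation T := (tri_form W A).
Implicit Types (f g F G u v : M -> R).

(** The pair is p = (y, z), with y the variable of the convolution and z that of the measure
    attached to x and -y. *)
Definition bil_integrand f g (x : R) (p : M * M) : R :=
  f p.2 * g p.1 * (translation_density alpha beta x (- p.1) p.2 * A p.1).

(** Over the product measure, additivity in the integrand involves no inner integral that might
    diverge for exceptional y. *)
Definition bilR f g (x : R) : R :=
  fine (\int[(mu \x mu)%E]_p (bil_integrand f g x p)%:E)%E.

Definition convR f g (x : R) : R :=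
  \int[mu]_y (translationR alpha beta f x (- y) * g y * A y).

Lemma measurable_fun_bil_integrand f g x : measurable_fun setT f ->
  measurable_fun setT g -> measurable_fun setT (bil_integrand f g x).
Proof.
move=> mf mg; apply: measurable_funM.
  by apply: measurable_funM; [exact: (measurableT_comp mf measurable_snd)|exact:
    (measurableT_comp mg measurable_fst)].
apply: measurable_funM; last first.
  exact: (measurableT_comp (measurable_jacobi_weight alpha beta) measurable_fst).
apply: measurable_fun_translation_density; [exact: measurable_cst| |exact:
  measurable_snd].
by apply: measurableT_comp => //; exact: measurable_fst.
Qed.

Lemma measurable_fun_translationR f d (S : measurableType d) (X Y : S -> M) :
  measurable_fun setT f -> measurable_fun setT X -> measurable_fun setT Y ->
  measurable_fun setT (fun t => translationR alpha beta f (X t) (Y t)).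
Proof.
move=> mf mX mY; rewrite /translationR.
apply: (@measurable_fun_Rintegral_param R _ S setT
  (fun p => f p.2 * translation_density alpha beta (X p.1) (Y p.1) p.2)) => //.
apply: measurable_funM; first exact: (measurableT_comp mf measurable_snd).
apply: measurable_fun_translation_density; last exact: measurable_snd.
- exact: (measurableT_comp mX measurable_fst).
- exact: (measurableT_comp mY measurable_fst).
Qed.

Lemma convR_bilR f g x : measurable_fun setT f -> measurable_fun setT g ->
  (mu \x mu)%E.-integrable setT (EFin \o bil_integrand f g x) ->
  mu.-integrable setT (EFin \o (fun y => translationR alpha beta f x (- y) * g y * A
    y)) /\
  convR f g x = bilR f g x.
Proof.
move=> mf mg If.
pose h y := translationR alpha beta f x (- y) * g y * A y.
have mh : measurable_fun [set: M] (EFin \o h).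
  apply/measurable_EFinP; apply: measurable_funM; last exact: measurable_jacobi_weight.
  by apply: measurable_funM => //; apply: measurable_fun_translationR => //;
    exact: measurableT_comp.
have IF := integrable_fubini_F If.
have E : ae_eq mu setT (fubini_F mu (EFin \o bil_integrand f g x)) (EFin \o h).
  have := ae_integrable1 If; apply: filterS => y Iy _.
  rewrite /fubini_F /= /bil_integrand /=.
  pose c := g y * A y.
  have fE z : f z * g y * (translation_density alpha beta x (- y) z * A y) =
     (f z * translation_density alpha beta x (- y) z) * c by rewrite /c; ring.
  rewrite (_ : h y = translationR alpha beta f x (- y) * c); last by rewrite /h /c mulrA.
  rewrite (_ : (fun z => _) = (fun z => (f z * translation_density alpha beta x (- y)
    z)%:E * c%:E)%E); last first.
    by apply/funext => z; rewrite -EFinM fE.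
  (* If c = 0, the integral defining the translation may diverge, but its value is multiplied by 0;
     otherwise integrability passes to it on division by c. *)
  have [c0|c0] := eqVneq c 0.
    by rewrite c0 mulr0; under eq_integral do rewrite mule0; rewrite integral0.
  have Ik : mu.-integrable setT (EFin \o (fun z => f z * translation_density alpha beta
    x (- y) z)).
    have := integrableZr measurableT c^-1 Iy.
    apply: eq_integrable => // z _ /=.
    by rewrite -EFinM /bil_integrand /= fE mulfK.
  rewrite integralZr // [RHS]EFinM; congr (_ * _)%E.
  by rewrite /translationR /Rintegral fineK //; exact: integrable_fin_num.
have mF := measurable_int _ IF.
have Ih : mu.-integrable setT (EFin \o h).
  apply/integrableP; split => //.
  rewrite -(@ae_eq_integral _ _ _ mu setT (fun y => `|h y|%:E) (fun y => `|fubini_F mu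
    (EFin \o bil_integrand f g x) y|)%E) //.
  - by case/integrableP : IF.
  - exact: measurableT_comp.
  - exact: (measurableT_comp (@abse_measurable R setT) mh).
  - by apply: filterS E => y Ey /Ey ->.
split => //; rewrite /convR /bilR /Rintegral -(integral12_prod_meas1 If); congr fine.
by apply/esym; apply: ae_eq_integral.
Qed.

Lemma tri_formZ (c : R) u v x : 0 <= c -> measurable_fun setT u ->
  measurable_fun setT v -> (forall z, 0 <= u z) -> (forall z, 0 <= v z) ->
  T (fun z => c * u z) v x = (c%:E * T u v x)%E.
Proof.
move=> c0 mu1 mv1 u0 v0.
have I0 y z : (0 <= (u z * v y * (W x y z * A z * A y))%:E)%E.
  rewrite lee_fin; apply: mulr_ge0; first exact: mulr_ge0.
  by apply: mulr_ge0; [apply: mulr_ge0; [exact: kernel_bound_ge0|exact: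
    jacobi_weight_ge0]|exact: jacobi_weight_ge0].
have mI : measurable_fun setT (fun p : M * M => (u p.2 * v p.1 * (W x p.1 p.2 * A p.2 *
  A p.1))%:E).
  apply/measurable_EFinP; apply: measurable_funM.
    by apply: measurable_funM; [exact: (measurableT_comp mu1 measurable_snd)|exact:
      (measurableT_comp mv1 measurable_fst)].
  apply: measurable_funM; last exact: (measurableT_comp (measurable_jacobi_weight alpha
    beta) measurable_fst).
  apply: measurable_funM; last exact: (measurableT_comp (measurable_jacobi_weight alpha
    beta) measurable_snd).
  by apply: measurable_fun_kernel_bound => //; exact: measurable_cst.
rewrite /tri_form -ge0_integralZl_EFin //; last 2 first.
- by move=> y _; apply: integral_ge0 => z _; exact: I0.
- exact: (@measurable_fun_integral R _ M (fun y z => (u z * v y * (W x y z * A z * A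
    y))%:E)).
apply: eq_integral => y _; rewrite -ge0_integralZl_EFin //.
- by apply: eq_integral => z _; rewrite -EFinM; congr EFin; rewrite !mulrA.
- exact: (measurableT_comp mI (pair1_measurable y)).
Qed.

Section Dominated.
Variable K : R.
Hypothesis K0 : 0 < K.
Hypothesis HK : forall x y z, `|translation_density alpha beta x y z| <= K * (W x y z *
  A z).

Lemma integral_bil_integrand_le f g x u v : measurable_fun setT f ->
  measurable_fun setT g ->
  measurable_fun setT u -> measurable_fun setT v ->
  (forall z, `|f z| <= u z) -> (forall z, `|g z| <= v z) ->
  (\int[(mu \x mu)%E]_p `|bil_integrand f g x p|%:E <= K%:E * T u v x)%E.
Proof.
move=> mf mg mu1 mv1 fu gv.
have u0 z : 0 <= u z by exact: le_trans (normr_ge0 _) (fu z).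
have v0 z : 0 <= v z by exact: le_trans (normr_ge0 _) (gv z).
have A0 y : 0 <= A y by exact: jacobi_weight_ge0.
rewrite -tri_formZ ?(ltW K0) //.
have mI : measurable_fun setT (fun p : M * M => (K * u p.2 * v p.1 * (W x p.1 p.2 * A
  p.2 * A p.1))%:E).
  apply/measurable_EFinP; apply: measurable_funM.
    apply: measurable_funM; last exact: (measurableT_comp mv1 measurable_fst).
    by apply: measurable_funM; [exact: measurable_cst|exact: (measurableT_comp mu1
      measurable_snd)].
  apply: measurable_funM; last exact: (measurableT_comp (measurable_jacobi_weight alpha
    beta) measurable_fst).
  apply: measurable_funM; last exact: (measurableT_comp (measurable_jacobi_weight alpha
    beta) measurable_snd).
  by apply: measurable_fun_kernel_bound => //; exact: measurable_cst.
have I0 (p : M * M) : (0 <= (K * u p.2 * v p.1 * (W x p.1 p.2 * A p.2 * A p.1))%:E)%E.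
  rewrite lee_fin; apply: mulr_ge0.
    by apply: mulr_ge0 => //; apply: mulr_ge0 => //; exact: ltW.
  by apply: mulr_ge0; [apply: mulr_ge0; [exact: kernel_bound_ge0|exact: A0]|exact: A0].
rewrite [leRHS](_ : _ = \int[(mu \x mu)%E]_p (K * u p.2 * v p.1 * (W x p.1 p.2 * A p.2
  * A p.1))%:E)%E; last first.
  by rewrite (fubini_tonelli1 _ mI I0).
have mB := measurable_fun_bil_integrand x mf mg.
apply: ge0_le_integral => //.
- by apply/measurable_EFinP; exact: measurable_fun_norm.
move=> p _; rewrite lee_fin /bil_integrand (normrM (_ * _)) (normrM (f _)).
rewrite (normrM (translation_density _ _ _ _ _)) (ger0_norm (A0 p.1)).
rewrite [leRHS](_ : _ = (u p.2 * v p.1) * (K * (W x p.1 p.2 * A p.2) * A p.1));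
  last first.
  by move: (W x p.1 p.2) (A p.2) (A p.1) => w a b; ring.
apply: ler_pM; [by apply: mulr_ge0| |by apply: ler_pM|].
  by apply: mulr_ge0 => //; exact: A0.
apply: ler_wpM2r; first exact: A0.
(* Evenness of W absorbs the sign of -y. *)
by rewrite -(kernel_boundNy alpha beta x p.1); exact: HK.
Qed.

Lemma bil_integrand_integrable f g x u v : measurable_fun setT f ->
  measurable_fun setT g ->
  measurable_fun setT u -> measurable_fun setT v ->
  (forall z, `|f z| <= u z) -> (forall z, `|g z| <= v z) -> (T u v x < +oo)%E ->
  (mu \x mu)%E.-integrable setT (EFin \o bil_integrand f g x) /\
  `|bilR f g x| <= K * fine (T u v x).
Proof.
move=> mf mg mu1 mv1 fu gv Tfin.
have u0 z : 0 <= u z by exact: le_trans (normr_ge0 _) (fu z).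
have v0 z : 0 <= v z by exact: le_trans (normr_ge0 _) (gv z).
have mB := measurable_fun_bil_integrand x mf mg.
have T0 : (0 <= T u v x)%E.
  apply: tri_form_ge0 => //; [exact: kernel_bound_ge0|by move=> y;
    exact: jacobi_weight_ge0].
have H := integral_bil_integrand_le x mf mg mu1 mv1 fu gv.
have TE : T u v x = (fine (T u v x))%:E by rewrite fineK // ge0_fin_numE.
have I : (mu \x mu)%E.-integrable setT (EFin \o bil_integrand f g x).
  apply/integrableP; split; first exact/measurable_EFinP.
  by apply: (le_lt_trans H); rewrite TE -EFinM ltry.
split => //; rewrite -lee_fin EFinM -TE; apply: le_trans H.
rewrite /bilR [leLHS](_ : _ = `|\int[(mu \x mu)%E]_p (bil_integrand f g x p)%:E|)%E.
  apply: (le_abse_integral _ measurableT); exact/measurable_EFinP.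
by rewrite -[in RHS](fineK (integrable_fin_num measurableT I)).
Qed.

Lemma ler_norm_sum3 (a b c d k r s t : R) : `|a| <= k * r -> `|b| <= k * s ->
  `|c| <= k * t -> `|a + b + c + d - d| <= k * (r + s + t).
Proof.
move=> ha hb hc; rewrite addrK !mulrDr (le_trans (ler_normD _ _)) // lerD //.
by rewrite (le_trans (ler_normD _ _)) // lerD.
Qed.

(** F G - f g is split as (F - f)(G - g) + (F - f) g + f (G - g). Finiteness of the fourth form
    makes the double integral of f and g converge, so that it can be subtracted. *)
Lemma bilR_diff_le F G f g x u1 u2 v1 v2 :
  measurable_fun setT F -> measurable_fun setT G ->
  measurable_fun setT f -> measurable_fun setT g ->
  measurable_fun setT u1 -> measurable_fun setT u2 ->
  measurable_fun setT v1 -> measurable_fun setT v2 ->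
  (forall z, `|F z - f z| <= u1 z) -> (forall z, `|f z| <= u2 z) ->
  (forall z, `|G z - g z| <= v1 z) -> (forall z, `|g z| <= v2 z) ->
  (T u1 v1 x < +oo)%E -> (T u1 v2 x < +oo)%E -> (T u2 v1 x < +oo)%E ->
    (T u2 v2 x < +oo)%E ->
  [/\ (mu \x mu)%E.-integrable setT (EFin \o bil_integrand F G x),
      (mu \x mu)%E.-integrable setT (EFin \o bil_integrand f g x) &
      `|bilR F G x - bilR f g x| <= K * (fine (T u1 v1 x) + fine (T u1 v2 x) + fine (T
        u2 v1 x))].
Proof.
move=> mF mG mf mg mu1 mu2 mv1 mv2 Fu fu Gv gv T11 T12 T21 T22.
have mFf : measurable_fun setT (fun z => F z - f z) by exact: measurable_funB.
have mGg : measurable_fun setT (fun z => G z - g z) by exact: measurable_funB.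
have [I11 B11] := bil_integrand_integrable mFf mGg mu1 mv1 Fu Gv T11.
have [I12 B12] := bil_integrand_integrable mFf mg mu1 mv2 Fu gv T12.
have [I21 B21] := bil_integrand_integrable mf mGg mu2 mv1 fu Gv T21.
have [I22 B22] := bil_integrand_integrable mf mg mu2 mv2 fu gv T22.
set i11 := bil_integrand _ _ x in I11; set i12 := bil_integrand _ _ x in I12.
set i21 := bil_integrand _ _ x in I21; set i22 := bil_integrand _ _ x in I22.
have IE : bil_integrand F G x = (fun p => i11 p + i12 p + i21 p + i22 p).
  apply/funext => p; rewrite /i11 /i12 /i21 /i22 /bil_integrand.
  set D := translation_density _ _ _ _ _; set a := jacobi_weight _ _ _.
  by clearbody D a; ring.
have IA : (mu \x mu)%E.-integrable setT (EFin \o (fun p => i11 p + i12 p)).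
  exact: (integrableD measurableT I11 I12).
have IB : (mu \x mu)%E.-integrable setT (EFin \o (fun p => i11 p + i12 p + i21 p)).
  exact: (integrableD measurableT IA I21).
have IC : (mu \x mu)%E.-integrable setT (EFin \o (fun p => i11 p + i12 p + i21 p + i22
  p)).
  exact: (integrableD measurableT IB I22).
split => //; first by rewrite IE.
have -> : bilR F G x = bilR (fun z => F z - f z) (fun z => G z - g z) x +
    bilR (fun z => F z - f z) g x + bilR f (fun z => G z - g z) x + bilR f g x.
  transitivity (\int[(mu \x mu)%E]_p (i11 p + i12 p + i21 p + i22 p)).
    by rewrite /bilR IE.
  by rewrite !RintegralD.
exact: ler_norm_sum3 B11 B12 B21.
Qed.

End Dominated.

End Bilinear.

(** * Complex convolutions through real and imaginary parts *)

Section ConvolutionDifference.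
Context {R : realType}.
Local Notation M := (measurableTypeR R).
Local Notation mu := (@lebesgue_measure R).
Local Notation normc := (@ComplexField.Normc.normc R).
Variables (alpha beta : R).
Hypotheses (hb : - 2^-1 <= beta) (hab : beta <= alpha) (ha : - 2^-1 < alpha).
Local Notation A := (fun x : R => jacobi_weight alpha beta `|x|).
Local Notation W := (kernel_bound alpha beta).
Local Notation T := (tri_form W A).

Definition cmeasurable (f : R -> R[i]) :=
  measurable_fun [set: M] (fun x => complex.Re (f x)) /\
  measurable_fun [set: M] (fun x => complex.Im (f x)).

Lemma normcE (c : R[i]) : normc c = (complex.Re c ^+ 2 + complex.Im c ^+ 2) `^ 2^-1.
Proof. by case: c => a b; rewrite powR12_sqrt // addr_ge0 ?sqr_ge0. Qed.

Lemma normc_ge0 (c : R[i]) : 0 <= normc c.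
Proof. by rewrite normcE powR_ge0. Qed.

Lemma measurable_fun_normc f : cmeasurable f -> measurable_fun [set: M] (normc \o f).
Proof.
move=> [mr mi]; rewrite (_ : normc \o f =
  (fun x => (complex.Re (f x) ^+ 2 + complex.Im (f x) ^+ 2) `^ 2^-1)).
  apply: measurable_fun_powR; apply: measurable_funD; exact: measurable_fun_sqr.
by apply/funext => x; rewrite /= normcE.
Qed.

Lemma normr_Re_le (c : R[i]) : `|complex.Re c| <= normc c.
Proof.
case: c => a b /=; rewrite -sqrtr_sqr ler_sqrt ?addr_ge0 ?sqr_ge0 //.
by rewrite lerDl sqr_ge0.
Qed.

Lemma normr_Im_le (c : R[i]) : `|complex.Im c| <= normc c.
Proof.
case: c => a b /=; rewrite -sqrtr_sqr ler_sqrt ?addr_ge0 ?sqr_ge0 //.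
by rewrite lerDr sqr_ge0.
Qed.

Lemma normc_le (c : R[i]) : normc c <= `|complex.Re c| + `|complex.Im c|.
Proof.
case: c => a b /=; rewrite -[leRHS]ger0_norm ?addr_ge0 // -sqrtr_sqr ler_sqrt ?sqr_ge0 //.
rewrite sqrrD !real_normK ?num_real // lerD2r lerDl.
by rewrite mulrn_wge0 // mulr_ge0.
Qed.

Lemma ReB (a b : R[i]) : complex.Re (a - b) = complex.Re a - complex.Re b.
Proof. by case: a; case: b. Qed.

Lemma ImB (a b : R[i]) : complex.Im (a - b) = complex.Im a - complex.Im b.
Proof. by case: a; case: b. Qed.

Lemma cmeasurableB f g : cmeasurable f -> cmeasurable g ->
  cmeasurable (fun x => f x - g x).
Proof.
move=> [fr fi] [gr gi]; split.
- by under eq_fun do rewrite ReB; exact: measurable_funB.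
- by under eq_fun do rewrite ImB; exact: measurable_funB.
Qed.

Lemma ReM (a b : R[i]) : complex.Re (a * b) =
  complex.Re a * complex.Re b - complex.Im a * complex.Im b.
Proof. by case: a; case: b. Qed.

Lemma ImM (a b : R[i]) : complex.Im (a * b) =
  complex.Re a * complex.Im b + complex.Im a * complex.Re b.
Proof. by case: a; case: b. Qed.

(** At y = 0, where the measure is a Dirac mass and not given by a density, the weight vanishes, so
    the formulas hold for every y in the integrand. *)
Lemma ReIm_convolution f g (x : R) : cmeasurable f -> cmeasurable g -> x != 0 ->
  let f1 := fun x => complex.Re (f x) in let f2 := fun x => complex.Im (f x) in
  let g1 := fun x => complex.Re (g x) in let g2 := fun x => complex.Im (g x) in
  complex.Re (convolution alpha beta f g x) =
    \int[mu]_y (translationR alpha beta f1 x (- y) * g1 y * A y -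
                translationR alpha beta f2 x (- y) * g2 y * A y) /\
  complex.Im (convolution alpha beta f g x) =
    \int[mu]_y (translationR alpha beta f1 x (- y) * g2 y * A y +
                translationR alpha beta f2 x (- y) * g1 y * A y).
Proof.
move=> [mf1 mf2] mg x0 f1 f2 g1 g2; split; apply: eq_Rintegral => y _.
- rewrite Re_mul_real ReM.
  have [->|y0] := eqVneq y 0; first by rewrite jacobi_weight0 // !mulr0 subrr.
  have ny0 : - y != 0 by rewrite oppr_eq0.
  by have [-> ->] := ReIm_translation alpha beta mf1 mf2 x0 ny0; rewrite mulrBl.
- rewrite Im_mul_real ImM.
  have [->|y0] := eqVneq y 0; first by rewrite jacobi_weight0 // !mulr0 addr0.
  have ny0 : - y != 0 by rewrite oppr_eq0.
  by have [-> ->] := ReIm_translation alpha beta mf1 mf2 x0 ny0; rewrite mulrDl.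
Qed.

(** A bound by four nonnegative terms has to be proved only when all of them are finite, which is
    when the integrals converge. *)
Lemma lee_sum4 (X a b c d : \bar R) :
  (0 <= a -> 0 <= b -> 0 <= c -> 0 <= d ->
  (a < +oo -> b < +oo -> c < +oo -> d < +oo -> X <= a + b + c + d) ->
  X <= a + b + c + d)%E.
Proof.
move: a b c d => [a| |] [b| |] [c| |] [d| |] // _ _ _ _; rewrite ?leey //.
by apply; rewrite ltry.
Qed.

Lemma ler_norm_sum4 (c11 c12 c21 c22 d11 d12 d21 d22 s : R) :
  `|c11 - d11| <= s -> `|c12 - d12| <= s -> `|c21 - d21| <= s ->
  `|c22 - d22| <= s ->
  `|c11 - c22 - (d11 - d22)| + `|c12 + c21 - (d12 + d21)| <= 4 * s.
Proof.
move=> h1 h2 h3 h4.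
have H1 : `|c11 - c22 - (d11 - d22)| <= 2 * s by move: h1 h4; rewrite !ler_norml; lra.
have H2 : `|c12 + c21 - (d12 + d21)| <= 2 * s by move: h2 h3; rewrite !ler_norml; lra.
by apply: (le_trans (lerD H1 H2)); lra.
Qed.

(* The last summand, where [delta] is arbitrary, makes the right-hand side
   infinite at the points where the integrals defining the convolutions need not
   converge: the estimate holds at every [x != 0] instead of almost everywhere. *)
Lemma convolution_diff_le : exists2 K : R, 0 < K &
  forall (F G f g : R -> R[i]) (delta x : R), cmeasurable F -> cmeasurable G ->
    cmeasurable f -> cmeasurable g -> 0 < delta -> x != 0 ->
    ((normc (convolution alpha beta F G x - convolution alpha beta f g x)%R)%:E <=
      T (fun z => (K * normc (F z - f z))%R) (fun y => (normc (G y - g y))%R) x +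
      T (fun z => (K * normc (F z - f z))%R) (fun y => normc (g y)) x +
      T (fun z => (K * normc (f z))%R) (fun y => (normc (G y - g y))%R) x +
      T (fun z => (delta * normc (f z))%R) (fun y => normc (g y)) x)%E.
Proof.
have [K K0 HK] := translation_density_le hb hab ha.
(* The real and the imaginary part of the convolution are each made of two real ones, hence the
   4. *)
have K4 : 0 < 4 * K by rewrite mulr_gt0.
exists (4 * K) => // F G f g delta x mF mG mf mg d0 x0.
have mu1 := measurable_fun_normc (cmeasurableB mF mf).
have mu2 := measurable_fun_normc mf.
have mv1 := measurable_fun_normc (cmeasurableB mG mg).
have mv2 := measurable_fun_normc mg.
set u1 := (fun z => normc (F z - f z)) in mu1 *.
set u2 := (fun z => normc (f z)) in mu2 *.
set v1 := (fun z => normc (G z - g z)) in mv1 *.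
set v2 := (fun z => normc (g z)) in mv2 *.
have u10 z : 0 <= u1 z by exact: normc_ge0.
have u20 z : 0 <= u2 z by exact: normc_ge0.
have v10 z : 0 <= v1 z by exact: normc_ge0.
have v20 z : 0 <= v2 z by exact: normc_ge0.
rewrite !tri_formZ ?(ltW K4) ?(ltW d0) //.
have T0 u v : (forall z, 0 <= u z) -> (forall z, 0 <= v z) -> (0 <= T u v x)%E.
  move=> h1 h2; apply: tri_form_ge0 => //; first exact: kernel_bound_ge0.
  by move=> y; exact: jacobi_weight_ge0.
have T11 := T0 _ _ u10 v10; have T12 := T0 _ _ u10 v20.
have T21 := T0 _ _ u20 v10; have T22 := T0 _ _ u20 v20.
have fin (c : R) (t : \bar R) : 0 < c -> (0 <= t)%E -> (c%:E * t < +oo)%E -> (t < +oo)%E.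
  by case: t => [t| |] // c0 _; rewrite ?ltry // gt0_muley ?lte_fin.
have P (c : R) (t : \bar R) : 0 < c -> (0 <= t)%E -> (0 <= c%:E * t)%E.
  by move=> c0 t0; rewrite mule_ge0 // lee_fin ltW.
have [t11 E11] : exists t, t = T u1 v1 x by eexists; reflexivity.
have [t12 E12] : exists t, t = T u1 v2 x by eexists; reflexivity.
have [t21 E21] : exists t, t = T u2 v1 x by eexists; reflexivity.
have [t22 E22] : exists t, t = T u2 v2 x by eexists; reflexivity.
rewrite -E11 -E12 -E21 -E22 in T11 T12 T21 T22 *.
apply: lee_sum4; [exact: P K4 T11|exact: P K4 T12|exact: P K4 T21|exact: P d0 T22|].
move=> /(fin _ _ K4 T11) L11 /(fin _ _ K4 T12) L12 /(fin _ _ K4 T21) L21 /(fin _ _ d0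
  T22) L22.
apply: (@le_trans _ _ (4 * (K * (fine t11 + fine t12 + fine t21)))%:E); last first.
  have E (t : \bar R) : (0 <= t)%E -> (t < +oo)%E -> t = (fine t)%:E.
    by case: t.
  rewrite [X in (_ * X + _ + _ + _)%E](E _ T11 L11) [X in (_ + _ * X + _ + _)%E](E _
    T12 L12) [X in (_ + _ * X + _)%E](E _ T21 L21).
  rewrite -!EFinM -!EFinD -!mulrDr mulrA.
  by apply: leeDl; exact: P d0 T22.
rewrite lee_fin; set S := K * _.
have L11' : (T u1 v1 x < +oo)%E by rewrite -E11.
have L12' : (T u1 v2 x < +oo)%E by rewrite -E12.
have L21' : (T u2 v1 x < +oo)%E by rewrite -E21.
have L22' : (T u2 v2 x < +oo)%E by rewrite -E22.
have SE : S = K * (fine (T u1 v1 x) + fine (T u1 v2 x) + fine (T u2 v1 x)).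
  by rewrite /S E11 E12 E21.
have [mF1 mF2] := mF; have [mG1 mG2] := mG; have [mf1 mf2] := mf; have [mg1 mg2] := mg.
have D (F' f' G' g' : M -> R) : measurable_fun setT F' -> measurable_fun setT f' ->
    measurable_fun setT G' -> measurable_fun setT g' ->
    (forall z, `|F' z - f' z| <= u1 z) -> (forall z, `|f' z| <= u2 z) ->
    (forall z, `|G' z - g' z| <= v1 z) -> (forall z, `|g' z| <= v2 z) ->
    [/\ mu.-integrable setT (EFin \o (fun y => translationR alpha beta F' x (- y) * G'
      y * A y)),
        mu.-integrable setT (EFin \o (fun y => translationR alpha beta f' x (- y) * g'
          y * A y)) &
        `|convR alpha beta F' G' x - convR alpha beta f' g' x| <= S].
  move=> m1 m2 m3 m4 h1 h2 h3 h4.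
  have := bilR_diff_le K0 HK m1 m3 m2 m4 mu1 mu2 mv1 mv2 h1 h2 h3 h4.
  move=> /(_ x L11' L12' L21' L22') [I1 I2 B].
  have [J1 ->] := convR_bilR m1 m3 I1; have [J2 ->] := convR_bilR m2 m4 I2.
  by split => //; rewrite SE; exact: B.
have rF z : `|complex.Re (F z) - complex.Re (f z)| <= u1 z by rewrite -ReB;
  exact: normr_Re_le.
have iF z : `|complex.Im (F z) - complex.Im (f z)| <= u1 z by rewrite -ImB;
  exact: normr_Im_le.
have rG z : `|complex.Re (G z) - complex.Re (g z)| <= v1 z by rewrite -ReB;
  exact: normr_Re_le.
have iG z : `|complex.Im (G z) - complex.Im (g z)| <= v1 z by rewrite -ImB;
  exact: normr_Im_le.
have rf z : `|complex.Re (f z)| <= u2 z by exact: normr_Re_le.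
have if' z : `|complex.Im (f z)| <= u2 z by exact: normr_Im_le.
have rg z : `|complex.Re (g z)| <= v2 z by exact: normr_Re_le.
have ig z : `|complex.Im (g z)| <= v2 z by exact: normr_Im_le.
have [J11 j11 B11] := D _ _ _ _ mF1 mf1 mG1 mg1 rF rf rG rg.
have [J12 j12 B12] := D _ _ _ _ mF1 mf1 mG2 mg2 rF rf iG ig.
have [J21 j21 B21] := D _ _ _ _ mF2 mf2 mG1 mg1 iF if' rG rg.
have [J22 j22 B22] := D _ _ _ _ mF2 mf2 mG2 mg2 iF if' iG ig.
have [RC IC] := ReIm_convolution mF mG x0.
have [Rc Ic] := ReIm_convolution mf mg x0.
apply: (le_trans (normc_le _)); rewrite ReB ImB RC IC Rc Ic.
rewrite RintegralB // RintegralB // RintegralD // RintegralD //.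
exact: ler_norm_sum4 B11 B12 B21 B22.
Qed.

(** Joint measurability of the translation in x and y includes the degenerate points x = 0 and y =
    0, so these enter as explicit cases. *)
Lemma cmeasurable_convolution f g : cmeasurable f -> cmeasurable g ->
  cmeasurable (convolution alpha beta f g).
Proof.
move=> [f1 f2] [g1 g2].
have mN : measurable_fun setT (fun p : M * M => - p.2 : M).
  by apply: measurableT_comp => //; exact: measurable_snd.
have mtr (h : M -> R) : measurable_fun setT h -> measurable_fun setT (fun p : M * M =>
    if - p.2 == 0 then h p.1 else if p.1 == 0 then h (- p.2) else
    translationR alpha beta h p.1 (- p.2)).
  move=> mh; apply: measurable_fun_ifT.
  - by apply: measurable_fun_eqr => //; exact: measurable_cst.
  - exact: (measurableT_comp mh measurable_fst).
  - apply: measurable_fun_ifT.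
    + by apply: measurable_fun_eqr; [exact: measurable_fst|exact: measurable_cst].
    + exact: (measurableT_comp mh mN).
    + by apply: measurable_fun_translationR.
have E (p : M * M) :
    complex.Re (translation alpha beta p.1 f (- p.2)) =
      (if - p.2 == 0 then complex.Re (f p.1) else if p.1 == 0 then complex.Re (f (-
        p.2)) else
    translationR alpha beta (fun t => complex.Re (f t)) p.1 (- p.2)) /\
    complex.Im (translation alpha beta p.1 f (- p.2)) =
      (if - p.2 == 0 then complex.Im (f p.1) else if p.1 == 0 then complex.Im (f (-
        p.2)) else
    translationR alpha beta (fun t => complex.Im (f t)) p.1 (- p.2)).
  have [y0|y0] := eqVneq (- p.2) 0; first by rewrite /translation /mu_integral y0 eqxx.
  have [x0|x0] := eqVneq p.1 0; first by rewrite /translation /mu_integral (negbTE y0)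
    x0 eqxx.
  exact: ReIm_translation.
have mT1 : measurable_fun setT (fun p : M * M => complex.Re (translation alpha beta p.1
  f (- p.2))).
  rewrite (_ : (fun p => _) = (fun p : M * M =>
    if - p.2 == 0 then complex.Re (f p.1) else if p.1 == 0 then complex.Re (f (- p.2))
      else
    translationR alpha beta (fun t => complex.Re (f t)) p.1 (- p.2)));
      first exact: mtr f1.
  by apply/funext => p; have [-> _] := E p.
have mT2 : measurable_fun setT (fun p : M * M => complex.Im (translation alpha beta p.1
  f (- p.2))).
  rewrite (_ : (fun p => _) = (fun p : M * M =>
    if - p.2 == 0 then complex.Im (f p.1) else if p.1 == 0 then complex.Im (f (- p.2))
      else
    translationR alpha beta (fun t => complex.Im (f t)) p.1 (- p.2)));
      first exact: mtr f2.
  by apply/funext => p; have [_ ->] := E p.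
have mg1 : measurable_fun setT (fun p : M * M => complex.Re (g p.2)).
  exact: (measurableT_comp g1 measurable_snd).
have mg2 : measurable_fun setT (fun p : M * M => complex.Im (g p.2)).
  exact: (measurableT_comp g2 measurable_snd).
have mA : measurable_fun setT (fun p : M * M => jacobi_weight alpha beta `|p.2|).
  exact: (measurableT_comp (measurable_jacobi_weight alpha beta) measurable_snd).
split.
- apply: (@measurable_fun_Rintegral_param R _ M setT (fun p => complex.Re
    (translation alpha beta p.1 f (- p.2) * g p.2 * (jacobi_weight alpha beta
      `|p.2|)%:C%C))) => //.
  under eq_fun do rewrite Re_mul_real ReM.
  by apply: measurable_funM => //; apply: measurable_funB; apply: measurable_funM.
- apply: (@measurable_fun_Rintegral_param R _ M setT (fun p => complex.Im
    (translation alpha beta p.1 f (- p.2) * g p.2 * (jacobi_weight alpha beta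
      `|p.2|)%:C%C))) => //.
  under eq_fun do rewrite Im_mul_real ImM.
  by apply: measurable_funM => //; apply: measurable_funD; apply: measurable_funM.
Qed.

End ConvolutionDifference.

(** * Density of the compactly supported continuous functions *)

Section Density.
Context {R : realType}.
Local Notation M := (measurableTypeR R).
Local Notation mu := (@lebesgue_measure R).
Implicit Types u w g : M -> R.

Lemma cvge0_near_le (t : nat -> \bar R) (e : R) : t @ \oo --> 0%E -> 0 < e ->
  \forall n \near \oo, (t n <= e%:E)%E.
Proof.
move=> /fine_cvgP[tf t0] e0; have te : \forall n \near \oo,
  `|(fine \o t) n| <= e by exact: (cvgr0_norm_le _ t0).
apply: filterS2 tf te => n fn te.
by rewrite -(fineK fn) lee_fin (le_trans (ler_norm _) te).
Qed.

Lemma powRD_le (p a b : R) : 0 < p -> 0 <= a -> 0 <= b ->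
  (a + b) `^ p <= 2 `^ p * (a `^ p + b `^ p).
Proof.
move=> p0 a0 b0.
have key c d : 0 <= c -> c <= d -> (c + d) `^ p <= 2 `^ p * (c `^ p + d `^ p).
  move=> c0 cd; have d0 := le_trans c0 cd.
  apply: (@le_trans _ _ ((2 * d) `^ p)).
    by apply: ge0_ler_powR; rewrite ?nnegrE ?(ltW p0) ?mulr_ge0 ?addr_ge0 // mulr_natl
      mulr2n lerD2r.
  by rewrite powRM // ler_wpM2l ?powR_ge0 // lerDr powR_ge0.
have [ab|/ltW ba] := leP a b; first exact: key.
by rewrite addrC [leRHS](_ : _ = 2 `^ p * (b `^ p + a `^ p));
  [exact: key|rewrite [X in _ * X]addrC].
Qed.

(** For uniformly bounded functions, closeness in L^1 thus gives closeness in L^p. *)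
Lemma powR_le_linear (p c t : R) : 1 <= p -> 0 <= t -> t <= c ->
  t `^ p <= c `^ (p - 1) * t.
Proof.
move=> p1; rewrite le_eqVlt => /predU1P[<- _|t0 tc].
  by rewrite powR0 ?mulr0 //; lra.
rewrite (_ : t `^ p = t `^ (p - 1) * t); last first.
  by rewrite -{3}(powRr1 (ltW t0)) -gt0_powRD // subrK.
rewrite ler_wpM2r ?(ltW t0) //; apply: ge0_ler_powR; rewrite ?nnegrE //; lra.
Qed.

Definition truncate (n : nat) u (x : R) : R :=
  if (`|x| <= n%:R) && (`|u x| <= n%:R) then u x else 0.

Lemma measurable_fun_truncate n u : measurable_fun setT u ->
  measurable_fun setT (truncate n u).
Proof.
move=> mu_; apply: measurable_fun_ifT => //.
apply: measurable_and; apply: measurable_fun_ler => //; exact: measurable_fun_norm.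
Qed.

Lemma normr_truncate_le n u x : `|truncate n u x| <= n%:R.
Proof. by rewrite /truncate; case: ifP => [/andP[]//|_]; rewrite normr0. Qed.

Definition plateau (n : nat) (x : R) : R := Num.max 0 (Num.min 1 (n.+1%:R - `|x|)).

Definition clamp (n : nat) (t : R) : R := Num.max (- n%:R) (Num.min n%:R t).

(** The clamp is the nearest-point projection onto [-n, n], so it does not increase the distance to
    points of that interval. *)
Lemma clampP n t : `|clamp n t| <= n%:R /\ `|clamp n t| <= `|t| /\
  (forall a, `|a| <= n%:R -> `|clamp n t - a| <= `|t - a|).
Proof.
have n0 : 0 <= n%:R :> R by [].
rewrite /clamp; move: n%:R n0 => c c0.
have [h1|h1] := leP c t; (have [h2|h2] := leP (- c) _); split; try lra.
all: try by rewrite ler_norml; lra.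
all: split.
all: try by (have := ler_norm t; have := ler_norm (- t); rewrite normrN ler_norml; lra).
all: by move=> a; rewrite ler_norml => /andP[a1 a2];
  have := ler_norm (t - a); have := ler_norm (- (t - a)); rewrite normrN ler_norml; lra.
Qed.

Lemma plateauP n (x : R) : 0 <= plateau n x <= 1 /\
  (`|x| <= n%:R -> plateau n x = 1) /\ (n.+1%:R <= `|x| -> plateau n x = 0).
Proof.
rewrite /plateau -natr1; move: `|x| n%:R => a c.
have [h1|h1] := leP 1 (c + 1 - a).
  by rewrite max_r //; split; [lra|split => h; lra].
by have [h2|h2] := leP 0 (c + 1 - a); split; [lra|split => h; lra|lra|split => h; lra].
Qed.

Lemma continuous_plateau_clamp n g : continuous (g : R -> R) ->
  continuous (fun x : R => plateau n x * clamp n (g x)).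
Proof.
move=> cg x; apply: continuousM.
  apply: (@continuous_max R R (cst 0) (fun x => Num.min 1 (n.+1%:R - `|x|))).
    exact: cst_continuous.
  apply: (@continuous_min R R (cst 1) (fun x => n.+1%:R - `|x|)).
    exact: cst_continuous.
  apply: continuousB; first exact: cst_continuous.
  exact: norm_continuous.
apply: (@continuous_max R R (cst (- n%:R)) (fun x => Num.min n%:R (g x))).
  exact: cst_continuous.
by apply: (@continuous_min R R (cst n%:R) g); [exact: cst_continuous|exact: cg].
Qed.

(** A continuous approximation g of [truncate n u] is made bounded and compactly supported without
    moving away from [truncate n u] at any point. *)
Lemma plateau_clampP n u g x :
  let w := plateau n x * clamp n (g x) in
  [/\ `|w - truncate n u x| <= 2 * n%:R,
      `|w - truncate n u x| <= `|truncate n u x - g x| &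
      n.+1%:R <= `|x| -> w = 0 /\ truncate n u x = 0].
Proof.
have [/andP[e0 e1] [ein eout]] := plateauP n x.
have [c1 [c2 c3]] := clampP n (g x).
have t1 := normr_truncate_le n u x.
move=> w; have w1 : `|w| <= `|clamp n (g x)|.
  by rewrite /w normrM ger0_norm // ler_piMl.
split.
- by apply: (le_trans (ler_normB _ _)); lra.
- have [xn|xn] := leP `|x| n%:R.
    by rewrite /w ein // mul1r [leRHS]distrC; exact: c3.
  rewrite (_ : truncate n u x = 0) ?subr0 ?sub0r ?normrN; first exact: le_trans w1 c2.
  by rewrite /truncate leNgt xn.
- move=> nx; rewrite /w eout // mul0r; split => //.
  by rewrite /truncate (_ : (`|x| <= n%:R) = false) //; apply/negbTE;
    rewrite -ltNge -natr1 in nx *; lra.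
Qed.

Section Weight.
Variables (A : M -> R) (p : R).
Hypotheses (mA : measurable_fun setT A) (A0 : forall x, 0 <= A x).
Hypothesis bA : forall c : R, exists S : R, forall x : R, `|x| <= c -> A x <= S.
Hypothesis p1 : 1 <= p.

Lemma measurable_powR_weight u : measurable_fun setT u ->
  measurable_fun setT (fun x => (`|u x| `^ p * A x)%:E).
Proof.
move=> m; apply/measurable_EFinP; apply: measurable_funM => //.
by apply: measurable_fun_powR; exact: measurable_fun_norm.
Qed.

(** At each point the truncation eventually agrees with u, and |u|^p A dominates the error. *)
Lemma truncate_near u (e : R) : measurable_fun setT u ->
  (\int[mu]_x (`|u x| `^ p * A x)%:E < +oo)%E -> 0 < e ->
  exists n, (\int[mu]_x (`|truncate n u x - u x| `^ p * A x)%:E <= e%:E)%E.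
Proof.
move=> mu_ Iu e0.
have p0 : 0 < p by have := p1; lra.
pose f_ n x := (`|truncate n u x - u x| `^ p * A x)%:E.
have mf n : measurable_fun setT (f_ n).
  by apply: measurable_powR_weight; apply: measurable_funB => //;
    exact: measurable_fun_truncate.
have key : (\int[mu]_x f_ n x)%E @[n --> \oo] --> (\int[mu]_x (cst 0 x))%E.
  apply: (@dominated_cvg _ _ _ mu setT measurableT f_ (cst 0%E) (fun x => (`|u x| `^ p
    * A x)%:E)) => //.
  - move=> x _; apply: cvg_near_cst.
    have h1 := nbhs_infty_ger `|x|; have h2 := nbhs_infty_ger `|u x|.
    apply: filterS2 h1 h2 => n n1 n2.
    by rewrite /f_ /truncate n1 n2 subrr normr0 powR0 ?gt_eqF // mul0r.
  - apply/integrableP; split; first exact: measurable_powR_weight.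
    rewrite [ltLHS](_ : _ = \int[mu]_x (`|u x| `^ p * A x)%:E)%E //.
    by apply: eq_integral => x _; rewrite gee0_abs // lee_fin mulr_ge0 ?powR_ge0.
  - move=> n x _; rewrite gee0_abs ?lee_fin; last by rewrite mulr_ge0 ?powR_ge0.
    rewrite ler_wpM2r // ge0_ler_powR ?nnegrE ?(ltW p0) //.
    by rewrite /truncate; case: ifP => _; rewrite ?subrr ?normr0 // sub0r normrN.
rewrite integral0 in key.
by have [n ?] := filter_ex (cvge0_near_le key e0); exists n.
Qed.

(** Lebesgue L^1 approximation on [-(n + 1), n + 1] is upgraded to weighted L^p: the error is
    bounded by 2 n and the weight by S there. *)
Lemma approx_truncate n u (e : R) : measurable_fun setT u -> 0 < e ->
  exists w : R -> R, [/\ continuous w, (forall x, n.+1%:R <= `|x| -> w x = 0) &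
    (\int[mu]_x (`|w x - truncate n u x| `^ p * A x)%:E <= e%:E)%E].
Proof.
move=> mu_ e0; set t := truncate n u.
have mt : measurable_fun setT t by exact: measurable_fun_truncate.
pose B : set M := `[- n.+1%:R, n.+1%:R]%classic.
have mB : measurable B by exact: measurable_itv.
have B1 : (mu B < +oo)%E.
  by rewrite /B lebesgue_measure_itv /=; case: ifP => _; rewrite -?EFinB ltry.
have It : mu.-integrable B (EFin \o t).
  apply: measurable_bounded_integrable => //; first exact: measurable_funTS.
  exists n%:R; split; first exact: num_real.
  move=> c nc x _; exact: le_trans (normr_truncate_le n u x) (ltW nc).
have [g [cg Ig g0]] := approximation_continuous_integrable mB B1 It.
have [S HS] := bA n.+1%:R.
have S0 : 0 <= S by apply: le_trans (A0 0) (HS 0 _); rewrite normr0.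
pose c := (2 * n%:R) `^ (p - 1) * S.
have c0 : 0 <= c by rewrite mulr_ge0 ?powR_ge0.
(* The 1 is added because c may be 0. *)
have ec : 0 < e / (c + 1) by rewrite divr_gt0 // ltr_wpDl.
have [k gk] := filter_ex (cvge0_near_le g0 ec).
pose w (x : R) := plateau n x * clamp n (g k x).
have cw : continuous w by exact: continuous_plateau_clamp.
have mw : measurable_fun setT (w : M -> R) by exact: continuous_measurable_fun.
have mg : measurable_fun setT (g k : M -> R) by exact: continuous_measurable_fun.
exists w; split => //.
  by move=> x nx; have [_ _ /(_ nx)[]] := plateau_clampP n u (g k) x.
pose h x := (`|w x - t x| `^ p * A x)%:E.
rewrite [leLHS](_ : _ = \int[mu]_(x in B) h x)%E; last first.
  rewrite [RHS]integral_mkcond; apply: eq_integral => x _; rewrite patchE.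
  case: (boolP (x \in B)) => //; rewrite /B notin_setE /= in_itv /= -ler_norml => /negP.
  rewrite -ltNge => /ltW nx; have [_ _ /(_ nx)[w0 t0]] := plateau_clampP n u (g k) x.
  by rewrite /w /t w0 t0 subrr normr0 powR0 ?mul0r //; have := p1; lra.
apply: (@le_trans _ _ (\int[mu]_(x in B) (c%:E * `|(t x - g k x)%:E|))%E).
  apply: ge0_le_integral => //.
  - by move=> x _; rewrite lee_fin mulr_ge0 ?powR_ge0.
  - by apply: measurable_funTS; apply: measurable_powR_weight; exact: measurable_funB.
  - apply: measurable_funTS; apply: emeasurable_funM; first exact: measurable_cst.
    apply: measurableT_comp => //; apply/measurable_EFinP; exact: measurable_funB.
  move=> x; rewrite /B /= in_itv /= -ler_norml => xn.
  have [h1 h2 _] := plateau_clampP n u (g k) x.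
  rewrite /h /abse -EFinM lee_fin /c -mulrA [S * _]mulrC mulrA.
  apply: ler_pM; [exact: powR_ge0|exact: A0| |exact: HS].
  apply: (le_trans (powR_le_linear p1 (normr_ge0 _) h1)).
  by rewrite ler_wpM2l ?powR_ge0.
rewrite ge0_integralZl_EFin //; last first.
  apply: measurable_funTS; apply: measurableT_comp => //.
  by apply/measurable_EFinP; exact: measurable_funB.
apply: le_trans (lee_wpmul2l _ gk) _; first by rewrite lee_fin.
rewrite -EFinM lee_fin mulrA ler_pdivrMr ?ltr_wpDl //.
by rewrite mulrDr mulr1 mulrC lerDl ltW.
Qed.

(** A quasi-triangle inequality suffices, as the errors are arbitrarily small. The pointwise
    domination of h also covers the modulus of a complex number by its two parts. *)
Lemma integral_powRD_le (a b : M -> R) (c d : R) : measurable_fun setT a ->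
  measurable_fun setT b ->
  (\int[mu]_x (`|a x| `^ p * A x)%:E <= c%:E)%E ->
  (\int[mu]_x (`|b x| `^ p * A x)%:E <= d%:E)%E ->
  forall h : M -> R, measurable_fun setT h -> (forall x, `|h x| <= `|a x| + `|b x|) ->
  (\int[mu]_x (`|h x| `^ p * A x)%:E <= (2 `^ p * (c + d))%:E)%E.
Proof.
move=> ma mb ia ib h mh hab; have p0 : 0 < p by have := p1; lra.
have P f x : (0 <= (`|f x| `^ p * A x)%:E)%E by rewrite lee_fin mulr_ge0 ?powR_ge0.
apply: (@le_trans _ _ ((2 `^ p)%:E * \int[mu]_x ((`|a x| `^ p * A x)%:E + (`|b x| `^ p
  * A x)%:E))%E).
  rewrite -ge0_integralZl_EFin ?powR_ge0 //; last 2 first.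
  - by move=> x _; rewrite adde_ge0.
  - by apply: emeasurable_funD; exact: measurable_powR_weight.
  apply: ge0_le_integral => //.
  - exact: measurable_powR_weight.
  - apply: emeasurable_funM; first exact: measurable_cst.
    by apply: emeasurable_funD; exact: measurable_powR_weight.
  move=> x _; rewrite -EFinD -EFinM lee_fin -mulrDl mulrA ler_wpM2r //.
  apply: le_trans (powRD_le p0 (normr_ge0 _) (normr_ge0 _)).
  by apply: ge0_ler_powR; rewrite ?nnegrE ?(ltW p0) ?addr_ge0.
rewrite EFinM; apply: lee_wpmul2l; first by rewrite lee_fin powR_ge0.
rewrite ge0_integralD //; [|exact: measurable_powR_weight|exact: measurable_powR_weight].
by rewrite EFinD leeD.
Qed.

Lemma approx_continuous u (e : R) : measurable_fun setT u ->
  (\int[mu]_x (`|u x| `^ p * A x)%:E < +oo)%E -> 0 < e ->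
  exists (n : nat) (w : R -> R), [/\ continuous w, (forall x, n.+1%:R <= `|x| ->
    w x = 0) &
    (\int[mu]_x (`|w x - u x| `^ p * A x)%:E <= e%:E)%E].
Proof.
move=> mu_ Iu e0.
pose d := e / (2 `^ p * 2).
have q0 : 0 < 2 `^ p * 2 :> R by rewrite mulr_gt0 // powR_gt0.
have d0 : 0 < d by rewrite divr_gt0.
have [n Hn] := truncate_near mu_ Iu d0.
have [w [cw w0 Hw]] := approx_truncate n mu_ d0.
have mw : measurable_fun setT (w : M -> R) by exact: continuous_measurable_fun.
have mt := measurable_fun_truncate n mu_.
exists n, w; split => //.
rewrite (_ : e = 2 `^ p * (d + d)); last first.
  have := lt0r_neq0 q0; rewrite /d; move: (2 `^ p) => q;
    rewrite mulf_eq0 negb_or => /andP[q1 _]; by field.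
apply: (integral_powRD_le _ _ Hw Hn); [exact: measurable_funB|exact:
  measurable_funB|exact: measurable_funB|].
move=> x; rewrite (_ : w x - u x = (w x - truncate n u x) + (truncate n u x - u x));
  last by ring.
exact: ler_normD.
Qed.

End Weight.
End Density.

Section Extension.
Context {R : realType}.
Local Notation M := (measurableTypeR R).
Local Notation mu := (@lebesgue_measure R).
Local Notation normc := (@ComplexField.Normc.normc R).
Variables (alpha beta : R).
Hypotheses (hb : - 2^-1 <= beta) (hab : beta <= alpha) (ha : - 2^-1 < alpha).
Local Notation nu := (jacobi_measure alpha beta).
Local Notation A := (fun x : R => jacobi_weight alpha beta `|x|).
Local Notation conv := (convolution alpha beta).

Lemma jacobi_weight_bounded (c : R) :
  exists S : R, forall x : R, `|x| <= c -> jacobi_weight alpha beta `|x| <= S.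
Proof.
exists (expR c `^ (2 * alpha + 1) * expR c `^ (2 * beta + 1)) => x xc.
have x0 := normr_ge0 x; have ec : expR `|x| <= expR c by rewrite ler_expR.
have e0 := expR_gt0 `|x|; have e0' := expR_gt0 (- `|x|).
have ee : expR (- `|x|) <= expR `|x| by rewrite ler_expR; lra.
have s0 : 0 <= sinh `|x| by rewrite /sinh; lra.
have c0 : 0 <= cosh `|x| by rewrite /cosh; lra.
have h1 := hb; have h2 := ha.
rewrite /jacobi_weight; apply: ler_pM; [exact: powR_ge0|exact: powR_ge0| |].
  apply: ge0_ler_powR; rewrite ?nnegrE ?expR_ge0 //; first lra.
  by rewrite /sinh; lra.
apply: ge0_ler_powR; rewrite ?nnegrE ?expR_ge0 //; first lra.
by rewrite /cosh; lra.
Qed.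

Lemma cLnorm_ge0 s f : (0 <= cLnorm alpha beta s f)%E.
Proof. exact: Lnorm_ge0. Qed.

Lemma integral_normc_fin (p : R) f : 0 < p -> inL alpha beta p%:E f ->
  exists2 K : R, 0 <= K & (\int[mu]_x (`|normc (f x)| `^ p * A x)%:E <= K%:E)%E.
Proof.
move=> p0 [fr fi ff].
have E : cLnorm alpha beta p%:E f = (fine (cLnorm alpha beta p%:E f))%:E.
  by rewrite fineK // ge0_fin_numE // cLnorm_ge0.
have a0 : 0 <= fine (cLnorm alpha beta p%:E f) by rewrite fine_ge0 // cLnorm_ge0.
exists (fine (cLnorm alpha beta p%:E f) `^ p); first exact: powR_ge0.
apply: (integral_le_Lnorm_jacobi p0 a0); first exact: (@measurable_fun_normc R f (conj
  fr fi)).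
by rewrite -E.
Qed.

Lemma Cc_near (p : R) f (e : R) : 1 <= p -> inL alpha beta p%:E f -> 0 < e ->
  exists F : R -> R[i], [/\ Cc F, inL alpha beta p%:E F &
    (cLnorm alpha beta p%:E (fun x => F x - f x)%R <= e%:E)%E].
Proof.
move=> p1 Lf e0; have p0 : 0 < p by lra.
have [K K0 IK] := integral_normc_fin p0 Lf.
have [fr fi _] := Lf; have mf : cmeasurable f by [].
have mA := measurable_jacobi_weight alpha beta.
have A0 (x : M) : 0 <= A x by exact: jacobi_weight_ge0.
have mnf := measurable_fun_normc mf.
have part (u : M -> R) : measurable_fun setT u -> (forall x, `|u x| <= normc (f x)) ->
    (\int[mu]_x (`|u x| `^ p * A x)%:E < +oo)%E.
  move=> m le; apply: le_lt_trans (ltry K); apply: le_trans IK.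
  apply: ge0_le_integral => //.
  - by move=> x _; rewrite lee_fin mulr_ge0 ?powR_ge0.
  - exact: measurable_powR_weight.
  - exact: measurable_powR_weight.
  move=> x _; rewrite lee_fin; apply: ler_wpM2r; first exact: A0.
  by apply: ge0_ler_powR; rewrite ?nnegrE ?(ltW p0) // (le_trans (le x)) // ler_norm.
have d0 : 0 < e `^ p / (2 `^ p * 2) by rewrite divr_gt0 ?mulr_gt0 ?powR_gt0.
have [n1 [w1 [cw1 w10 Hw1]]] := approx_continuous mA A0 jacobi_weight_bounded p1 fr
  (part _ fr (fun x => normr_Re_le (f x))) d0.
have [n2 [w2 [cw2 w20 Hw2]]] := approx_continuous mA A0 jacobi_weight_bounded p1 fi
  (part _ fi (fun x => normr_Im_le (f x))) d0.
have m1 : measurable_fun setT (w1 : M -> R) by exact: continuous_measurable_fun.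
have m2 : measurable_fun setT (w2 : M -> R) by exact: continuous_measurable_fun.
pose F (x : R) : R[i] := (w1 x +i* w2 x)%C.
have mF : cmeasurable F by [].
have mFf := cmeasurableB mF mf.
have IF : (\int[mu]_x (`|normc (F x - f x)| `^ p * A x)%:E <= (e `^ p)%:E)%E.
  rewrite (_ : e `^ p = 2 `^ p * (e `^ p / (2 `^ p * 2) + e `^ p / (2 `^ p * 2)));
    last first.
    have := lt0r_neq0 (powR_gt0 p (ltr0Sn R 1)); move: (2 `^ p) (e `^ p) => q E q1.
    by field.
  apply: (integral_powRD_le mA A0 p1 _ _ Hw1 Hw2).
  - exact: measurable_funB.
  - exact: measurable_funB.
  - exact: (measurable_fun_normc mFf).
  move=> x; rewrite ger0_norm ?normc_ge0 // (le_trans (normc_le _)) //.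
  by rewrite ReB ImB.
exists F; split.
- split; [exact: cw1|exact: cw2|].
  (* The parts vanish for |x| >= n1 + 1 and |x| >= n2 + 1 respectively, so n1 + n2 + 1 is a common
     radius. *)
  refine (subclosed_compact (@closed_closure _ _) (@segment_compact _ (- (n1 +
    n2).+1%:R) (n1 + n2).+1%:R) _).
  set B := (X in _ `<=` X); have : closed B by exact: itv_closed.
  move=> /closure_id ->; apply: closureS => x /=.
  rewrite /B /= in_itv /= -ler_norml; apply: contraNT; rewrite -ltNge => /ltW nx.
  rewrite /F w10 ?w20 //; apply: le_trans nx; rewrite ler_nat ltnS.
    exact: leq_addl.
  exact: leq_addr.
- split=> //; apply: (@le_lt_trans _ _ ((2 `^ p * (e `^ p + K)) `^ p^-1)%:E);
    last exact: ltry.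
  apply: (Lnorm_jacobi_le p0 (powR_ge0 _ _) (measurable_fun_normc mF)).
  rewrite -powRrM mulVf ?gt_eqF // powRr1; last by rewrite mulr_ge0 ?addr_ge0 ?powR_ge0.
  apply: (integral_powRD_le mA A0 p1 _ _ IF IK).
  - exact: (measurable_fun_normc mFf).
  - exact: mnf.
  - exact: (measurable_fun_normc mF).
  move=> x; rewrite !ger0_norm ?normc_ge0 //.
  by have := le_normcD (F x - f x) (f x); rewrite subrK.
- exact: (Lnorm_jacobi_le p0 (ltW e0) (measurable_fun_normc mFf)).
Qed.

Lemma Cc_dense (p : R) f : 1 <= p -> inL alpha beta p%:E f ->
  exists F : nat -> R -> R[i], (forall n, Cc (F n)) /\ cvg_L alpha beta p%:E F f.
Proof.
move=> p1 Lf.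
have H n : exists F : R -> R[i], [/\ Cc F, inL alpha beta p%:E F &
    (cLnorm alpha beta p%:E (fun x => F x - f x)%R <= (n.+1%:R^-1)%:E)%E].
  by apply: Cc_near => //; rewrite invr_gt0.
have [F HF] := choice H.
exists F; split; first by move=> n; have [] := HF n.
split=> //; first by move=> n; have [] := HF n.
apply: (@squeeze_cvge _ _ _ _ (fun=> 0%E) _ (fun n => (n.+1%:R^-1)%:E)).
- by apply: nearW => n; rewrite cLnorm_ge0 /=; have [] := HF n.
- exact: cvg_cst.
- by apply: cvg_EFin; [exact: nearW|exact: (@cvg_harmonic R)].
Qed.

Lemma Lnorm_jacobiZ_le (p k a : R) (u : M -> R) : 0 < p -> 0 <= k -> 0 <= a ->
  measurable_fun setT u -> (Lnorm nu p%:E (EFin \o u) <= a%:E)%E ->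
  (Lnorm nu p%:E (EFin \o (fun x => k * u x)%R) <= (k * a)%:E)%E.
Proof.
move=> p0 k0 a0 mu_ Hu; have mA := measurable_jacobi_weight alpha beta.
have A0 (x : M) : 0 <= A x by exact: jacobi_weight_ge0.
apply: Lnorm_jacobi_le => //.
- by rewrite mulr_ge0.
- exact: measurable_funM.
under eq_integral => x _.
  rewrite (normrM k) (ger0_norm k0) (powRM _ k0 (normr_ge0 _)) -mulrA EFinM.
  over.
rewrite ge0_integralZl_EFin ?powR_ge0 //; last 2 first.
- by move=> x _; rewrite lee_fin mulr_ge0 ?powR_ge0.
- exact: measurable_powR_weight.
rewrite powRM // EFinM; apply: lee_wpmul2l; first by rewrite lee_fin powR_ge0.
exact: integral_le_Lnorm_jacobi.
Qed.

(** * Extension of the convolution *)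

Section Bounded.
Variables (p c : R) (s : \bar R).
Hypotheses (p1 : 1 <= p) (c0 : 0 <= c).
Hypothesis hT : tri_form_bounded alpha beta p%:E s c.

Lemma sume_ord4 (t : nat -> \bar R) :
  (\sum_(i < 4) t i = t 0%N + t 1%N + t 2%N + t 3%N)%E.
Proof. by rewrite !big_ord_recl big_ord0 /= adde0 !addeA. Qed.

(** The fourth term of [convolution_diff_le], needed for convergence, contributes c d n m to the
    norm and disappears as d tends to 0. *)
Lemma cLnorm_convolutionB_le : exists2 K : R, 0 < K & forall F G f g (a b n m : R),
  cmeasurable F -> cmeasurable G -> cmeasurable f -> cmeasurable g ->
  0 <= a -> 0 <= b -> 0 <= n -> 0 <= m ->
  (cLnorm alpha beta p%:E (fun x => F x - f x)%R <= a%:E)%E ->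
  (cLnorm alpha beta 2%:E (fun x => G x - g x)%R <= b%:E)%E ->
  (cLnorm alpha beta p%:E f <= n%:E)%E -> (cLnorm alpha beta 2%:E g <= m%:E)%E ->
  (cLnorm alpha beta s (fun x => conv F G x - conv f g x)%R <=
    (c * (K * (a * b + a * m + n * b)))%:E)%E.
Proof.
have [K K0 HK] := convolution_diff_le hb hab ha.
exists K => // F G f g a b n m mF mG mf mg a0 b0 n0 m0 Ha Hb Hn Hm.
have p0 : 0 < p by have := p1; lra.
have mFf := measurable_fun_normc (cmeasurableB mF mf).
have mGg := measurable_fun_normc (cmeasurableB mG mg).
have mnf := measurable_fun_normc mf; have mng := measurable_fun_normc mg.
pose h d := c * (K * (a * b + a * m + n * b) + d * (n * m)).
have -> : c * (K * (a * b + a * m + n * b)) = h 0 by rewrite /h mul0r addr0.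
apply: lee_right_limit.
  rewrite /h; apply: continuousM; first exact: cst_continuous.
  apply: continuousD; first exact: cst_continuous.
  by apply: continuousM; [exact: cvg_id|exact: cst_continuous].
move=> d d0.
pose u (i : 'I_4) : M -> R := nth (cst 0) [:: (fun z => K * normc (F z - f z));
  (fun z => K * normc (F z - f z)); (fun z => K * normc (f z));
    (fun z => d * normc (f z))] i.
pose v (i : 'I_4) : M -> R := nth (cst 0) [:: (fun z => normc (G z - g z));
  (fun z => normc (g z)); (fun z => normc (G z - g z)); (fun z => normc (g z))] i.
pose a_ (i : 'I_4) : R := nth 0 [:: K * a; K * a; K * n; d * n] i.
pose b_ (i : 'I_4) : R := nth 0 [:: b; m; b; m] i.
have K1 := ltW K0; have d1 := ltW d0.
have := @hT (fun x => normc (conv F G x - conv f g x)) u v a_ b_.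
rewrite (_ : c * (\sum_(i < 4) a_ i * b_ i) = h d); last first.
  by rewrite !big_ord_recl big_ord0 /h /a_ /b_ /=; ring.
apply.
- by apply: (measurable_fun_normc (cmeasurableB _ _)); exact: cmeasurable_convolution.
- by case=> [[|[|[|[|//]]]] ?]; apply: measurable_funM.
- by case=> [[|[|[|[|//]]]] ?].
- by case=> [[|[|[|[|//]]]] ?] x; apply: mulr_ge0 => //; exact: normc_ge0.
- by case=> [[|[|[|[|//]]]] ?] x; exact: normc_ge0.
- by case=> [[|[|[|[|//]]]] ?]; apply: mulr_ge0.
- by case=> [[|[|[|[|//]]]] ?].
- by case=> [[|[|[|[|//]]]] ?]; apply: Lnorm_jacobiZ_le.
- by case=> [[|[|[|[|//]]]] ?].
move=> x x0; rewrite ger0_norm ?normc_ge0 //.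
pose t (k : nat) := tri_form (kernel_bound alpha beta) A
  (nth (cst 0) [:: (fun z => K * normc (F z - f z)); (fun z => K * normc (F z - f z));
    (fun z => K * normc (f z)); (fun z => d * normc (f z))] k)
  (nth (cst 0) [:: (fun z => normc (G z - g z)); (fun z => normc (g z));
    (fun z => normc (G z - g z)); (fun z => normc (g z))] k) x.
rewrite [leRHS](sume_ord4 t); exact: (HK F G f g d x mF mG mf mg d0 x0).
Qed.

Lemma convolution0 x : conv (cst 0) (cst 0) x = 0.
Proof.
rewrite /convolution /cintegral /cst.
under eq_Rintegral do rewrite mulr0 mul0r /=.
under [X in (_ +i* X)%C]eq_Rintegral do rewrite mulr0 mul0r /=.
by rewrite /Rintegral integral0.
Qed.

Lemma cLnorm0 r : r != 0%E -> cLnorm alpha beta r (cst 0) = 0%E.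
Proof.
move=> r0; rewrite /cLnorm (_ : (fun x => _) = cst 0%E) ?Lnorm0 //.
by apply/funext => x; congr EFin; exact: ComplexField.Normc.normc0.
Qed.

Lemma convolution_extension : exists C : R, 0 < C /\
  forall f g : R -> R[i], inL alpha beta p%:E f -> inL alpha beta 2%:E g ->
  exists h : R -> R[i],
    [/\ is_convolution alpha beta p%:E 2%:E s f g h, inL alpha beta s h &
        (cLnorm alpha beta s h <=
          C%:E * cLnorm alpha beta p%:E f * cLnorm alpha beta 2%:E g)%E].
Proof.
have [K K0 HK] := cLnorm_convolutionB_le.
have p0 : 0 < p by have := p1; lra.
have fin r f : inL alpha beta r f -> cLnorm alpha beta r f = (fine (cLnorm alpha beta r
  f))%:E.
  by case=> _ _ ff; rewrite fineK // ge0_fin_numE // cLnorm_ge0.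
have fin0 r f : 0 <= fine (cLnorm alpha beta r f) by rewrite fine_ge0 // cLnorm_ge0.
have m0 : cmeasurable (cst (0 : R[i])) by split; exact: measurable_cst.
have cm r f : inL alpha beta r f -> cmeasurable f by case.
have bound f g : inL alpha beta p%:E f -> inL alpha beta 2%:E g ->
    (cLnorm alpha beta s (conv f g) <=
     (c * (K * (fine (cLnorm alpha beta p%:E f) * fine (cLnorm alpha beta 2%:E
       g))))%:E)%E.
  move=> Lf Lg; have sub0 (k : R -> R[i]) : (fun x => k x - cst 0 x) = k.
    by apply/funext => x; rewrite subr0.
  (* The bound for f and g is the difference estimate against zero functions, with n = m = 0. *)
  have := HK f g (cst 0) (cst 0) (fine (cLnorm alpha beta p%:E f))
    (fine (cLnorm alpha beta 2%:E g)) 0 0 (cm _ _ Lf) (cm _ _ Lg) m0 m0 (fin0 _ _)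
      (fin0 _ _)
    (lexx _) (lexx _).
  rewrite !sub0 -!fin // !cLnorm0 ?eqe ?gt_eqF //.
  rewrite (_ : (fun x => conv f g x - conv (cst 0) (cst 0) x) = conv f g); last first.
    by apply/funext => x; rewrite convolution0 subr0.
  by rewrite mulr0 mul0r !addr0; apply.
have inLconv f g : inL alpha beta p%:E f -> inL alpha beta 2%:E g ->
  inL alpha beta s (conv f g).
  move=> Lf Lg; have [m1 m2] := cmeasurable_convolution alpha beta (cm _ _ Lf) (cm _ _
    Lg).
  by split => //; apply: le_lt_trans (bound f g Lf Lg) (ltry _).
(* The 1 makes the constant positive even if c = 0. *)
exists (c * K + 1); split; first by rewrite ltr_wpDl // mulr_ge0 // ltW.
(* The limit is the integral formula evaluated at f and g, so completeness of L^s is not invoked. *)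
move=> f g Lf Lg; exists (conv f g); split; [split| |].
- have [F [CF cF]] := Cc_dense p1 Lf.
  have [G [CG cG]] := Cc_dense (ler1n _ 2) Lg.
  by exists F, G.
- move=> F G CF CG [LF _ cF] [LG _ cG].
  split; [by move=> n; exact: inLconv|exact: inLconv|].
  have /fine_cvgP[fF cvF] := cF; have /fine_cvgP[fG cvG] := cG.
  set a := fine \o _ in cvF; set b := fine \o _ in cvG.
  set n := fine (cLnorm alpha beta p%:E f); set m := fine (cLnorm alpha beta 2%:E g).
  apply: (@squeeze_cvge _ _ _ _ (fun=> 0%E) _
     (fun k => (c * (K * (a k * b k + a k * m + n * b k)))%:E)).
  + apply: filterS2 fF fG => k fFk fGk; rewrite cLnorm_ge0 /=.
    apply: HK; [exact: cm (LF k)|exact: cm (LG k)|exact: cm Lf|exact: cm Lg|exact: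
      fin0|exact: fin0|exact: fin0|exact: fin0| | | |].
    * by rewrite /a /= fineK.
    * by rewrite /b /= fineK.
    * by rewrite -fin.
    * by rewrite -fin.
  + exact: cvg_cst.
  + apply: cvg_EFin; first exact: nearW.
    rewrite (_ : 0 = c * (K * (0 * 0 + 0 * m + n * 0))); last by ring.
    apply: cvgM; first exact: cvg_cst.
    apply: cvgM; first exact: cvg_cst.
    apply: cvgD; last by apply: cvgM; [exact: cvg_cst|exact: cvG].
    by apply: cvgD; apply: cvgM; [exact: cvF|exact: cvG|exact: cvF|exact: cvg_cst].
- exact: inLconv.
- apply: (le_trans (bound f g Lf Lg)).
  rewrite {2}(fin _ _ Lf) {2}(fin _ _ Lg) -!EFinM lee_fin !mulrA.
  by rewrite ler_wpM2r // ler_wpM2r // lerDl.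
Qed.

End Bounded.
End Extension.

Theorem theorem5p1 (R : realType) (alpha beta : R)
    (hbeta : - 2^-1 <= beta) (halphabeta : beta <= alpha)
    (halpha : - 2^-1 < alpha) :
  (forall p : R, 1 <= p -> p < 2 ->
    exists Cp : R, 0 < Cp /\
      forall f g : R -> R[i],
        inL alpha beta p%:E f -> inL alpha beta 2%:E g ->
        exists h : R -> R[i],
          [/\ is_convolution alpha beta p%:E 2%:E 2%:E f g h,
              inL alpha beta 2%:E h &
              (cLnorm alpha beta 2%:E h <=
                Cp%:E * cLnorm alpha beta p%:E f *
                cLnorm alpha beta 2%:E g)%E]) /\
  (forall q : \bar R, (2%:E < q)%E ->
    exists Cq : R, 0 < Cq /\
      forall f g : R -> R[i],
        inL alpha beta 2%:E f -> inL alpha beta 2%:E g ->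
        exists h : R -> R[i],
          [/\ is_convolution alpha beta 2%:E 2%:E q f g h,
              inL alpha beta q h &
              (cLnorm alpha beta q h <=
                Cq%:E * cLnorm alpha beta 2%:E f *
                cLnorm alpha beta 2%:E g)%E]).
Proof.
split.
- move=> p p1 p2; have [c c0 hc] := tri_form_bounded_p_2 hbeta halphabeta halpha p1 p2.
  exact: (convolution_extension hbeta halphabeta halpha p1 c0 hc).
- move=> q q2; have [c c0 hc] := tri_form_bounded_2_r hbeta halphabeta halpha q2.
  exact: (convolution_extension hbeta halphabeta halpha (ler1n _ 2) c0 hc).
Qed.
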